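(* For every $\mu\in\mathcal{D}_c(1,* )$ there exists a unique $*$-distribution $\nu\in\mathcal{D}_c^{(\mathrm{inf\text{-}div})}(1,* )$ such that $R_\nu=\eta_\mu$. Moreover, the map $$\mathbb{B}_{(1,* )}:\mathcal{D}_c(1,* )\to\mathcal{D}_c^{(\mathrm{inf\text{-}div})}(1,* ),\qquad \mathbb{B}_{(1,* )}(\mu):=\nu,$$ that is, the map determined by the requirement that $R_{\mathbb{B}_{(1,* )}(\mu)}=\eta_\mu$ for all $\mu\in\mathcal{D}_c(1,* )$, is a bijection.
   Context: $\mathbb{C}\langle Z,Z^*\rangle$ is the algebra of complex polynomials in two non-commuting variables. $\mathcal{W}^+=\bigsqcup_{n\ge1}\{1,*\}^n$ is the set of non-empty words over $\{1,*\}$; for $w=(\ell_1,\dots,\ell_n)$ let $|w|=n$, $Z^w=Z^{\ell_1}\cdots Z^{\ell_n}$, $a^w=a^{\ell_1}\cdots a^{\ell_n}$ (with $a^1=a$), and $z^w=z^{\ell_1}\cdots z^{\ell_n}$ for non-commuting formal indeterminates $z,z^*$. A $C^*$-probability space $(\mathcal{A},\varphi)$ is a unital $C^*$-algebra with a positive linear functional $\varphi$ with $\varphi(1)=1$ (not assumed to be a trace). The $*$-distribution of $a\in\mathcal{A}$ is the linear functional $\mu$ on $\mathbb{C}\langle Z,Z^*\rangle$ with $\mu(1)=1$ and $\mu(Z^w)=\varphi(a^w)$, $w\in\mathcal{W}^+$. $\mathcal{D}_c(1,* )$ is the set of all functionals that are $*$-distributions of some element of some $C^*$-probability space. Free additive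 convolution $\boxplus$ on $\mathcal{D}_c(1,* )$: if $a,a'$ are in a $C^*$-probability space, with $\{a,a^*\}$ free from $\{a',(a')^*\}$, the $*$-distribution of $a+a'$ is $\mu\boxplus\mu'$, where $\mu,\mu'$ are the $*$-distributions of $a,a'$. $\mu\in\mathcal{D}_c(1,* )$ is $\boxplus$-infinitely divisible if for every $n\in\mathbb{N}$ there is $\mu_n\in\mathcal{D}_c(1,* )$ with $\mu=\mu_n\boxplus\cdots\boxplus\mu_n$ ($n$ times); the set of these is $\mathcal{D}_c^{(\mathrm{inf\text{-}div})}(1,* )$. For $\mu\in\mathcal{D}_c(1,* )$: the moment series is $M_\mu=\sum_{w\in\mathcal{W}^+}\mu(Z^w)z^w$; the $\eta$-series is $\eta_\mu=M_\mu(1+M_\mu)^{-1}$; the $R$-transform $R_\mu$ is the unique formal power series in non-commuting $z,z^*$ with zero constant term such that, for every $w\in\mathcal{W}^+$ with $|w|=n$, $\mu(Z^w)=\sum_{\pi\in NC(n)}\prod_{B\in\pi}\mathrm{Cf}_{w|B}(R_\mu)$, where $NC(n)$ is the set of non-crossing partitions of $\{1,\dots,n\}$, $\mathrm{Cf}_v(f)$ is the coefficient of $z^v$ in $f$, and for $B=\{b_1<\dots<b_m\}$, $w|B=(\ell_{b_1},\dots,\ell_{b_m})$. *)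

(* Defs.v *)
From HB Require Import structures.
From mathcomp Require Import all_boot all_order all_algebra.
From mathcomp Require Import complex monalg.
From mathcomp Require Import boolp classical_sets functions reals topology normedtype.

Set Implicit Arguments.
Unset Strict Implicit.
Unset Printing Implicit Defensive.

Import Order.TTheory GRing.Theory Num.Theory.
Import numFieldNormedType.Exports.

Local Open Scope classical_set_scope.
Local Open Scope complex_scope.
Local Open Scope ring_scope.

(* The letter [false] stands for 1 and the letter [true] stands for *, so that
   words over {1, *} are elements of [seq bool]; the set W^+ consists of the
   words different from [::]. *)
Notation word := (seq bool).

(* [{fmonom bool}] is the free monoid on two letters, hence [ncpoly R] is the
   monoid algebra C<Z, Z*>. *)
Notation ncpoly R := {malg R[i][{fmonom bool}]}.

Definition ncvar (R : realType) (l : bool) : ncpoly R := mkmalgU (FMonom [:: l]) 1.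

Definition Zpow (R : realType) (w : word) : ncpoly R := \prod_(l <- w) ncvar R l.

Lemma ZpowE (R : realType) (w : word) : Zpow R w = mkmalgU (FMonom w) 1.
Proof.
rewrite /Zpow; elim: w => [|l w IHw].
  by rewrite big_nil -fmoneE.
rewrite big_cons IHw malgM_def fgmulUU mulr1.
by congr (mkmalgU _ 1); rewrite /mmul /= fmmulE.
Qed.

(* The norm is a field of the mixin, rather than inherited from
   [normedModType R[i]], because MathComp's hierarchy has no join of normed
   modules and rings below [numDomainType]. An [algType] is a nonzero ring; this
   is no restriction here, as a C*-algebra carrying a state is nonzero. *)
HB.mixin Record isCStarAlgebra (R : realType) A of GRing.Algebra R[i] A := {
  star : A -> A;
  cnorm : A -> R;
  starK : involutive star;
  starD : {morph star : x y / x + y};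
  starZ : forall (c : R[i]) x, star (c *: x) = Num.conj c *: star x;
  starM : forall x y, star (x * y) = star y * star x;
  cnorm_eq0 : forall x, cnorm x = 0 -> x = 0;
  cnormD_le : forall x y, cnorm (x + y) <= cnorm x + cnorm y;
  cnormZ : forall (c : R[i]) x, (cnorm (c *: x))%:C = `|c| * (cnorm x)%:C;
  cnormM_le : forall x y, cnorm (x * y) <= cnorm x * cnorm y;
  cnorm_star_mul : forall x, cnorm (star x * x) = cnorm x ^+ 2;
  cnorm_complete : forall u : nat -> A,
    (forall e : R, 0 < e -> exists N : nat, forall m n : nat,
       (N <= m)%N -> (N <= n)%N -> cnorm (u m - u n) < e) ->
    exists l : A, cnorm (u n - l) @[n --> \oo] --> (0 : R)
}.

#[short(type="cstarAlgType")]
HB.structure Definition CStarAlgebra (R : realType) :=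
  {A of isCStarAlgebra R A & GRing.Algebra R[i] A}.

Record cstarProbSpace (R : realType) := CStarProbSpace {
  cps_alg :> cstarAlgType R;
  state : {scalar cps_alg};
  state_ge0 : forall x : cps_alg, 0 <= state (star x * x);
  state1 : state 1 = 1
}.

Definition star_pow (R : realType) (A : cstarAlgType R) (a : A) (w : word) : A :=
  \prod_(l <- w) (if l then star a else a).

Definition is_star_distribution (R : realType) (P : cstarProbSpace R) (a : P)
    (mu : ncpoly R -> R[i]) : Prop :=
  [/\ scalar mu, mu 1 = 1
    & forall w : word, w != [::] -> mu (Zpow R w) = state P (star_pow a w)].

Definition Dc (R : realType) : set (ncpoly R -> R[i]) :=
  [set mu | exists (P : cstarProbSpace R) (a : P), is_star_distribution a mu].

Arguments Dc : clear implicits.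

Definition unital_subalgebra (R : realType) (A : cstarAlgType R) : set (set A) :=
  [set B | [/\ B 1, forall x y, B x -> B y -> B (x + y),
               forall (c : R[i]) x, B x -> B (c *: x)
             & forall x y, B x -> B y -> B (x * y)]].

Definition gen_alg (R : realType) (A : cstarAlgType R) (S : set A) : set A :=
  smallest (@unital_subalgebra R A) S.

Definition free_sets (R : realType) (P : cstarProbSpace R) (I : Type)
    (S : I -> set P) : Prop :=
  forall (n : nat) (i : nat -> I) (x : nat -> P),
    (0 < n)%N ->
    (forall k, (k < n)%N -> gen_alg (S (i k)) (x k)) ->
    (forall k, (k < n)%N -> state P (x k) = 0) ->
    (forall k, (k.+1 < n)%N -> i k <> i k.+1) ->
    state P (\prod_(k < n) x k) = 0.

Definition star_free (R : realType) (P : cstarProbSpace R) (a a' : P) : Prop :=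
  free_sets (fun b : bool => if b then [set a'; star a'] else [set a; star a]).

(* The graph of the operation (mu, mu') |-> mu [+] mu'. *)
Definition is_boxplus (R : realType) (mu mu' rho : ncpoly R -> R[i]) : Prop :=
  exists (P : cstarProbSpace R) (a a' : P),
    [/\ star_free a a', is_star_distribution a mu,
        is_star_distribution a' mu' & is_star_distribution (a + a') rho].

(* [is_boxplus_iter mu k rho]: rho is mu [+] ... [+] mu with k.+1 terms. *)
Fixpoint is_boxplus_iter (R : realType) (mu : ncpoly R -> R[i]) (k : nat)
    (rho : ncpoly R -> R[i]) : Prop :=
  if k is k'.+1 then
    exists2 sigma, is_boxplus_iter mu k' sigma & is_boxplus sigma mu rho
  else rho = mu.

Definition Dc_infdiv (R : realType) : set (ncpoly R -> R[i]) :=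
  [set mu | Dc R mu /\
     forall n : nat, (0 < n)%N ->
       exists2 mu_n, Dc R mu_n & is_boxplus_iter mu_n n.-1 mu].

Arguments Dc_infdiv : clear implicits.

(* Formal power series in two non-commuting indeterminates; [f w] is the
   coefficient of z^w in f. *)
Definition ncseries (K : nzRingType) : Type := word -> K.

Section NCSeries.
Variable K : nzRingType.
Implicit Types f g h : ncseries K.

HB.instance Definition _ := GRing.Zmodule.copy (ncseries K) (word -> K).

Definition ncs_one : ncseries K := fun w => (w == [::])%:R.

Definition ncs_mul f g : ncseries K :=
  fun w => \sum_(i < (size w).+1) f (take i w) * g (drop i w).

Lemma ncs_addE f g w : (f + g) w = f w + g w. Proof. by []. Qed.
Lemma ncs_oppE f w : (- f) w = - f w. Proof. by []. Qed.
Lemma ncs_zeroE w : (0 : ncseries K) w = 0. Proof. by []. Qed.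

Lemma ncs_mulA : associative ncs_mul.
Proof.
move=> f g h; apply/funext => w; rewrite /ncs_mul.
under eq_bigr => i _ do rewrite mulr_sumr.
under [RHS]eq_bigr => i _ do rewrite mulr_suml.
have H1 : \sum_(i < (size w).+1) \sum_(j < (size (drop i w)).+1)
     f (take i w) * (g (take j (drop i w)) * h (drop j (drop i w)))
   = \sum_(0 <= i < (size w).+1) \sum_(0 <= k < (size w).+1 | (i <= k)%N)
     f (take i w) * (g (take (k - i) (drop i w)) * h (drop k w)).
  rewrite big_mkord; apply: eq_bigr => i _.
  rewrite -(big_mkord predT (fun j => f (take i w) *
     (g (take j (drop i w)) * h (drop j (drop i w))))).
  rewrite size_drop -subSn; last by rewrite -ltnS.
  transitivity (\sum_(i <= k < (size w).+1)
      f (take i w) * (g (take (k - i) (drop i w)) * h (drop k w))).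
    have shift (n m : nat) (F : nat -> K) :
        \sum_(m <= k < n) F k = \sum_(0 <= k < n - m) F (k + m)%N.
      by rewrite -{1}[m]add0n big_addn.
    rewrite [RHS]shift.
    by apply: eq_bigr => k _; rewrite addnK drop_drop.
  by rewrite (big_nat_widenl _ 0%N).
have H2 : \sum_(k < (size w).+1) \sum_(i < (size (take k w)).+1)
     f (take i (take k w)) * g (drop i (take k w)) * h (drop k w)
   = \sum_(0 <= k < (size w).+1) \sum_(0 <= i < (size w).+1 | (i <= k)%N)
     f (take i w) * (g (take (k - i) (drop i w)) * h (drop k w)).
  rewrite big_mkord; apply: eq_bigr => k _.
  rewrite size_takel; last by rewrite -ltnS.
  rewrite -(big_mkord predT (fun i => f (take i (take k w)) *
     g (drop i (take k w)) * h (drop k w))).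
  rewrite (big_nat_widen _ _ (size w).+1); last exact: ltn_ord.
  apply: eq_bigr => i /=; rewrite ltnS => ik.
  by rewrite take_takel// -mulrA take_drop subnK.
rewrite [LHS]H1 [RHS]H2.
by rewrite (exchange_big_dep_nat predT).
Qed.

Lemma ncs_mul1 : left_id ncs_one ncs_mul.
Proof.
move=> f; apply/funext => w; rewrite /ncs_mul big_ord_recl /= take0 drop0.
rewrite /ncs_one eqxx mul1r big1 ?addr0// => i _.
by case: w i => [|b w] i; [case: i | rewrite /= mul0r].
Qed.

Lemma ncs_mulr1 : right_id ncs_one ncs_mul.
Proof.
move=> f; apply/funext => w; rewrite /ncs_mul big_ord_recr /= take_size drop_size.
rewrite /ncs_one eqxx mulr1 big1 ?add0r// => i _.
by rewrite -size_eq0 size_drop subn_eq0 leqNgt ltn_ord mulr0.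
Qed.

Lemma ncs_mulDl : left_distributive ncs_mul +%R.
Proof.
move=> f g h; apply/funext => w; rewrite ncs_addE /ncs_mul -big_split /=.
by apply: eq_bigr => i _; rewrite ncs_addE mulrDl.
Qed.

Lemma ncs_mulDr : right_distributive ncs_mul +%R.
Proof.
move=> f g h; apply/funext => w; rewrite ncs_addE /ncs_mul -big_split /=.
by apply: eq_bigr => i _; rewrite ncs_addE mulrDr.
Qed.

Lemma ncs_one_neq0 : ncs_one != 0.
Proof.
apply/eqP => /(congr1 (fun f => f [::])) /eqP.
by rewrite ncs_zeroE /ncs_one eqxx oner_eq0.
Qed.

HB.instance Definition _ := GRing.Zmodule_isNzRing.Build (ncseries K)
  ncs_mulA ncs_mul1 ncs_mulr1 ncs_mulDl ncs_mulDr ncs_one_neq0.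

Definition ncs_unit : {pred ncseries K} := fun f => `[< exists g, g * f = 1 /\ f * g = 1 >].

Definition ncs_inv f : ncseries K :=
  if pselect (exists g, g * f = 1 /\ f * g = 1) is left e then sval (cid e) else f.

Lemma ncs_mulVr : {in ncs_unit, left_inverse 1 ncs_inv *%R}.
Proof.
move=> f /asboolP fU; rewrite /ncs_inv; case: pselect => // e.
by case: cid => g [].
Qed.

Lemma ncs_divrr : {in ncs_unit, right_inverse 1 ncs_inv *%R}.
Proof.
move=> f /asboolP fU; rewrite /ncs_inv; case: pselect => // e.
by case: cid => g [].
Qed.

Lemma ncs_unitP f g : g * f = 1 /\ f * g = 1 -> ncs_unit f.
Proof. by move=> fg; apply/asboolP; exists g. Qed.

Lemma ncs_inv_out : {in [predC ncs_unit], ncs_inv =1 id}.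
Proof.
move=> f /negP fU; rewrite /ncs_inv; case: pselect => // e.
by exfalso; apply: fU; apply/asboolP.
Qed.

HB.instance Definition _ := GRing.NzRing_hasMulInverse.Build (ncseries K)
  ncs_mulVr ncs_divrr ncs_unitP ncs_inv_out.

Lemma ncs_oneE w : (1 : ncseries K) w = (w == [::])%:R. Proof. by []. Qed.

Lemma ncs_mulE f g w :
  (f * g) w = \sum_(i < (size w).+1) f (take i w) * g (drop i w).
Proof. by []. Qed.

Lemma ncs_exp_small f k w : f [::] = 0 -> (size w < k)%N -> (f ^+ k) w = 0.
Proof.
move=> f0; elim: k w => // k IHk w wk.
rewrite exprS ncs_mulE big1// => i _.
have [i0|i0] := posnP i; first by rewrite i0 take0 f0 mul0r.
have w0 : (0 < size w)%N by rewrite (leq_trans i0)// -ltnS.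
rewrite IHk ?mulr0// size_drop (@leq_trans (size w))//.
by rewrite ltn_subrL i0.
Qed.

Lemma ncs_unit1D f : f [::] = 0 -> (1 + f : ncseries K) \is a GRing.unit.
Proof.
move=> f0; pose u : ncseries K := - f.
have u0 : u [::] = 0 by rewrite /u ncs_oppE f0 oppr0.
pose g : ncseries K := fun w => (\sum_(k < (size w).+1) u ^+ k) w.
have sumE n w : (\sum_(k < n) u ^+ k) w = \sum_(k < n) (u ^+ k) w.
  by elim: n => [|n IHn]; rewrite ?big_ord0// !big_ord_recr/= ncs_addE IHn.
have gE n w : (size w < n)%N -> g w = (\sum_(k < n) u ^+ k) w.
  move=> wn; rewrite /g !sumE.
  rewrite -(big_mkord predT (fun k => (u ^+ k) w)).
  rewrite -[RHS](big_mkord predT (fun k => (u ^+ k) w)).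
  rewrite [RHS](@big_cat_nat _ _ _ (size w).+1)//=.
  rewrite [X in _ = _ + X]big_nat_cond [X in _ = _ + X]big1 ?addr0//.
  by move=> k; rewrite andbT => /andP[wk _]; rewrite ncs_exp_small.
have -> : 1 + f = 1 - u by rewrite /u opprK.
have tele n : (1 - u) * (\sum_(k < n) u ^+ k) = 1 - u ^+ n.
  by rewrite -(opprB (u ^+ n)) subrX1 -mulNr opprB.
have teler n : (\sum_(k < n) u ^+ k) * (1 - u) = 1 - u ^+ n.
  rewrite -tele; apply/commr_sym; apply: GRing.commr_sum => i _.
  by apply/commr_sym/commrB; [exact: commr1 | exact/commr_sym/commrX].
suff gU : g * (1 - u) = 1 /\ (1 - u) * g = 1 by apply: (ncs_unitP gU).
split; apply/funext => w.
- transitivity (((\sum_(k < (size w).+1) u ^+ k) * (1 - u)) w).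
    rewrite !ncs_mulE; apply: eq_bigr => i _; congr (_ * _).
    by apply: gE; rewrite size_take_min ltnS geq_minr.
  by rewrite teler ncs_addE ncs_oppE ncs_exp_small// subr0.
- transitivity (((1 - u) * (\sum_(k < (size w).+1) u ^+ k)) w).
    rewrite !ncs_mulE; apply: eq_bigr => i _; congr (_ * _).
    by apply: gE; rewrite size_drop ltnS leq_subr.
  by rewrite tele ncs_addE ncs_oppE ncs_exp_small// subr0.
Qed.

End NCSeries.

Definition moment_series (R : realType) (mu : ncpoly R -> R[i]) : ncseries R[i] :=
  fun w => if w == [::] then 0 else mu (Zpow R w).

Definition eta_series (R : realType) (mu : ncpoly R -> R[i]) : ncseries R[i] :=
  moment_series mu * (1 + moment_series mu)^-1.

Lemma eta_seriesM (R : realType) (mu : ncpoly R -> R[i]) :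
  eta_series mu * (1 + moment_series mu) = moment_series mu.
Proof. by rewrite /eta_series mulrVK//; apply: ncs_unit1D. Qed.

Definition noncrossing (n : nat) (P : {set {set 'I_n}}) : bool :=
  [forall B in P, forall B' in P, (B != B') ==>
     ~~ [exists a in B, exists b in B', exists c in B, exists d in B',
           [&& a < b, b < c & c < d]%N]].

Definition NC (n : nat) : {set {set {set 'I_n}}} :=
  [set P | finset.partition P [set: 'I_n] & noncrossing P].

(* [enum B] lists B in increasing order. *)
Definition subword (w : word) (B : {set 'I_(size w)}) : word :=
  [seq tnth (in_tuple w) i | i <- enum B].

Definition is_R_transform (R : realType) (mu : ncpoly R -> R[i])
    (f : ncseries R[i]) : Prop :=
  f [::] = 0 /\
  forall w : word, w != [::] ->
    mu (Zpow R w) = \sum_(P in NC (size w)) \prod_(B in P) f (subword B).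

Definition R_transform (R : realType) (mu : ncpoly R -> R[i]) : ncseries R[i] :=
  xget 0 [set f | is_R_transform mu f].

Lemma size_subword (w : word) (B : {set 'I_(size w)}) :
  size (subword B) = #|B|.
Proof. by rewrite /subword size_map cardE. Qed.

Lemma subwordT (w : word) : subword [set: 'I_(size w)]%SET = w.
Proof.
rewrite /subword enum_setT -enumT.
by rewrite (map_tnth_enum (in_tuple w)).
Qed.

Lemma NC_setT (n : nat) : (0 < n)%N -> [set [set: 'I_n]]%SET \in NC n.
Proof.
move=> n0; rewrite inE; apply/andP; split.
  apply/and3P; split.
  - by rewrite /finset.cover big_set1.
  - by rewrite /finset.trivIset /finset.cover !big_set1.
  - rewrite inE; apply/eqP => /(congr1 (fun A : {set _} => #|A|)).
    by rewrite cards0 cardsT card_ord => n00; rewrite -n00 in n0.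
apply/forall_inP => B /finset.set1P->; apply/forall_inP => B' /finset.set1P->.
by rewrite eqxx.
Qed.

Lemma NC_card_lt (n : nat) (P : {set {set 'I_n}}) (B : {set 'I_n}) :
  P \in NC n -> P != [set [set: 'I_n]]%SET -> B \in P -> (#|B| < n)%N.
Proof.
rewrite inE => /andP[/and3P[/eqP coverP trivP P0] _] PT BP.
have [BT|BT] := eqVneq B [set: 'I_n]%SET; last first.
  by rewrite -[X in (_ < X)%N]card_ord -cardsT proper_card// finset.properT.
exfalso; move/eqP: PT; apply; apply/finset.setP => C; rewrite !inE.
apply/idP/eqP => [CP|->]; last by rewrite -BT.
apply/eqP; apply: contraT; rewrite -BT => CB.
have /(_ C B CP BP CB) := finset.trivIsetP trivP.
rewrite BT -finset.setI_eq0 finset.setIT => C0.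
by rewrite (eqP C0) (negbTE P0) in CP.
Qed.

Section RTransform.
Variables (R : realType) (mu : ncpoly R -> R[i]).

Let rest (f : word -> R[i]) (w : word) : R[i] :=
  \sum_(P in NC (size w) | P != [set [set: 'I_(size w)]]%SET)
     \prod_(B in P) f (subword B).

Let sum_rest (f : word -> R[i]) (w : word) : w != [::] ->
  \sum_(P in NC (size w)) \prod_(B in P) f (subword B) = f w + rest f w.
Proof.
move=> w0; rewrite (bigD1 [set [set: 'I_(size w)]]%SET)/=; last first.
  by apply: NC_setT; rewrite lt0n size_eq0.
by rewrite big_set1 subwordT.
Qed.

Let rest_eq (f g : word -> R[i]) (w : word) :
  (forall v : word, (size v < size w)%N -> f v = g v) -> rest f w = rest g w.
Proof.
move=> fg; apply: eq_bigr => P /andP[PN PT]; apply: eq_bigr => B BP.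
by apply: fg; rewrite size_subword (NC_card_lt PN).
Qed.

Let fixpt (n : nat) : word -> R[i] :=
  iter n (fun f w => if w == [::] then 0 else mu (Zpow R w) - rest f w) (fun=> 0).

Let fixpt_stable (n m : nat) (w : word) :
  (size w < n)%N -> (size w < m)%N -> fixpt n w = fixpt m w.
Proof.
elim: n m w => // n IHn [//|m] w wn wm /=.
case: eqP => // _; congr (_ - _); apply: rest_eq => v vw.
by apply: IHn; [exact: leq_trans vw _ | exact: leq_trans vw _].
Qed.

Lemma is_R_transform_ex : exists f, is_R_transform mu f.
Proof.
pose f w := fixpt (size w).+1 w; exists f; split=> [//|w w0].
rewrite (sum_rest f)// {1}/f /= (negbTE w0).
rewrite -[LHS](subrK (rest (fixpt (size w)) w)).
congr (_ + _); apply: rest_eq => v vw; exact: fixpt_stable.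
Qed.

Lemma is_R_transform_uniq f g :
  is_R_transform mu f -> is_R_transform mu g -> f = g.
Proof.
move=> [f0 fmu] [g0 gmu]; apply/funext => w.
have [n] := ubnP (size w); elim: n w => // n IHn w wn.
have [->|w0] := eqVneq w [::]; first by rewrite f0 g0.
have := fmu w w0; rewrite gmu// !sum_rest// (@rest_eq f g).
  by move/addIr.
by move=> v vw; apply: IHn; rewrite (leq_trans vw).
Qed.

Lemma R_transformP : is_R_transform mu (R_transform mu).
Proof. by case: is_R_transform_ex => f; exact: (xgetI 0). Qed.

Lemma R_transformE f : is_R_transform mu f -> R_transform mu = f.
Proof. exact: is_R_transform_uniq R_transformP. Qed.

End RTransform.

(* Main.v *)
(* By the GNS construction, a unital functional is a *-distribution iff its word
   moments are exponentially bounded and positive. Both sides of the bijection are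
   parametrised by the same series k: the hermitian, exponentially bounded ones
   for which (u, v) |-> k (u^* v) is positive on non-empty words.
   - R-transforms: creation, preservation and annihilation operators on the full
     Fock space over the polynomials without constant term, with inner product
     given by k, have free cumulants k, and k/n is of the same kind; conversely the
     R-transform of an infinitely divisible distribution is the limit of the
     functionals n mu_n on words.
   - eta-series: eta (u^* v) = phi (b_u^* b_v) where b_(l v) is the centring of
     a_l b_v; conversely the direct sum of the scalars and that one-particle space
     carries an element with eta-series k. *)

Require Import Defs.
From HB Require Import structures.
From mathcomp Require Import all_boot all_order all_algebra.
From mathcomp Require Import complex monalg.
From mathcomp Require Import boolp classical_sets functions reals topology normedtype.
From mathcomp Require Import ring lra zify finmap.

Set Implicit Arguments.
Unset Strict Implicit.
Unset Printing Implicit Defensive.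
Import Order.TTheory GRing.Theory Num.Theory.
Import numFieldNormedType.Exports.
Local Open Scope ring_scope.

(** * Moments and free cumulants on the Fock space *)

(** The hub is the functional equation [free_moments], A = F(zA) with F = 1 + f. It has one
    solution, so sums over non-crossing partitions, vacuum moments on the Fock space and moments of
    sums of free elements are compared through it. No Hilbert space operator is built: positivity of
    moments only needs operators that send a basis element to a finite combination and are adjoint
    for a positive kernel, and C*-algebras are produced only by the GNS step, from word moments.
    There left multiplications must be bounded before an operator norm exists; the exponential bound
    on moments supplies this through iterated Cauchy-Schwarz. Conversely a state on an abstract
    C*-algebra must be shown to be bounded, which takes a square root of 1 - y. The limit of n mu_n
    is taken word by word, so it gives symmetry and positivity of the cumulants but no exponential
    bound; that bound comes from the moments of nu itself, by writing F as the inverse of the moment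
    series whose cumulants are A^-1. *)

Section WordSeries.
Variables (K : comNzRingType) (X : Type).
Implicit Types (f g h : seq X -> K) (w : seq X).

Definition dword (l : X) f : seq X -> K := fun w => f (l :: w).

(** The product of series, by recursion on the word instead of a sum over cut points, so that
    inductions on words unfold it one letter at a time. *)
Fixpoint conv f g w : K :=
  if w is l :: w' then conv (dword l f) g w' + f [::] * g w
  else f [::] * g [::].

Definition delta0 w : K := (nilp w)%:R.

Lemma conv_eq n f f' g g' w :
  (forall v, (size v <= n)%N -> f v = f' v) ->
  (forall v, (size v <= n)%N -> g v = g' v) ->
  (size w <= n)%N -> conv f g w = conv f' g' w.
Proof.
elim: w n f f' => [|l w IHw] n f f' ff gg /= wn; first by rewrite ff// gg.
case: n ff gg wn => // n ff gg wn.
rewrite (IHw n (dword l f) (dword l f')) ?ff ?gg//.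
- by move=> v vn; apply: ff.
- by move=> v vn; apply: gg; apply: leqW.
Qed.

Lemma conv_ext f f' g g' : f =1 f' -> g =1 g' -> conv f g =1 conv f' g'.
Proof. by move=> ff gg w; apply: (@conv_eq (size w)). Qed.

Lemma convDl f f' g w :
  conv (fun v => f v + f' v) g w = conv f g w + conv f' g w.
Proof.
elim: w f f' => [|l w IHw] f f' /=; first by rewrite mulrDl.
by rewrite [LHS](congr2 _ (IHw _ _) erefl) mulrDl addrACA.
Qed.

Lemma convDr f g g' w :
  conv f (fun v => g v + g' v) w = conv f g w + conv f g' w.
Proof.
elim: w f => [|l w IHw] f /=; first by rewrite mulrDr.
by rewrite IHw mulrDr addrACA.
Qed.

Lemma convZl c f g w : conv (fun v => c * f v) g w = c * conv f g w.
Proof.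
elim: w f => [|l w IHw] f /=; first by rewrite mulrA.
by rewrite [LHS](congr2 _ (IHw _) erefl) mulrDr mulrA.
Qed.

Lemma convZr c f g w : conv f (fun v => c * g v) w = c * conv f g w.
Proof.
elim: w f => [|l w IHw] f /=; first by rewrite mulrCA.
by rewrite IHw mulrDr (mulrCA c).
Qed.

Lemma conv0r f g w : g =1 (fun=> 0) -> conv f g w = 0.
Proof.
move=> g0; elim: w f => [|l w IHw] f /=; first by rewrite g0 mulr0.
by rewrite IHw g0 mulr0 addr0.
Qed.

Lemma conv0l f g w : f =1 (fun=> 0) -> conv f g w = 0.
Proof.
elim: w f => [|l w IHw] f f0 /=; first by rewrite f0 mul0r.
by rewrite IHw ?f0 ?mul0r ?addr0// => v; apply: f0.
Qed.

Lemma conv1l f w : conv delta0 f w = f w.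
Proof.
case: w => [|l w] /=; first by rewrite mul1r.
by rewrite conv0l ?add0r ?mul1r// => v.
Qed.

Lemma convA f g h w : conv f (conv g h) w = conv (conv f g) h w.
Proof.
elim: w f g => [|l w IHw] f g /=; first by rewrite mulrA.
rewrite IHw (@conv_ext (dword l (conv f g))
  (fun v => conv (dword l f) g v + f [::] * dword l g v) h h)//.
by rewrite convDl convZl -addrA mulrDr mulrA.
Qed.

(* Substitution of [z_l * H] for every letter [z_l] in [f]; the first argument
   is fuel for the recursion. *)
Fixpoint subst_rec (n : nat) (H f : seq X -> K) w : K :=
  if w is l :: w' then
    if n is n'.+1 then conv H (subst_rec n' H (dword l f)) w' else 0
  else f [::].

Definition subst (H f : seq X -> K) w : K := subst_rec (size w) H f w.

Lemma subst_rec_eq n m H f w : (size w <= n)%N -> (size w <= m)%N ->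
  subst_rec n H f w = subst_rec m H f w.
Proof.
elim: n m f w => [|n IHn] [|m] f [|l w] //= wn wm.
apply: (@conv_eq (size w)) => // v vw.
by apply: IHn; [exact: leq_trans vw _ | exact: leq_trans vw _].
Qed.

Lemma subst_nil H f : subst H f [::] = f [::]. Proof. by []. Qed.

Lemma dword_subst l H f w :
  dword l (subst H f) w = conv H (subst H (dword l f)) w.
Proof.
apply: (@conv_eq (size w)) => // v vw.
exact: subst_rec_eq.
Qed.

Lemma subst_cons l H f w : subst H f (l :: w) = conv H (subst H (dword l f)) w.
Proof. exact: dword_subst. Qed.

Lemma subst_eq n H H' f f' w :
  (forall v, (size v < n)%N -> H v = H' v) ->
  (forall v, (size v <= n)%N -> f v = f' v) ->
  (size w <= n)%N -> subst H f w = subst H' f' w.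
Proof.
elim: n f f' w => [|n IHn] f f' [|l w] HH ff wn //.
- by rewrite !subst_nil ff.
- by rewrite !subst_nil ff.
rewrite !subst_cons; apply: (@conv_eq n) => // v vn.
apply: IHn => // u un; first by apply: HH; apply: leqW.
exact: ff.
Qed.

Lemma subst_ext H H' f f' : H =1 H' -> f =1 f' -> subst H f =1 subst H' f'.
Proof. by move=> HH ff w; apply: (@subst_eq (size w)). Qed.

Lemma substD H f g w :
  subst H (fun v => f v + g v) w = subst H f w + subst H g w.
Proof.
have [n] := ubnP (size w); elim: n f g w => // n IHn f g [|l w] wn //.
rewrite !subst_cons -convDr; apply: (@conv_eq (size w)) => // v vw.
by rewrite -IHn// (leq_ltn_trans vw).
Qed.

Lemma substZ H c g w : subst H (fun v => c * g v) w = c * subst H g w.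
Proof.
have [n] := ubnP (size w); elim: n g w => // n IHn g [|l w] wn //.
rewrite !subst_cons.
rewrite -convZr; apply: (@conv_eq (size w)) => // v vw.
by rewrite -IHn// (leq_ltn_trans vw).
Qed.

(** The left derivative of a product obeys the same two-term rule before and after substitution,
    since [dword l] of [subst H f] is H times the substituted derivative. *)
Lemma substM H f g w : subst H (conv f g) w = conv (subst H f) (subst H g) w.
Proof.
have [n] := ubnP (size w); elim: n f g w => // n IHn f g [|l w] wn //=.
rewrite subst_cons.
rewrite (@conv_eq (size w) H H _
  (fun v => conv (subst H (dword l f)) (subst H g) v
            + f [::] * subst H (dword l g) v))//; last first.
  move=> v vw; rewrite -substZ -IHn; last exact: leq_ltn_trans vw _.
  exact: substD.
rewrite convDr convA convZr -dword_subst; congr (_ + _).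
by apply: conv_ext => // v; rewrite -dword_subst.
Qed.

(** Replacing z_l by z_l H' in z_l H gives z_l H' H(zH'). *)
Lemma subst_subst H H' f w :
  subst H' (subst H f) w = subst (conv H' (subst H' H)) f w.
Proof.
have [n] := ubnP (size w); elim: n f w => // n IHn f [|l w] wn //=.
rewrite !subst_cons -convA; apply: (@conv_eq (size w)) => // v vw.
rewrite (@subst_ext H' H' _ (conv H (subst H (dword l f))))//; last first.
  by move=> u; rewrite -dword_subst.
rewrite substM; apply: (@conv_eq (size v)) => // u uv.
by apply: IHn; rewrite (leq_ltn_trans _ (wn : (size w < n)%N))// (leq_trans uv).
Qed.

Lemma subst_delta0 f w : subst delta0 f w = f w.
Proof.
elim: w f => [|l w IHw] f //; rewrite subst_cons conv1l; exact: IHw.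
Qed.

Lemma subst0 H f w : f =1 (fun=> 0) -> subst H f w = 0.
Proof.
move=> f0; rewrite (@subst_ext H H f (fun v => 0 * f v))// ?substZ ?mul0r//.
by move=> v; rewrite f0 mulr0.
Qed.

Lemma subst1 H w : subst H delta0 w = delta0 w.
Proof.
by case: w => [|l w] //; rewrite subst_cons conv0r// => v; apply: subst0.
Qed.

(* [A] is the moment series with free cumulants [f]: the letter [l] opening a
   word starts a block, and what follows it up to the next letter of the block
   is an independent word. *)
Definition free_moments (f A : seq X -> K) :=
  A [::] = 1 /\ forall l w, A (l :: w) = conv A (subst A (dword l f)) w.

(** The equation gives A on a word of length n + 1 from its values on words of length at most n, and
    reads f on non-empty words only. *)
Lemma free_moments_uniq f f' A A' : (forall l w, f (l :: w) = f' (l :: w)) ->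
  free_moments f A -> free_moments f' A' -> A =1 A'.
Proof.
move=> ff [A0 AS] [A'0 A'S] w.
have [n] := ubnP (size w); elim: n w => // n IHn [|l w] wn; first by rewrite A0.
rewrite AS A'S; apply: (@conv_eq (size w)) => // v vw.
  by apply: IHn; rewrite (leq_ltn_trans vw).
apply: (@subst_eq (size w)) => // u uw; last exact: ff.
by apply: IHn; rewrite (ltn_trans uw).
Qed.

End WordSeries.

(* The full Fock space over the polynomials without constant term has as basis
   the stacks of non-empty words, the word [x :: r] being stored as [(x, r)].
   [fock_dual l] is the transpose of the operator that creates [[:: l]] on top
   of the stack, prepends [l] to the top word, removes the top word [v] with
   coefficient [f (l :: v)], and adds the scalar [f [:: l]]. *)
Section Fock.
Variables (K : comNzRingType) (X : Type) (f : seq X -> K).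
Notation stack := (seq (X * seq X)).
Implicit Types (g : seq X -> K) (h : stack -> K) (w : seq X) (s : stack).

Definition fock_dual l h s : K :=
  h ((l, [::]) :: s) + f [:: l] * h s +
  if s is (x, r) :: s' then h ((l, x :: r) :: s') + f (l :: x :: r) * h s'
  else 0.

(** The leftmost letter acts first on the bra h, so [mom w] is the vacuum expectation of the product
    of the operators in the order of w. *)
Definition fock w h : stack -> K := foldl (fun h l => fock_dual l h) h w.

Definition vacuum s : K := (nilp s)%:R.

Definition mom w : K := fock w vacuum [::].

Lemma fock_ext w h h' : h =1 h' -> fock w h =1 fock w h'.
Proof. by move=> /funext->. Qed.

Lemma fock_cons l w h : fock (l :: w) h = fock w (fock_dual l h).
Proof. by []. Qed.

Lemma fock_cat w w' h : fock (w ++ w') h = fock w' (fock w h).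
Proof. exact: foldl_cat. Qed.

Lemma fockD w h h' s :
  fock w (fun t => h t + h' t) s = fock w h s + fock w h' s.
Proof.
elim: w h h' => [|l w IHw] h h' //; rewrite !fock_cons -IHw.
apply: fock_ext => -[|[x r] t]; rewrite /fock_dual ?addr0; ring.
Qed.

Lemma fockZ w c h s : fock w (fun t => c * h t) s = c * fock w h s.
Proof.
elim: w h => [|l w IHw] h //; rewrite !fock_cons -IHw.
apply: fock_ext => -[|[x r] t]; rewrite /fock_dual ?addr0; ring.
Qed.

(** The bra pairing g with the top word and h with the rest of the stack; the constant term of g
    stands for a block that is already closed. *)
Definition tensor g h s : K :=
  g [::] * h s + if s is (x, r) :: s' then g (x :: r) * h s' else 0.

Definition killconst g w : K := if w is [::] then 0 else g w.

(** The letter l finds the block of g closed and acts on h, or joins that block, or opens a new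
    block above it. In the last case the constant term of g is removed, being accounted for by the
    first. *)
Lemma fock_dual_tensor l g h s : fock_dual l (tensor g h) s =
  g [::] * fock_dual l h s + tensor (dword l g) h s
  + tensor (dword l f) (tensor (killconst g) h) s.
Proof.
by case: s => [|[x r] s]; rewrite /fock_dual /tensor /= /dword; ring.
Qed.

Lemma fock_dual_vacuum l s : fock_dual l vacuum s = tensor (dword l f) vacuum s.
Proof.
by case: s => [|[x r] s]; rewrite /fock_dual /tensor /= /dword /vacuum /=; ring.
Qed.

(* Contribution of the letters read until the block continued by [g] closes. *)
Fixpoint closing_rec (n : nat) g w : K :=
  if w is l :: w' then
    if n is n'.+1 then
      closing_rec n' (dword l g) w' +
      conv (closing_rec n' (dword l f)) (closing_rec n' (killconst g)) w'
    else 0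
  else g [::].

Definition closing g w : K := closing_rec (size w) g w.

Lemma closing_rec_eq n m g w : (size w <= n)%N -> (size w <= m)%N ->
  closing_rec n g w = closing_rec m g w.
Proof.
elim: n m g w => [|n IHn] [|m] g [|l w] //= wn wm.
congr (_ + _); first exact: IHn.
apply: (@conv_eq _ _ (size w)) => // v vw;
  by apply: IHn; [exact: leq_trans vw _ | exact: leq_trans vw _].
Qed.

Lemma closing_cons l g w : closing g (l :: w) =
  closing (dword l g) w + conv (closing (dword l f)) (closing (killconst g)) w.
Proof.
congr (_ + _).
by apply: (@conv_eq _ _ (size w)) => // v vw; apply: closing_rec_eq.
Qed.

Lemma closing_killconst g w :
  closing g w = closing (killconst g) w + g [::] * delta0 K w.
Proof.
case: w => [|l w]; first by rewrite /closing /= add0r mulr1.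
rewrite !closing_cons mulr0 addr0; congr (_ + conv _ _ _).
by apply/funext => v; congr closing; apply/funext => -[].
Qed.

(** The word is cut where the block of g closes; from there on only h is seen. *)
Lemma fock_tensor g h w :
  fock w (tensor g h) [::] = conv (closing g) (fun v => fock v h [::]) w.
Proof.
have [n] := ubnP (size w); elim: n g h w => // n IHn g h [|l w] wn.
  by rewrite /= /tensor addr0.
transitivity (g [::] * fock w (fock_dual l h) [::] +
    fock w (tensor (dword l g) h) [::] +
    fock w (tensor (dword l f) (tensor (killconst g) h)) [::]).
  rewrite fock_cons (fock_ext _ (fock_dual_tensor l g h)) -fockZ.
  rewrite -(fockD w _ (tensor (dword l g) h)).
  by rewrite -(fockD w _ (tensor (dword l f) _)).
rewrite !IHn// -addrA addrC /=; congr (_ + _).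
rewrite [X in _ + X = _](@conv_eq _ _ (size w) _ (closing (dword l f)) _
   (conv (closing (killconst g)) (fun v => fock v h [::])))//; last first.
  by move=> v vw; apply: IHn; rewrite (leq_ltn_trans vw).
rewrite convA -convDl; apply: conv_ext => // v.
by rewrite -closing_cons.
Qed.

Lemma mom_nil : mom [::] = 1. Proof. by []. Qed.

Lemma mom_closing l w : mom (l :: w) = conv (closing (dword l f)) mom w.
Proof. by rewrite /mom fock_cons (fock_ext _ (fock_dual_vacuum l)) fock_tensor. Qed.

(** With A = [mom], [closing g] is g(Az), with A inserted before every letter of the block, while
    [subst mom g] is g(zA). The identity is g(Az) A = A g(zA). *)
Lemma closing_mom g w : conv (closing g) mom w = conv mom (subst mom g) w.
Proof.
have [n] := ubnP (size w); elim: n g w => // n IHn g [|l w] wn.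
  by rewrite /= mulrC.
transitivity (conv (closing (dword l g)) mom w +
              conv (closing (dword l f)) (conv (closing g) mom) w).
  rewrite /= mom_closing.
  have -> : dword l (closing g) = fun v => closing (dword l g) v +
     conv (closing (dword l f)) (closing (killconst g)) v.
    by apply/funext => v; rewrite /dword closing_cons.
  rewrite convDl -convA -convZr -!addrA -convDr; congr (_ + conv _ _ _).
  apply/funext => v; rewrite (@conv_ext _ _ (closing g) _ mom mom
     (closing_killconst g) (frefl _)) convDl convZl conv1l.
  by [].
rewrite /= mul1r subst_cons addrC (IHn _ _ wn); congr (_ + _).
rewrite (@conv_ext _ _ (dword l mom) (conv (closing (dword l f)) mom)
   _ (subst mom g))// -?convA.
  by apply: (@conv_eq _ _ (size w)) => // v vw; apply: IHn; rewrite (leq_ltn_trans vw).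
by move=> v; rewrite /dword mom_closing.
Qed.

Lemma mom_free : free_moments f mom.
Proof. by split=> // l w; rewrite mom_closing closing_mom. Qed.

End Fock.

(** * Cumulants as the inverse of a moment series *)

Section Inversion.
Variables (K : comNzRingType) (X : Type).
Implicit Types (f g A B G : seq X -> K).

Lemma free_moments_subst f A : f [::] = 1 -> free_moments f A ->
  A =1 subst A f.
Proof. by move=> f0 [A0 AS] [|l w]; rewrite ?A0 ?AS ?subst_cons. Qed.

(* Write [A = F(zA)] with [F = 1 + f]. If [G = A^-1(zG)], then
   [G * A(zG) = 1], so [A(zG) = F(zG * A(zG)) = F(z)] and [G * F = 1]. *)
Lemma free_moments_inv f A B G : f [::] = 1 -> B [::] = 1 ->
  free_moments f A -> conv B A =1 @delta0 K X -> free_moments B G ->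
  conv G f =1 @delta0 K X.
Proof.
move=> f0 B0 fA BA BG.
have GA : conv G (subst G A) =1 @delta0 K X.
  move=> w; rewrite -(subst1 G) -(subst_ext (frefl G) BA) substM.
  by apply: conv_ext => // v; exact: (free_moments_subst B0 BG).
move=> w; rewrite -(GA w); apply: conv_ext => // v.
rewrite (subst_ext (frefl G) (free_moments_subst f0 fA)) subst_subst.
by rewrite (subst_ext GA (frefl f)) subst_delta0.
Qed.

End Inversion.

(** * Exponential bounds *)

Section Bounds.
Variables (K : numFieldType) (X : Type) (C : K).
Hypothesis C0 : 0 <= C.
Implicit Types (f g : seq X -> K).

Lemma conv_bound a f g w : 0 <= a ->
  (forall v, `|f v| <= a * C ^+ size v) ->
  (forall v, (size v <= size w)%N -> `|g v| <= (2 * C) ^+ size v) ->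
  `|conv f g w| <= a * C ^+ size w * (2 ^+ (size w).+1 - 1).
Proof.
elim: w a f => [|l w IHw] a f a0 fa gC.
  have -> : a * C ^+ size (Nil X) * (2 ^+ (size (Nil X)).+1 - 1) = a.
    by rewrite /= expr0 expr1; ring.
  rewrite /= normrM -[leRHS]mulr1 ler_pM//.
    by have := fa [::]; rewrite mulr1.
  by have := gC [::] isT; rewrite expr0.
rewrite /= (le_trans (ler_normD _ _))//.
have -> : a * C ^+ (size w).+1 * (2 ^+ (size w).+2 - 1) =
  a * C * C ^+ size w * (2 ^+ (size w).+1 - 1) + a * (2 * C) ^+ (size w).+1.
  by rewrite exprMn !exprS; ring.
rewrite lerD//.
  apply: IHw; first by rewrite mulr_ge0.
  - by move=> v; rewrite (le_trans (fa (l :: v)))//= exprS mulrA.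
  - by move=> v vw; apply: gC; rewrite (leq_trans vw).
rewrite normrM ler_pM//; first by have := fa [::]; rewrite mulr1.
exact: gC.
Qed.

(** The coefficient of g at l w is minus a convolution of [dword l f] with g on shorter words; the
    geometric sum of [conv_bound] stays below the next power of 2, whence the rate 2C. *)
Lemma inv_bound f g : f [::] = 1 -> conv f g =1 @delta0 K X ->
  (forall w, `|f w| <= C ^+ size w) ->
  forall w, `|g w| <= (2 * C) ^+ size w.
Proof.
move=> f0 fg fC w; have [n] := ubnP (size w).
elim: n w => // n IHn [|l w] wn.
  by have := fg [::]; rewrite /= f0 mul1r => ->; rewrite normr1.
have := fg (l :: w); rewrite /= f0 mul1r => /eqP.
rewrite addrC addr_eq0 => /eqP ->; rewrite normrN.
have C2 : C * C ^+ size w * (2 ^+ (size w).+1 - 1) <= (2 * C) ^+ (size w).+1.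
  rewrite exprMn -exprS mulrC ler_wpM2r ?exprn_ge0//.
  by rewrite lerBlDr lerDl.
apply: le_trans C2; apply: conv_bound => //.
  by move=> v; rewrite (le_trans (fC (l :: v)))//= exprS.
by move=> v vw; apply: IHn; rewrite (leq_ltn_trans vw).
Qed.

Let weight (s : seq (X * seq X)) := sumn [seq (size b.2).+1 | b <- s].

(** A letter read is either stored in the stack, where [weight] counts it, or paid for by a
    coefficient of f; both cost a factor C. There are four terms in [fock_dual], hence the rate
    4C. *)
Lemma fock_bound f w h c : 0 <= c ->
  (forall l v, `|f (l :: v)| <= C ^+ (size v).+1) ->
  (forall s, `|h s| <= c * C ^+ weight s) ->
  forall s, `|fock f w h s| <= c * (4 * C) ^+ size w * C ^+ weight s.
Proof.
move=> c0 fC; elim: w h c c0 => [|l w IHw] h c c0 hC s.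
  by rewrite expr0 mulr1 hC.
rewrite fock_cons.
have -> : c * (4 * C) ^+ size (l :: w) = c * (4 * C) * (4 * C) ^+ size w.
  by rewrite exprS mulrA.
apply: IHw; first by rewrite !mulr_ge0.
move=> {}s; have CS b t : c * C * C ^+ weight t = c * C ^+ weight ((b, [::]) :: t).
  by rewrite /weight /= add1n exprS mulrA.
have hl : `|h ((l, [::]) :: s)| <= c * C * C ^+ weight s by rewrite (CS l).
have fl : `|f [:: l] * h s| <= c * C * C ^+ weight s.
  by rewrite normrM (mulrC c) -mulrA ler_pM// (fC l [::]).
have -> : c * (4 * C) * C ^+ weight s =
  c * C * C ^+ weight s + c * C * C ^+ weight s +
  (c * C * C ^+ weight s + c * C * C ^+ weight s) by ring.
rewrite (le_trans (ler_normD _ _))// lerD// ?(le_trans (ler_normD _ _))// ?lerD//.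
case: s {hl fl} => [|[x r] s].
  by rewrite normr0 addr_ge0// !mulr_ge0 ?exprn_ge0.
rewrite (le_trans (ler_normD _ _))// lerD//.
  by rewrite (le_trans (hC _))// /weight /= !addSn !exprS !mulrA.
rewrite normrM (le_trans (ler_pM _ _ (fC _ _) (hC _)))//.
rewrite /weight /= addSn !exprS exprD le_eqVlt; apply/orP; left; apply/eqP.
ring.
Qed.

Lemma mom_bound f : (forall l v, `|f (l :: v)| <= C ^+ (size v).+1) ->
  forall w, `|mom f w| <= (4 * C) ^+ size w.
Proof.
move=> fC w; rewrite -[leRHS]mul1r -[leRHS]mulr1.
apply: (fock_bound w ler01 fC _ [::]) => -[|b s].
  by rewrite mul1r /vacuum normr1.
by rewrite /vacuum normr0 mul1r exprn_ge0.
Qed.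

End Bounds.

(** * Coloured words and additivity of cumulants *)

Section Colours.
Variables (K : comNzRingType) (X : Type).
Implicit Types (g A : seq (bool * X) -> K) (w : seq X).

(** Sum over all colourings of w: the moments of a sum of two elements in terms of their joint
    moments. *)
Fixpoint colsum g w : K :=
  if w is l :: w' then
    colsum (dword (false, l) g) w' + colsum (dword (true, l) g) w'
  else g [::].

Definition colres (c : bool) g w : K := g [seq (c, l) | l <- w].

Lemma colsumD g g' w :
  colsum (fun v => g v + g' v) w = colsum g w + colsum g' w.
Proof.
elim: w g g' => [|l w IHw] g g' //=.
by rewrite [LHS](congr2 _ (IHw _ _) (IHw _ _)) addrACA.
Qed.

Lemma colsumZ c g w : colsum (fun v => c * g v) w = c * colsum g w.
Proof.
elim: w g => [|l w IHw] g //=.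
by rewrite [LHS](congr2 _ (IHw _) (IHw _)) mulrDr.
Qed.

Lemma colsum_conv g g' w :
  colsum (conv g g') w = conv (colsum g) (colsum g') w.
Proof.
elim: w g g' => [|l w IHw] g g' //=.
have E c : colsum (dword (c, l) (conv g g')) w =
    conv (colsum (dword (c, l) g)) (colsum g') w +
    g [::] * colsum (dword (c, l) g') w.
  by rewrite -IHw -colsumZ -colsumD.
by rewrite !E addrACA mulrDr -convDl.
Qed.

Lemma dword_colsum l g w : colsum g (l :: w) =
  colsum (fun v => dword (false, l) g v + dword (true, l) g v) w.
Proof. by rewrite colsumD. Qed.

Lemma colsum_subst A g w :
  colsum (subst A g) w = subst (colsum A) (colsum g) w.
Proof.
have [n] := ubnP (size w); elim: n g w => // n IHn g [|l w] wn //.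
transitivity (conv (colsum A)
    (colsum (subst A (fun v => dword (false, l) g v + dword (true, l) g v))) w).
  rewrite -colsum_conv dword_colsum; congr colsum; apply/funext => v.
  by rewrite !dword_subst -convDr; congr conv; apply/funext => u; rewrite substD.
rewrite subst_cons; apply: (@conv_eq _ _ (size w)) => // v vw.
rewrite IHn ?(leq_ltn_trans vw)//; congr subst; apply/funext => u.
by rewrite -dword_colsum.
Qed.

(** [colsum] respects products and substitutions, hence carries the functional equation to the one
    for the summed cumulants. *)
Lemma free_moments_colsum g A : free_moments g A ->
  free_moments (colsum g) (colsum A).
Proof.
move=> [A0 AS]; split=> // l w; rewrite dword_colsum.
rewrite [RHS](_ : _ = conv (colsum A) (colsum (subst A
    (fun v => dword (false, l) g v + dword (true, l) g v))) w); last first.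
  apply: conv_ext => // v; rewrite colsum_subst.
  by apply: subst_ext => // u; rewrite -dword_colsum.
rewrite -colsum_conv; congr colsum; apply/funext => v.
rewrite /dword !AS -convDr; congr conv; apply/funext => u.
by rewrite -substD.
Qed.

Lemma colres_conv c g g' w :
  colres c (conv g g') w = conv (colres c g) (colres c g') w.
Proof.
rewrite /colres; elim: w g => [|l w IHw] g //=.
by rewrite IHw.
Qed.

Lemma colres_subst c A g w :
  colres c (subst A g) w = subst (colres c A) (colres c g) w.
Proof.
have [n] := ubnP (size w); elim: n g w => // n IHn g [|l w] wn //.
rewrite /colres /= !subst_cons -/(colres c _ w) colres_conv.
apply: (@conv_eq _ _ (size w)) => // v vw.
by rewrite IHn// (leq_ltn_trans vw).
Qed.

Lemma free_moments_colres c g A : free_moments g A ->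
  free_moments (colres c g) (colres c A).
Proof.
move=> [A0 AS]; split=> // l w; rewrite /colres /= AS -/(colres c _ w) colres_conv.
by apply: conv_ext => // v; rewrite colres_subst.
Qed.

Definition monochrome (x : bool * X) (r : seq (bool * X)) :=
  all (fun y => y.1 == x.1) r.

(* Cumulants of two free families: the mixed ones vanish. *)
Definition fcol (f : bool -> seq X -> K) (w : seq (bool * X)) : K :=
  if w is x :: r then
    if monochrome x r then f x.1 [seq y.2 | y <- w] else 0
  else 0.

Lemma fcol_colres f c l w : colres c (fcol f) (l :: w) = f c (l :: w).
Proof.
rewrite /colres /= /monochrome all_map -map_comp.
by rewrite (eq_all (a2 := predT)) ?all_predT ?map_id//= => x; exact: eqxx.
Qed.

Lemma fcol_colsum f l w :
  colsum (fcol f) (l :: w) = f false (l :: w) + f true (l :: w).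
Proof.
(* Only the constant colouring c survives; the prefix u collects the letters already read. *)
have E c u : colsum (fun v => if all (fun y => y.1 == c) v
    then f c (u ++ [seq y.2 | y <- v]) else 0) w = f c (u ++ w).
  elim: w u => [|x w IHw] u //=.
  have Z : colsum (fun=> 0) w = 0.
    by elim: (w) => //= y v ->; rewrite addr0.
  case: c IHw => IHw; rewrite /dword /=.
    by rewrite Z add0r -cat_rcons -IHw; congr colsum; apply/funext => v; rewrite cat_rcons.
  by rewrite Z addr0 -cat_rcons -IHw; congr colsum; apply/funext => v; rewrite cat_rcons.
rewrite /=; congr (_ + _); first exact: (E false [:: l]).
exact: (E true [:: l]).
Qed.

Lemma mom_colsum f w :
  colsum (mom (fcol f)) w = mom (fun v => f false v + f true v) w.
Proof.
apply: (free_moments_uniq _ (free_moments_colsum (mom_free _)) (mom_free _)).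
exact: fcol_colsum.
Qed.

Lemma mom_colres f c w : mom (fcol f) [seq (c, l) | l <- w] = mom (f c) w.
Proof.
have := free_moments_uniq _ (free_moments_colres c (mom_free (fcol f))) (mom_free (f c)).
by apply; exact: fcol_colres.
Qed.

End Colours.

(* Polynomials are lists of pairs (coefficient, word). *)
Section FockFreeness.
Variables (K : comNzRingType) (X : Type) (f : seq (bool * X) -> K).
Hypothesis f_mixed : forall x r, ~~ monochrome x r -> f (x :: r) = 0.
Notation letter := (bool * X)%type.
Notation stack := (seq (letter * seq letter)).
Implicit Types (h : stack -> K) (w : seq letter) (s : stack).
Implicit Types (p q : seq (K * seq letter)) (i : bool).

Definition fock_poly p h s : K := \sum_(a <- p) a.1 * fock f a.2 h s.

Definition mom_poly p : K := \sum_(a <- p) a.1 * mom f a.2.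

Definition polymul p q := [seq (a.1 * b.1, a.2 ++ b.2) | a <- p, b <- q].

Definition coloured i w := all (fun y => y.1 == i) w.

Let stack_coloured i s := all (fun b => b.1.1 == i) s.

(** Bras that ignore stacks containing a word of two colours; the operators preserve this class
    because mixed cumulants vanish. *)
Let pure h := forall s, ~~ all (fun b => monochrome b.1 b.2) s -> h s = 0.

Let pure_dual l h : pure h -> pure (fock_dual f l h).
Proof.
move=> hp s ms; rewrite /fock_dual (hp ((l, [::]) :: s))// add0r (hp s)// mulr0 add0r.
case: s ms => // -[x r] s; rewrite /= negb_and => /orP ms.
have -> : h ((l, x :: r) :: s) = 0.
  apply: hp; rewrite /= /monochrome /=; case: eqP => //= <-.
  by rewrite negb_and; apply/orP.
rewrite add0r; case: ms => ms; last by rewrite hp ?mulr0.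
rewrite f_mixed ?mul0r// /monochrome /=; case: eqP => //= <-.
exact: ms.
Qed.

Let pure_fock w h : pure h -> pure (fock f w h).
Proof. by elim: w h => // l w IHw h /(pure_dual l) /IHw. Qed.

Let fock_coloured i w h h' : coloured i w ->
  (forall s, stack_coloured i s -> h s = h' s) ->
  forall s, stack_coloured i s -> fock f w h s = fock f w h' s.
Proof.
elim: w h h' => [|l w IHw] h h' // /andP[li wi] hh s si.
rewrite !fock_cons; apply: IHw => // -[|[x r] t] ti; rewrite /fock_dual.
  by rewrite !hh//= li.
by move: ti => /= /andP[xi ti]; rewrite !hh ?/= ?li ?xi.
Qed.

(* Words of colour [i] leave the part of the stack below a block of the other
   colour untouched. *)
Let fock_shift i w h s : coloured i w -> pure h ->
  (if s is b :: _ then b.1.1 != i else true) ->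
  fock f w h s = fock f w (fun t => h (t ++ s)) [::].
Proof.
move=> wi; elim: w wi h => [|l w IHw] // /andP[li wi] h hp si.
rewrite !fock_cons IHw//; last exact: pure_dual.
congr fock; apply/funext => -[|[x r] t] //; rewrite /fock_dual /= addr0.
case: s si {IHw} => [|[x r] s] /= xi; first by rewrite addr0.
have lx : ~~ monochrome l (x :: r).
  by rewrite /monochrome /= (eqP li) (negbTE xi).
have -> : h ((l, x :: r) :: s) = 0 by apply: hp; rewrite /= negb_and lx.
by rewrite (f_mixed lx) mul0r !addr0.
Qed.

Let vanish_top i h := forall b s, b.1.1 = i -> h (b :: s) = 0.

(** By [fock_shift] only what letters of colour i build on top of s matters, and h kills everything
    built there except the empty stack. The polynomial thus acts as its vacuum expectation. *)
Let fock_poly_vanish i p h s : (forall a, List.In a p -> coloured i a.2) ->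
  pure h -> vanish_top i h ->
  (if s is b :: _ then b.1.1 != i else true) ->
  fock_poly p h s = h s * mom_poly p.
Proof.
move=> pc hp hi si; rewrite /fock_poly /mom_poly.
elim: p pc => [|a p IHp] pc; first by rewrite !big_nil mulr0.
rewrite !big_cons mulrDr IHp => [|b bp]; last by apply: pc; right.
congr (_ + _); rewrite mulrCA; congr (_ * _).
have ai : coloured i a.2 by apply: pc; left.
rewrite (fock_shift ai hp si) -fockZ; apply: (fock_coloured ai) => // -[|b t] /=.
  by rewrite mulr1.
by move=> /andP[/eqP bi _]; rewrite hi// mulr0.
Qed.

Lemma fock_poly_mul p q h s :
  fock_poly (polymul p q) h s = fock_poly q (fock_poly p h) s.
Proof.
rewrite /fock_poly /polymul big_allpairs_dep exchange_big; apply: eq_bigr => b _.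
rewrite (_ : fock f b.2 _ s = \sum_(a <- p) a.1 * fock f b.2 (fock f a.2 h) s).
  by rewrite mulr_sumr; apply: eq_bigr => a _ /=; rewrite fock_cat mulrCA mulrA.
elim: p => [|a p IHp].
  rewrite big_nil -[RHS](mul0r (fock f b.2 (fun=> 0) s)) -fockZ.
  by apply: fock_ext => t; rewrite big_nil mul0r.
rewrite big_cons -IHp -fockZ -fockD; apply: fock_ext => t.
by rewrite big_cons.
Qed.

(* Applying alternating centred polynomials to the vacuum gives a combination
   of non-empty stacks whose top has the first colour; the bra [h] kills those. *)
Lemma fock_poly_alternating (ps : seq (bool * seq (K * seq letter))) h :
  (forall ip, List.In ip ps ->
     (forall a, List.In a ip.2 -> coloured ip.1 a.2) /\ mom_poly ip.2 = 0) ->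
  sorted (fun ip jq => ip.1 != jq.1) ps -> pure h ->
  (if ps is ip :: _ then vanish_top ip.1 h else h [::] = 0) ->
  fock_poly (foldr (fun ip => polymul ip.2) [:: (1, [::])] ps) h [::] = 0.
Proof.
elim: ps h => [|[i p] ps IHps] h psP.
  by move=> _ _ h0; rewrite /fock_poly big_seq1 mul1r.
move=> psS hp hi; rewrite /= fock_poly_mul.
have [pc p0] := psP _ (or_introl erefl).
have vp s : (if s is b :: _ then b.1.1 != i else true) -> fock_poly p h s = 0.
  by move=> si; rewrite (@fock_poly_vanish i)// p0 mulr0.
apply: IHps.
- by move=> ip ipps; apply: psP; right.
- by case: (ps) psS => //= a l /andP[].
- move=> s ms; apply: big1 => a _.
  by rewrite (pure_fock _ hp)// mulr0.
case: ps psS {psP} => [|[j q] ps] /=; first by move=> _; exact: vp.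
by move=> /andP[ij _] b s /= bj; apply: vp; rewrite bj eq_sym.
Qed.

Lemma mom_poly_free (ps : seq (bool * seq (K * seq letter))) :
  (0 < size ps)%N ->
  (forall ip, List.In ip ps ->
     (forall a, List.In a ip.2 -> coloured ip.1 a.2) /\ mom_poly ip.2 = 0) ->
  sorted (fun ip jq => ip.1 != jq.1) ps ->
  mom_poly (foldr (fun ip => polymul ip.2) [:: (1, [::])] ps) = 0.
Proof.
case: ps => // ip ps _ psP psS; apply: fock_poly_alternating => //.
by case=> // b s; rewrite /= negb_and.
Qed.

End FockFreeness.

(** * Sums over non-crossing partitions *)

Lemma convE (K : comNzRingType) (X : Type) (f g : seq X -> K) w :
  conv f g w = \sum_(m < (size w).+1) f (take m w) * g (drop m w).
Proof.
elim: w f => [|l w IHw] f; first by rewrite big_ord1.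
by rewrite big_ord_recl /= IHw addrC.
Qed.

Section NoncrossingSums.
Import mathcomp.boot.fintype mathcomp.boot.finset.
Variables (K : comNzRingType) (X : Type) (f : seq X -> K) (n : nat) (x : nat -> X).
Implicit Types (P Q : {set {set 'I_n}}) (A B C : {set 'I_n}) (i j k : 'I_n).

Let itv (a b : nat) : {set 'I_n} := [set y : 'I_n | (a <= y < b)%N].

Let subw B : seq X := [seq x (val y) | y <- enum B].

Let ncp A : {set {set {set 'I_n}}} := [set P | partition P A & noncrossing P].

Let wt (P : {set {set 'I_n}}) : K := \prod_(B in P) f (subw B).

Let ncsum (a b : nat) : K := \sum_(P in ncp (itv a b)) wt P.

(* The block of the first point [i] gets its weight from [g]. *)
Let ncsum1 (g : seq X -> K) (i : 'I_n) (b : nat) : K :=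
  \sum_(P in ncp (itv i b))
    g (subw (pblock P i :\ i)) * wt (P :\ pblock P i).

(** Pointwise form of a non-crossing partition of A; the crossing condition concludes that two
    blocks are equal, which is how it is applied. *)
Record isncp P A : Prop := IsNcp {
  ncp_ne : forall B, B \in P -> exists y, y \in B;
  ncp_sub : forall B y, B \in P -> y \in B -> y \in A;
  ncp_cov : forall y, y \in A -> exists2 B, B \in P & y \in B;
  ncp_inj : forall B C y, B \in P -> C \in P -> y \in B -> y \in C -> B = C;
  ncp_nc : forall B C (a b c d : 'I_n), B \in P -> C \in P ->
    a \in B -> b \in C -> c \in B -> d \in C ->
    (a < b)%N -> (b < c)%N -> (c < d)%N -> B = C }.

Let ncpP P A : reflect (isncp P A) (P \in ncp A).
Proof.
rewrite inE; apply: (iffP andP) => [[/and3P[/eqP cP tP nP] ncP]|H].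
  split.
  - move=> B BP; apply/set0Pn; apply: contra nP => /eqP <-//.
  - by move=> B y BP yB; rewrite -cP; apply/bigcupP; exists B.
  - by move=> y; rewrite -cP => /bigcupP[B BP yB]; exists B.
  - by move=> B C y BP CP yB yC; rewrite -(def_pblock tP BP yB) (def_pblock tP CP yC).
  - move=> B C a b c d BP CP aB bC cB dC ab bc cd; apply/eqP; apply: contraT => BC.
    move/forall_inP: ncP => /(_ B BP) /forall_inP/(_ C CP); rewrite BC /=.
    case/negP; apply/exists_inP; exists a => //; apply/exists_inP; exists b => //.
    apply/exists_inP; exists c => //; apply/exists_inP; exists d => //.
    by rewrite ab bc cd.
split.
  apply/and3P; split.
  - apply/eqP/setP => y; apply/bigcupP/idP => [[B BP yB]|/(ncp_cov H)[B BP yB]].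
      exact: ncp_sub BP yB.
    by exists B.
  - apply/trivIsetP => B C BP CP BC; rewrite -setI_eq0; apply/eqP/setP => y.
    rewrite !inE; apply/negP => /andP[yB yC]; move/eqP: BC; apply.
    exact: (ncp_inj H BP CP yB yC).
  - by apply/negP => /(ncp_ne H) [y]; rewrite inE.
apply/forall_inP => B BP; apply/forall_inP => C CP; apply/implyP => BC.
apply/negP => /exists_inP[a aB /exists_inP[b bC /exists_inP[c cB /exists_inP[d dC]]]].
move=> /and3P[ab bc cd]; move/eqP: BC; apply.
exact: (ncp_nc H BP CP aB bC cB dC).
Qed.

Let pblockE P A B y : isncp P A -> B \in P -> y \in B -> pblock P y = B.
Proof.
move=> /ncpP; rewrite inE => /andP[/and3P[_ tP _] _]; exact: def_pblock.
Qed.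

Let pblockP P A y : isncp P A -> y \in A -> pblock P y \in P /\ y \in pblock P y.
Proof.
by move=> H /(ncp_cov H)[B BP yB]; rewrite (pblockE H BP yB).
Qed.

Let enum_sorted B : sorted (fun y z : 'I_n => (y < z)%N) (enum B).
Proof.
have ltr : transitive (fun y z : 'I_n => (y < z)%N) by move=> a b c; apply: ltn_trans.
have enS : sorted (fun y z : 'I_n => (y < z)%N) (enum 'I_n).
  by have := iota_ltn_sorted 0 n; rewrite -val_enum_ord sorted_map.
by rewrite {1}/enum_mem sorted_filter// -enumT.
Qed.

Let enum_min B i : i \in B -> (forall y, y \in B -> (i <= y)%N) ->
  enum B = i :: enum (B :\ i).
Proof.
move=> iB imin.
have ltr : transitive (fun y z : 'I_n => (y < z)%N) by move=> a b c; apply: ltn_trans.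
have irr : irreflexive (fun y z : 'I_n => (y < z)%N) by move=> a; apply: ltnn.
apply: (irr_sorted_eq ltr irr); first exact: enum_sorted.
  rewrite /= path_min_sorted ?enum_sorted//; apply/allP => y; rewrite mem_enum !inE.
  by move=> /andP[yi yB]; rewrite ltn_neqAle imin// eq_sym andbT.
by move=> y; rewrite !inE !mem_enum !inE; case: eqP => // ->; rewrite iB.
Qed.

Let subw_min B i : i \in B -> (forall y, y \in B -> (i <= y)%N) ->
  subw B = x i :: subw (B :\ i).
Proof. by move=> iB imin; rewrite /subw (enum_min iB imin). Qed.

Let subw0 : subw set0 = [::].
Proof. by rewrite /subw enum_set0. Qed.

Let wtD1 P B : B \in P -> wt P = f (subw B) * wt (P :\ B).
Proof. by move=> BP; rewrite /wt (big_setD1 B). Qed.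

Let ncsumE i (b : nat) : (i < b)%N -> ncsum i b = ncsum1 (dword (x i) f) i b.
Proof.
move=> ib; apply: eq_bigr => P /ncpP H.
have iA : i \in itv i b by rewrite inE leqnn.
have [BP iB] := pblockP H iA.
rewrite (wtD1 BP) (@subw_min _ i)// => y yB.
by have := ncp_sub H BP yB; rewrite inE => /andP[].
Qed.

Let ncsum0 (a : nat) : ncsum a a = 1.
Proof.
rewrite /ncsum (big_pred1 set0) ?/wt ?big_set0// => P; rewrite inE.
have -> : itv a a = set0.
  by apply/setP => y; rewrite !inE ltnNge andbN.
rewrite partition_set0 /=; case: eqP => [->|//] /=.
by apply/forall_inP => B; rewrite inE.
Qed.

(* Either [i] is a singleton block, or removing it from its block, whose next
   element is [k], splits the partition into one of ]i, k[ and one of [k, b[. *)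
Let glue i k (PP : {set {set 'I_n}} * {set {set 'I_n}}) : {set {set 'I_n}} :=
  (i |: pblock PP.2 k) |: (PP.1 :|: (PP.2 :\ pblock PP.2 k)).

Let unglue i k (b : nat) P : {set {set 'I_n}} * {set {set 'I_n}} :=
  ([set B in P | B \subset itv i.+1 k],
   (pblock P i :\ i) |: [set B in P | B \subset itv k b]).

(** The default value i signals that i is a singleton block. *)
Let next i P : 'I_n := head i (enum (pblock P i :\ i)).

Let nextP i k (b : nat) P : isncp P (itv i b) -> (i < b)%N -> next i P = k ->
  k != i ->
  [/\ (i < k < b)%N, k \in pblock P i &
      forall y, y \in pblock P i -> y != i -> (k <= y)%N].
Proof.
move=> H ib; have iA : i \in itv i b by rewrite inE leqnn.
have [BP iB] := pblockP H iA; rewrite /next.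
case E: (enum (pblock P i :\ i)) => [|k' s] /= <-; first by rewrite eqxx.
move=> ki; have : k' \in pblock P i :\ i by rewrite -mem_enum E mem_head.
rewrite !inE => /andP[_ kB]; split => //.
  have := ncp_sub H BP kB; rewrite inE => /andP[ik ->].
  by rewrite andbT ltn_neqAle ik andbT eq_sym.
move=> y yB yi; have : y \in enum (pblock P i :\ i) by rewrite mem_enum !inE yi.
have : sorted (fun y z : 'I_n => (y < z)%N) (enum (pblock P i :\ i)).
  exact: enum_sorted.
rewrite E inE /= => ks /predU1P[-> //|ys]; apply: ltnW.
have ltr : transitive (fun y z : 'I_n => (y < z)%N) by move=> u v w; apply: ltn_trans.
by have /allP/(_ _ ys) := order_path_min ltr ks.
Qed.

Let next_eq i k (b : nat) P : k \in pblock P i -> k != i ->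
  (forall y, y \in pblock P i -> y != i -> (k <= y)%N) -> next i P = k.
Proof.
move=> kB ki kmin; rewrite /next (@enum_min _ k) ?inE ?ki//=.
by move=> y; rewrite !inE => /andP[yi yB]; apply: kmin.
Qed.

Let mem_itv (y : 'I_n) (a b : nat) : (y \in itv a b) = (a <= y < b)%N.
Proof. by rewrite inE. Qed.

Let unglueP i k (b : nat) P : isncp P (itv i b) -> (i < b)%N -> next i P = k ->
  k != i ->
  [/\ isncp (unglue i k b P).1 (itv i.+1 k), isncp (unglue i k b P).2 (itv k b) &
      glue i k (unglue i k b P) = P].
Proof.
move=> H ib nk ki; have iA : i \in itv i b by rewrite mem_itv leqnn.
have [BP iB] := pblockP H iA.
have [/andP[ik kb] kB kmin] := nextP H ib nk ki.
rewrite /unglue /glue /=; set B := pblock P i in BP iB kB kmin *.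
have Psub C y : C \in P -> y \in C -> (i <= y < b)%N.
  by move=> CP yC; rewrite -mem_itv; apply: (ncp_sub H CP yC).
have Bnot C y z : C \in P -> C != B -> y \in C -> z \in B -> (y : nat) != z.
  move=> CP /eqP CB yC zB; apply/eqP => /val_inj yz; apply: CB.
  by apply: (ncp_inj H CP BP yC); rewrite yz.
(* A block with points on both sides of k would cross the pair i, k of B. *)
have F1 C : C \in P -> C != B -> C \subset itv i.+1 k \/ C \subset itv k b.
  move=> CP CB; case: (boolP [exists y in C, (y < k)%N]) => [/exists_inP[y yC yk]|].
    left; apply/subsetP => z zC; rewrite mem_itv.
    have /andP[iz _] := Psub C z CP zC; have /andP[iy _] := Psub C y CP yC.
    rewrite ltn_neqAle eq_sym (Bnot C z i)// iz /= ltnNge; apply/negP => kz.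
    case/eqP: (CB); apply: esym; apply: (ncp_nc H BP CP iB yC kB zC) => //.
      by rewrite ltn_neqAle iy eq_sym (Bnot C y i).
    by rewrite ltn_neqAle kz eq_sym (Bnot C z k).
  rewrite negb_exists_in => /forall_inP Ck; right; apply/subsetP => y yC.
  have /andP[_ yb] := Psub C y CP yC.
  by rewrite mem_itv yb andbT leqNgt Ck.
have memP2 C : C \in (B :\ i) |: [set C in P | C \subset itv k b] ->
    exists2 C', C' \in P & C = C' :\ i.
  case/setU1P => [->|]; first by exists B.
  rewrite inE => /andP[CP Ck]; exists C => //; apply/setP => y; rewrite !inE.
  case: eqP => //= ->; apply/negbTE/negP => /(subsetP Ck).
  by rewrite mem_itv leqNgt ik.
split.
- split=> [C|C y|y|C C' y|C C' u v y z]; rewrite ?inE.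
  + by case/andP => /(ncp_ne H).
  + by move=> /andP[_ /subsetP Ck] /Ck; rewrite mem_itv.
  + case/andP => iy yk; have /(ncp_cov H)[C CP yC] : y \in itv i b.
      by rewrite mem_itv (ltnW iy) (ltn_trans yk).
    exists C; rewrite // inE CP /=; have CB : C != B.
      apply/eqP => CB; have := kmin y; rewrite -CB yC => /(_ isT).
      by rewrite leqNgt yk -(inj_eq val_inj) neq_ltn iy orbT => /(_ isT).
    case: (F1 C CP CB) => // /subsetP/(_ y yC); rewrite mem_itv.
    by rewrite leqNgt yk.
  + by case/andP => CP _ /andP[C'P _]; apply: (ncp_inj H).
  + by case/andP => CP _ /andP[C'P _]; apply: (ncp_nc H).
- split=> [C|C y|y|C C' y|C C' u v y z].
  + case/setU1P => [->|]; first by exists k; rewrite !inE ki.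
    by rewrite inE => /andP[/(ncp_ne H)].
  + case/setU1P => [->|].
      rewrite !inE => /andP[yi yB]; rewrite kmin//=.
      by case/andP: (Psub B y BP yB).
    by rewrite inE => /andP[_ /subsetP]; apply.
  + rewrite mem_itv => /andP[ky yb]; have iy := leq_trans ik ky.
    have yi : y != i by rewrite -(inj_eq val_inj) neq_ltn iy orbT.
    have /(ncp_cov H)[C CP yC] : y \in itv i b by rewrite mem_itv (ltnW iy).
    have [CB|CB] := eqVneq C B.
      by exists (B :\ i); rewrite ?setU11// !inE yi -CB.
    exists C; rewrite // !inE CP /=; apply/orP; right.
    case: (F1 C CP CB) => // /subsetP/(_ y yC); rewrite mem_itv.
    by rewrite [(y < k)%N]ltnNge ky andbF.
  + move=> /memP2[D DP ->] /memP2[D' D'P ->]; rewrite !inE.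
    by move=> /andP[_ yD] /andP[_ yD']; rewrite (ncp_inj H DP D'P yD yD').
  + move=> /memP2[D DP ->] /memP2[D' D'P ->]; rewrite !inE.
    move=> /andP[_ uD] /andP[_ vD'] /andP[_ yD] /andP[_ zD'] uv vy yz.
    by rewrite (ncp_nc H DP D'P uD vD' yD zD' uv vy yz).
have DE : pblock ((B :\ i) |: [set C in P | C \subset itv k b]) k = B :\ i.
  apply: def_pblock; rewrite ?setU11// ?inE ?ki//.
  apply/trivIsetP => C C' /memP2[D DP ->] /memP2[D' D'P ->] DD.
  rewrite -setI_eq0; apply/eqP/setP => y; rewrite !inE.
  apply/negP => /andP[/andP[_ yD] /andP[_ yD']]; move/eqP: DD; apply.
  by rewrite (ncp_inj H DP D'P yD yD').
rewrite DE setD1K//; apply/setP => C; rewrite !inE.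
have [-> //|CB /=] := eqVneq C B.
apply/idP/idP => [/orP[/andP[] //|/andP[CBi]]|CP].
  by rewrite (negbTE CBi) => /andP[].
case: (F1 C CP CB) => Ck; rewrite CP Ck ?orbT//=.
apply/orP; right; rewrite ?orbT ?andbT; apply/eqP => CBi.
have := Bnot C k k CP CB; rewrite eqxx CBi !inE ki kB.
by move=> /(_ isT isT).
Qed.

Let glueP i k (b : nat) P1 P2 : (i < k < b)%N ->
  isncp P1 (itv i.+1 k) -> isncp P2 (itv k b) ->
  let P := glue i k (P1, P2) in
  [/\ isncp P (itv i b), pblock P i = i |: pblock P2 k, next i P = k,
      unglue i k b P = (P1, P2) &
      P :\ pblock P i = P1 :|: (P2 :\ pblock P2 k)].
Proof.
move=> /andP[ik kb] H1 H2 P.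
have kA : k \in itv k b by rewrite mem_itv leqnn.
have [DP kD] := pblockP H2 kA; rewrite /P /glue /= {P}.
set D := pblock P2 k in DP kD *; set B := i |: D.
pose P := B |: (P1 :|: P2 :\ D); rewrite -/P.
have P1s C y : C \in P1 -> y \in C -> (i < y < k)%N.
  by move=> CP /(ncp_sub H1 CP); rewrite mem_itv.
have P2s C y : C \in P2 -> y \in C -> (k <= y < b)%N.
  by move=> CP /(ncp_sub H2 CP); rewrite mem_itv.
have iC2 C : C \in P2 -> i \notin C.
  by move=> CP; apply/negP => /(P2s _ _ CP); rewrite leqNgt ik.
(* A point of a glued block is i, or a point of a block of P1, or a point of a block of P2, which
   becomes B when it is the block of k. *)
have cls C y : C \in P -> y \in C -> [\/ (y = i /\ C = B),
    ((i < y < k)%N /\ C \in P1) |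
    exists2 C', C' \in P2 & [/\ (k <= y < b)%N, y \in C' & C = if C' == D then B else C']].
  case/setU1P => [->|/setUP[CP yC|/setD1P[CD CP yC]]].
  - case/setU1P => [->|yD]; [by constructor 1|constructor 3; exists D => //].
    by rewrite eqxx; split=> //; apply: P2s yD.
  - by constructor 2; split=> //; apply: P1s yC.
  - by constructor 3; exists C => //; rewrite (negbTE CD); split=> //; apply: P2s yC.
have up_inj C C' : C \in P2 -> C' \in P2 ->
    (if C == D then B else C) = (if C' == D then B else C') -> C = C'.
  move=> CP CP'; case: eqP => [->|_]; case: eqP => [->|_] //.
    by move=> BC; have := iC2 _ CP'; rewrite -BC setU11.
  by move=> BC; have := iC2 _ CP; rewrite BC setU11.
have HP : isncp P (itv i b).
  split=> [C|C y CP yC|y|C C' y CP C'P yC yC'|C C' u v y z CP C'P uC vC' yC zC' uv vy yz].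
  - case/setU1P => [->|/setUP[/(ncp_ne H1)//|/setD1P[_ /(ncp_ne H2)//]]].
    by exists i; rewrite setU11.
  - rewrite mem_itv; case: (cls C y CP yC) => [[-> _]|[/andP[iy yk] _]|[C' _ [/andP[ky yb] _ _]]].
    + by rewrite leqnn (ltn_trans ik).
    + by rewrite (ltnW iy) (ltn_trans yk).
    + by rewrite yb (leq_trans (ltnW ik)).
  - rewrite mem_itv => /andP[iy yb]; have [ky|yk] := leqP k y.
      have /(ncp_cov H2)[C CP yC] : y \in itv k b by rewrite mem_itv ky.
      have [CD|CD] := eqVneq C D; first by exists B; rewrite !inE ?eqxx// -CD yC orbT.
      by exists C => //; rewrite !inE CD CP !orbT.
    move: iy; rewrite leq_eqVlt => /orP[/eqP iy|iy].
      by exists B; rewrite ?setU11// -(val_inj iy) setU11.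
    have /(ncp_cov H1)[C CP yC] : y \in itv i.+1 k by rewrite mem_itv iy.
    by exists C => //; rewrite !inE CP !orbT.
  - case: (cls C y CP yC) => [[yi ->]|[/andP[iy yk] C1]|[D1 D1P [/andP[ky _] yD1 ->]]];
    case: (cls C' y C'P yC') => [[yi' ->]|[/andP[iy' yk'] C1']|[D2 D2P [/andP[ky' _] yD2 ->]]] //.
    + by move: iy'; rewrite yi ltnn.
    + by move: ky'; rewrite yi leqNgt ik.
    + by move: iy; rewrite yi' ltnn.
    + exact: (ncp_inj H1 C1 C1' yC yC').
    + by move: ky'; rewrite leqNgt yk.
    + by move: ky; rewrite yi' leqNgt ik.
    + by move: ky; rewrite leqNgt yk'.
    + by rewrite (ncp_inj H2 D1P D2P yD1 yD2).
  (* The position of v decides: left of k the crossing lies in P1, otherwise in P2, with k in place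
     of u when u is i. *)
  - have uy := ltn_trans uv vy; have vz := ltn_trans vy yz.
    have iu : (i <= u)%N.
      by case: (cls C u CP uC) => [[->]|[/andP[/ltnW]]|[D1 _ [/andP[/(leq_trans (ltnW ik))]]]].
    have iv := leq_ltn_trans iu uv.
    case: (cls C' v C'P vC') => [[vi]|[/andP[_ vk] C1']|[D2 D2P [/andP[kv _] vD2 CE']]].
    + by move: iv; rewrite vi ltnn.
    + have /andP[_ zk] := P1s _ _ C1' zC'; have yk := ltn_trans yz zk.
      case: (cls C y CP yC) => [[yi]|[_ C1]|[D1 _ [/andP[]]]].
      * by move: (ltn_trans iv vy); rewrite yi ltnn.
      * exact: (ncp_nc H1 C1 C1' uC vC' yC zC').
      * by rewrite leqNgt yk.
    + have ky := leq_trans kv (ltnW vy); have kz := leq_trans kv (ltnW vz).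
      have zD2 : z \in D2.
        case: (cls C' z C'P zC') => [[zi]|[/andP[_]]|[D3 D3P [_ zD3 CE3]]].
        * by move: kz; rewrite zi leqNgt ik.
        * by rewrite ltnNge kz.
        * by rewrite (up_inj D2 D3)// -CE'.
      case: (cls C y CP yC) => [[yi]|[/andP[_]]|[D1 D1P [_ yD1 CE]]].
      * by move: ky; rewrite yi leqNgt ik.
      * by rewrite ltnNge ky.
      * rewrite CE CE'; suff -> : D1 = D2 by [].
        case: (cls C u CP uC) => [[ui CB]|[_ C1]|[D3 D3P [_ uD3 CE3]]].
        -- have D1D : D1 = D by apply: up_inj => //; rewrite -CE CB eqxx.
           rewrite D1D; move: kv; rewrite leq_eqVlt => /orP[/eqP kv|kv].
             by apply: (ncp_inj H2 DP D2P kD); rewrite (val_inj kv).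
           by apply: (ncp_nc H2 DP D2P kD vD2 _ zD2 kv vy yz); rewrite -D1D.
        -- by have /andP[_] := P1s _ _ C1 yC; rewrite ltnNge ky.
        -- have D13 : D3 = D1 by apply: up_inj => //; rewrite -CE -CE3.
           by apply: (ncp_nc H2 D1P D2P _ vD2 yD1 zD2 uv vy yz); rewrite -D13.
have BP : B \in P by rewrite setU11.
have pB : pblock P i = B by apply: (pblockE HP BP); rewrite setU11.
have BN : B \notin P1 :|: P2 :\ D.
  rewrite !inE !negb_or; apply/andP; split.
    by apply/negP => /P1s/(_ (setU11 _ _)); rewrite ltnn.
  rewrite negb_and; apply/orP; right; apply/negP => /iC2.
  by rewrite setU11.
split=> //.
- apply: (next_eq b); rewrite ?pB ?inE ?kD ?orbT//.
    by rewrite -(inj_eq val_inj) neq_ltn ik orbT.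
  move=> y /setU1P[->|/(P2s _ _ DP)/andP[]//]; by rewrite eqxx.
- rewrite /unglue pB; congr pair; last first.
    apply/setP => C; rewrite setU1K ?iC2//; apply/setU1P/idP => [[-> //|]|CP].
      rewrite inE => /andP[CP Ck]; case/setU1P: (CP) => [CB|/setUP[C1|/setD1P[]//]].
        by have := subsetP Ck i; rewrite CB setU11 mem_itv leqNgt ik => /(_ isT).
      have [y yC] := ncp_ne H1 C1; have /andP[_ yk] := P1s _ _ C1 yC.
      by have := subsetP Ck y yC; rewrite mem_itv leqNgt yk.
    have [->|CD] := eqVneq C D; first by left.
    right; rewrite !inE CD CP !orbT /=; apply/subsetP => y yC.
    by rewrite mem_itv; apply: P2s yC.
  apply/setP => C; rewrite inE; apply/andP/idP => [[CP Ck]|C1]; last first.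
    split; first by rewrite !inE C1 !orbT.
    by apply/subsetP => y yC; rewrite mem_itv; apply: P1s yC.
  case/setU1P: (CP) => [CB|/setUP[//|/setD1P[_ C2]]].
    by have := subsetP Ck i; rewrite CB setU11 mem_itv ltnn => /(_ isT).
  have [y yC] := ncp_ne H2 C2; have /andP[ky _] := P2s _ _ C2 yC.
  by have := subsetP Ck y yC; rewrite mem_itv [(y < k)%N]ltnNge ky andbF.
- by rewrite pB setU1K.
Qed.

Let ncsum1_next g i k (b : nat) : (i < k < b)%N ->
  \sum_(P in ncp (itv i b) | next i P == k)
    g (subw (pblock P i :\ i)) * wt (P :\ pblock P i) =
  ncsum i.+1 k * ncsum1 (dword (x k) g) k b.
Proof.
move=> ikb; have /andP[ik kb] := ikb; have ib := ltn_trans ik kb.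
have ki : k != i by rewrite -(inj_eq val_inj) neq_ltn ik orbT.
rewrite (reindex_onto (glue i k) (unglue i k b)) /=; last first.
  by move=> P /andP[/ncpP H /eqP nk]; have [] := unglueP H ib nk ki.
rewrite /ncsum mulr_suml.
under [RHS]eq_bigr => P1 _ do rewrite mulr_sumr.
rewrite pair_big /=; apply: eq_big => [[P1 P2]|[P1 P2]] /=.
  apply/idP/idP => [/andP[/andP[/ncpP H /eqP nk] /eqP gE]|/andP[/ncpP H1 /ncpP H2]].
    have [] := unglueP H ib nk ki; rewrite gE /= => H1 H2 _.
    by apply/andP; split; apply/ncpP.
  have [H _ nk uE _] := glueP ikb H1 H2; rewrite nk uE !eqxx !andbT.
  exact/ncpP.
move=> /andP[/andP[/ncpP H /eqP nk] /eqP gE].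
have [H1 H2 _] := unglueP H ib nk ki; rewrite gE /= in H1 H2.
have [_ pE _ _ ->] := glueP ikb H1 H2.
have kA : k \in itv k b by rewrite mem_itv leqnn.
have [DP kD] := pblockP H2 kA; have D2 y : y \in pblock P2 k -> (k <= y)%N.
  by move=> /(ncp_sub H2 DP); rewrite mem_itv => /andP[].
rewrite pE setU1K; last by apply/negP => /D2; rewrite leqNgt ik.
rewrite (subw_min kD D2) /dword mulrCA; congr (_ * _).
rewrite /wt -bigU /=; first by apply: eq_bigl => C; rewrite !inE.
rewrite disjoint_sym disjoint_subset; apply/subsetP => C.
rewrite !inE => /andP[_ C2]; apply/negP => C1.
have [y yC] := ncp_ne H1 C1; have := ncp_sub H1 C1 yC; have := ncp_sub H2 C2 yC.
by rewrite !mem_itv [(y < k)%N]ltnNge => /andP[-> _]; rewrite andbF.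
Qed.

Let ncsum1_last g i (b : nat) : (i < b)%N ->
  \sum_(P in ncp (itv i b) | next i P == i)
    g (subw (pblock P i :\ i)) * wt (P :\ pblock P i) =
  g [::] * ncsum i.+1 b.
Proof.
move=> ib; have iA : i \in itv i b by rewrite mem_itv leqnn.
have iN (Q : {set {set 'I_n}}) C : isncp Q (itv i.+1 b) -> C \in Q -> i \notin C.
  by move=> H CQ; apply/negP => /(ncp_sub H CQ); rewrite mem_itv ltnn.
have iNQ (Q : {set {set 'I_n}}) : isncp Q (itv i.+1 b) -> [set i] \notin Q.
  by move=> H; apply/negP => /(iN _ _ H); rewrite !inE eqxx.
have add1 (Q : {set {set 'I_n}}) : isncp Q (itv i.+1 b) ->
    isncp ([set i] |: Q) (itv i b) /\ pblock ([set i] |: Q) i = [set i].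
  move=> H; suff HP : isncp ([set i] |: Q) (itv i b).
    by split=> //; apply: (pblockE HP); rewrite ?setU11// !inE.
  split=> [C|C y|y|C C' y|C C' u v y z].
  - by case/setU1P => [->|/(ncp_ne H)//]; exists i; rewrite !inE.
  - case/setU1P => [->|CQ]; first by rewrite inE => /eqP->.
    by move=> /(ncp_sub H CQ); rewrite !mem_itv => /andP[/ltnW-> ->].
  - rewrite mem_itv leq_eqVlt => /andP[/orP[/eqP iy|iy] yb].
      by exists [set i]; rewrite ?setU11// inE (val_inj iy).
    have /(ncp_cov H)[C CQ yC] : y \in itv i.+1 b by rewrite mem_itv iy.
    by exists C => //; rewrite !inE CQ orbT.
  - move=> /setU1P[->|CQ] /setU1P[->|C'Q] //; rewrite ?inE.
    + by move=> /eqP->; rewrite (negbTE (iN _ _ H C'Q)).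
    + by move=> yC /eqP yi; move: yC; rewrite yi (negbTE (iN _ _ H CQ)).
    + exact: (ncp_inj H).
  - move=> /setU1P[->|CQ] /setU1P[->|C'Q] //; rewrite ?inE.
    + by move=> /eqP-> _ /eqP-> _ /ltn_trans h /h; rewrite ltnn.
    + by move=> _ /eqP-> _ /eqP-> _ /ltn_trans h /h; rewrite ltnn.
    + exact: (ncp_nc H).
have del1 P : isncp P (itv i b) -> next i P = i ->
    [/\ isncp (P :\ [set i]) (itv i.+1 b), [set i] \in P & pblock P i = [set i]].
  move=> H nk; have [BP iB] := pblockP H iA.
  have BE : pblock P i = [set i].
    apply/setP => y; rewrite !inE; apply/idP/eqP => [yB|->//].
    apply/eqP; apply: contraT => yi; move: nk; rewrite /next.
    case E: (enum _) => [|k s] /= => [_|ki].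
      have : y \in enum (pblock P i :\ i) by rewrite mem_enum !inE yi.
      by rewrite E.
    have : k \in enum (pblock P i :\ i) by rewrite E mem_head.
    by rewrite mem_enum ki !inE eqxx.
  rewrite -BE; split=> //; rewrite BE in BP *.
  split=> [C|C y|y|C C' y|C C' u v y z].
  - by case/setD1P => _ /(ncp_ne H).
  - case/setD1P => Ci CP yC; rewrite mem_itv.
    have := ncp_sub H CP yC; rewrite mem_itv => /andP[iy ->].
    rewrite andbT ltn_neqAle iy andbT; apply: contra Ci => /eqP/val_inj yi; apply/eqP.
    by apply: (ncp_inj H CP BP yC); rewrite -yi inE.
  - rewrite mem_itv => /andP[iy yb]; have /(ncp_cov H)[C CP yC] : y \in itv i b.
      by rewrite mem_itv (ltnW iy).
    exists C => //; rewrite !inE CP andbT; apply/eqP => Ci.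
    by move: yC iy; rewrite Ci inE => /eqP ->; rewrite ltnn.
  - by case/setD1P => _ CP /setD1P[_ C'P]; apply: (ncp_inj H).
  - by case/setD1P => _ CP /setD1P[_ C'P]; apply: (ncp_nc H).
rewrite (reindex_onto (fun Q => [set i] |: Q) (fun P => P :\ [set i])) /=; last first.
  by move=> P /andP[/ncpP H /eqP nk]; have [_ iP _] := del1 P H nk; rewrite setD1K.
have setDi : [set i] :\ i = set0.
  by apply/setP => y; rewrite !inE andNb.
rewrite /ncsum mulr_sumr; apply: eq_big => [Q|Q] /=.
  apply/idP/idP => [/andP[/andP[/ncpP H /eqP nk] /eqP QE]|/ncpP H].
    by apply/ncpP; rewrite -QE; have [] := del1 _ H nk.
  have [HP pE] := add1 _ H; rewrite setU1K ?iNQ// eqxx andbT.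
  by apply/andP; split; [exact/ncpP | rewrite /next pE setDi enum_set0].
move=> /andP[/andP[/ncpP H /eqP nk] /eqP QE].
have [HQ _ pE] := del1 _ H nk; rewrite QE in HQ.
by rewrite pE setDi subw0 setU1K ?iNQ.
Qed.

(** The successor k of i in its block plays the role of the cut point of a convolution; the
    singleton block gives the term in g [::]. *)
Let ncsum1E g i (b : nat) : (i < b)%N -> ncsum1 g i b =
  g [::] * ncsum i.+1 b +
  \sum_(k : 'I_n | (i < k < b)%N) ncsum i.+1 k * ncsum1 (dword (x k) g) k b.
Proof.
move=> ib; rewrite /ncsum1 (partition_big (next i) (fun k => (i <= k < b)%N)).
  rewrite (bigD1 i) ?leqnn//= ncsum1_last//; congr (_ + _).
  apply: eq_big => [k|k /andP[/andP[ik kb] ki]].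
    by rewrite [(i < k)%N]ltn_neqAle [(i : nat) == k]eq_sym -[RHS]andbA andbC.
  by rewrite ncsum1_next// kb andbT ltn_neqAle ik andbT eq_sym.
move=> P /ncpP H; have [-> |ki] := eqVneq (next i P) i; first by rewrite leqnn.
by have [/andP[/ltnW-> ->]] := nextP H ib erefl ki.
Qed.

Let seg (a b : nat) : seq X := [seq x t | t <- iota a (b - a)].

Let seg_cons (a b : nat) : (a < b)%N -> seg a b = x a :: seg a.+1 b.
Proof. by move=> ab; rewrite /seg -(subnSK ab). Qed.

(** Both sums go through one induction on the length of the interval: [ncsum] calls [ncsum1] at the
    first point, which calls both on shorter intervals. *)
Let ncsum_seg (A : seq X -> K) : free_moments f A ->
  forall a b : nat, (a <= b <= n)%N -> ncsum a b = A (seg a b).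
Proof.
move=> [A0 AS] a b /andP[ab bn].
suff [//] : ncsum a b = A (seg a b) /\
  forall (i : 'I_n) g, i = a :> nat -> (i < b)%N ->
    ncsum1 g i b = conv A (subst A g) (seg i.+1 b).
have [m] := ubnP (b - a); elim: m a b ab bn => // m IHm a b ab bn mab.
have IH1 (i : 'I_n) g : i = a :> nat -> (i < b)%N ->
    ncsum1 g i b = conv A (subst A g) (seg i.+1 b).
  move=> ia ib; rewrite ncsum1E//.
  transitivity (g [::] * A (seg i.+1 b) + \sum_(i.+1 <= t < b)
      A (seg i.+1 t) * conv A (subst A (dword (x t) g)) (seg t.+1 b)).
    congr (_ * _ + _); first by apply: (proj1 (IHm _ _ _ _ _)) => //; lia.
    rewrite (big_nat_widen _ _ n)// (big_nat_widenl _ 0)// big_mkord.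
    apply: eq_big => [k|k /andP[ik kb]]; first by rewrite andbC.
    congr (_ * _); first by apply: (proj1 (IHm _ _ _ _ _)) => //; lia.
    by apply: (proj2 (IHm k b _ _ _)) => //; lia.
  rewrite convE big_ord_recr /= take_size drop_size subst_nil mulrC addrC.
  congr (_ + _).
  have sE : size (seg i.+1 b) = (b - i.+1)%N by rewrite size_map size_iota.
  rewrite sE -{1}[i.+1]add0n big_addn big_mkord; apply: eq_bigr => -[t tb] _ /=.
  congr (_ * _).
    by congr A; rewrite /seg -map_take take_iota addnK (minn_idPl (ltnW tb)).
  rewrite [in RHS](_ : drop t (seg i.+1 b) = seg (t + i.+1) b); last first.
    by rewrite /seg -map_drop drop_iota addnC subnDA subnAC.
  by rewrite (@seg_cons (t + i.+1)%N) ?subst_cons//; lia.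
split=> //; move: ab; rewrite leq_eqVlt => /predU1P[->|ab].
  by rewrite ncsum0 /seg subnn.
pose i : 'I_n := Ordinal (leq_trans ab bn).
rewrite -[a]/(i : nat) ncsumE// IH1// (@seg_cons i)// AS.
Qed.

Lemma noncrossing_sum_mkseq (A : seq X -> K) : free_moments f A ->
  \sum_(P in NC n) \prod_(B in P) f [seq x (val y) | y <- enum B] = A (mkseq x n).
Proof.
move=> fA; have := @ncsum_seg A fA 0 n; rewrite leqnn /seg subn0 => <- //.
apply: eq_bigl => P; rewrite !inE; congr (partition _ _ && _).
by apply/setP => y; rewrite !inE ltn_ord.
Qed.

End NoncrossingSums.

Lemma noncrossing_sum (K : comNzRingType) (f A : seq bool -> K) (w : seq bool) :
  free_moments f A ->
  \sum_(P in NC (size w)) \prod_(B in P) f (subword B) = A w.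
Proof.
move=> fA; rewrite -[in RHS](mkseq_nth false w) -(noncrossing_sum_mkseq _ _ fA).
apply: eq_bigr => P _; apply: eq_bigr => B _; congr f; apply: eq_map => y.
by rewrite (tnth_nth false).
Qed.

(** * Positive kernels *)

Section PositiveKernels.
Variable K : numClosedFieldType.

Definition kform (T : Type) (k : T -> T -> K) (L : seq (K * T)) : K :=
  \sum_(p <- L) \sum_(q <- L) p.1^* * q.1 * k p.2 q.2.

Definition psd (T : Type) (k : T -> T -> K) := forall L, 0 <= kform k L.

Lemma kform_cons T (k : T -> T -> K) p L : kform k (p :: L) =
  p.1^* * p.1 * k p.2 p.2 + p.1^* * (\sum_(q <- L) q.1 * k p.2 q.2) +
  p.1 * (\sum_(q <- L) q.1^* * k q.2 p.2) + kform k L.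
Proof.
rewrite /kform !big_cons.
have -> : \sum_(j <- L) \sum_(q <- p :: L) (j.1)^* * q.1 * k j.2 q.2 =
  p.1 * (\sum_(q <- L) q.1^* * k q.2 p.2) + kform k L.
  rewrite mulr_sumr -big_split /=; apply: eq_bigr => q _.
  by rewrite big_cons mulrCA mulrA.
rewrite addrA; congr (_ + _ + _); congr (_ + _).
by rewrite mulr_sumr; apply: eq_bigr => q _; rewrite mulrA.
Qed.

Lemma psd_ge0 T (k : T -> T -> K) x : psd k -> 0 <= k x x.
Proof.
by move=> /(_ [:: (1, x)]); rewrite kform_cons /kform !big_nil /= conjC1 !mul1r !addr0.
Qed.

(** The cross terms of the form at x and a y are real for every a; a = 1 and a = i suffice. *)
Lemma psd_herm T (k : T -> T -> K) x y : psd k -> k y x = (k x y)^*.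
Proof.
move=> kP; have xx := psd_ge0 x kP; have yy := psd_ge0 y kP.
have real a : a * k x y + a^* * k y x \is Num.real ->
    a^* * ((k x y)^* - k y x) = a * (k x y - (k y x)^*).
  move=> /CrealP; rewrite rmorphD !rmorphM /= conjCK => E.
  apply/eqP; rewrite -subr_eq0.
  have -> : a^* * ((k x y)^* - k y x) - a * (k x y - (k y x)^*) =
    a^* * (k x y)^* + a * (k y x)^* - (a * k x y + a^* * k y x) by ring.
  by rewrite E subrr.
have H a : a * k x y + a^* * k y x \is Num.real.
  have := kP [:: (1, x); (a, y)]; rewrite !kform_cons /kform !big_cons !big_nil /=.
  rewrite conjC1 !mulr0 !mul1r !addr0 => /ger0_real P0.
  have -> : a * k x y + a^* * k y x = (k x x + a * k x y + a^* * k y x +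
     a^* * a * k y y) - (k x x + a^* * a * k y y) by ring.
  have aa : 0 <= a^* * a by rewrite mulrC -normCK exprn_ge0.
  apply: rpredB; first exact: P0.
  by apply: rpredD; apply: ger0_real => //; apply: mulr_ge0.
have := real _ (H 1); rewrite conjC1 !mul1r => E1.
have := real _ (H 'i); rewrite conjCi E1 mulNr => /eqP.
rewrite eq_sym -subr_eq0 opprK -mulr2n mulrn_eq0 /= mulf_eq0 (negbTE (neq0Ci K)) /=.
by rewrite -E1 subr_eq0 => /eqP ->.
Qed.

Lemma psd_ext T (k k' : T -> T -> K) : (forall x y, k x y = k' x y) ->
  psd k -> psd k'.
Proof.
move=> kk kP L; rewrite (_ : kform k' L = kform k L)//.
by apply: eq_bigr => p _; apply: eq_bigr => q _; rewrite kk.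
Qed.

Lemma psdD T (k k' : T -> T -> K) : psd k -> psd k' ->
  psd (fun x y => k x y + k' x y).
Proof.
move=> kP kP' L; rewrite (_ : kform _ L = kform k L + kform k' L) ?addr_ge0//.
rewrite /kform -big_split; apply: eq_bigr => p _.
by rewrite -big_split; apply: eq_bigr => q _; rewrite mulrDr.
Qed.

Lemma psdZ T (k : T -> T -> K) c : 0 <= c -> psd k -> psd (fun x y => c * k x y).
Proof.
move=> c0 kP L; rewrite (_ : kform _ L = c * kform k L) ?mulr_ge0//.
rewrite /kform mulr_sumr; apply: eq_bigr => p _.
by rewrite mulr_sumr; apply: eq_bigr => q _; rewrite mulrCA.
Qed.

(** Partial maps also give direct sums of kernels, as sums of pullbacks with disjoint domains. *)
Lemma psd_pull T T' (k : T' -> T' -> K) (phi : T -> option T') : psd k ->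
  psd (fun x y => if phi x is Some a then
                    if phi y is Some b then k a b else 0 else 0).
Proof.
move=> kP L; pose L' := pmap (fun p => omap (pair p.1) (phi p.2)) L.
suff -> : kform (fun x y => if phi x is Some a then
    if phi y is Some b then k a b else 0 else 0) L = kform k L' by exact: kP.
have sumE (F : K -> T' -> K) : \sum_(q <- L') F q.1 q.2 =
    \sum_(q <- L) (if phi q.2 is Some b then F q.1 b else 0).
  rewrite /L'; elim: (L) => [|q M IH] /=; first by rewrite !big_nil.
  by rewrite big_cons -IH; case: (phi q.2) => [b|] /=; rewrite ?big_cons ?add0r.
rewrite /kform (sumE (fun c a => \sum_(q <- L') c^* * q.1 * k a q.2)).
apply: eq_bigr => p _; case: (phi p.2) => [a|]; last first.
  by rewrite big1// => q _; rewrite mulr0.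
rewrite (sumE (fun c b => p.1^* * c * k a b)); apply: eq_bigr => q _.
by case: (phi q.2) => // ; rewrite mulr0.
Qed.

(** This is the form of k on a vector minus its projection on x. When k x x = 0 the inverse is 0 and
    the kernel is unchanged. *)
Lemma psd_schur T (k : T -> T -> K) x : psd k ->
  psd (fun s t => k s t - k s x * k x t / k x x).
Proof.
move=> kP L; have [x0|x0] := eqVneq (k x x) 0.
  rewrite (_ : kform _ L = kform k L)//; apply: eq_bigr => p _.
  by apply: eq_bigr => q _; rewrite x0 invr0 mulr0 subr0.
pose S := \sum_(q <- L) q.1 * k x q.2.
have SC : \sum_(q <- L) q.1^* * k q.2 x = S^*.
  rewrite /S rmorph_sum; apply: eq_bigr => q _.
  by rewrite rmorphM /= -psd_herm.
have xxr : (k x x)^* = k x x by apply/CrealP/ger0_real/psd_ge0.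
have := kP ((- S / k x x, x) :: L); rewrite kform_cons /= SC -/S.
congr (0 <= _); rewrite rmorphM fmorphV rmorphN /= xxr.
transitivity (kform k L - S^* * S / k x x); first by field.
rewrite /kform -SC /S !mulr_suml -sumrB; apply: eq_bigr => p _.
rewrite mulr_sumr mulr_suml -sumrB; apply: eq_bigr => q _; ring.
Qed.

Lemma psd_null T (k : T -> T -> K) x t : psd k -> k x x = 0 -> k x t = 0.
Proof.
move=> kP x0; apply/eqP; apply: contraT => xt.
have tt : 0 <= k t t := psd_ge0 t kP.
have tx : k t x = (k x t)^* by apply: psd_herm.
have tx0 : (k x t)^* != 0 by rewrite conjC_eq0.
(* With this coefficient the form takes the value - k t t - 2, which is negative. *)
have := kP [:: (- (k t t + 1) / (k x t)^*, x); (1, t)].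
rewrite !kform_cons /kform !big_cons !big_nil /= conjC1 x0 tx !mulr0 !addr0 !mul1r.
have rt : (k t t)^* = k t t by apply/CrealP/ger0_real.
rewrite rmorphM fmorphV rmorphN rmorphD /= conjC1 conjCK rt.
rewrite divfK// divfK// add0r => H.
have : 0 <= - k t t - 2 by move: H; congr (0 <= _); ring.
rewrite lerBrDr add0r => H2.
have : 2 <= 0 :> K by rewrite (le_trans H2)// oppr_le0.
by rewrite lt_geF// ltr0n.
Qed.

(** Cholesky factorisation: the rank-one part of x is split off and the Schur complement is factored
    on the remaining points. Its vectors are cut to 0 at x, where the complement vanishes. *)
Lemma psd_gram (T : choiceType) (k : T -> T -> K) (D : seq T) : psd k ->
  exists us : seq (T -> K), {in D &, forall s t,
    k s t = \sum_(u <- us) (u s)^* * u t}.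
Proof.
elim: D k => [|x D IHD] k kP; first by exists [::].
have [us usP] := IHD _ (psd_schur x kP).
pose cut (u : T -> K) t := if t == x then 0 else u t.
exists ((fun t => k x t / sqrtC (k x x)) :: [seq cut u | u <- us]) => s t sD tD.
have x0 := psd_ge0 x kP.
rewrite big_cons big_map.
have -> : (k x s / sqrtC (k x x))^* * (k x t / sqrtC (k x x)) =
    k s x * k x t / k x x.
  rewrite rmorphM fmorphV /= -psd_herm//.
  rewrite (CrealP _) ?ger0_real ?sqrtC_ge0//.
  by rewrite mulrACA -invfM -expr2 sqrtCK.
apply/eqP; rewrite addrC -subr_eq; apply/eqP.
have kl y : k x y - k x x * k x y / k x x = 0.
  have [xx|xx] := eqVneq (k x x) 0; first by rewrite xx (psd_null _ kP xx) !mul0r subrr.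
  by rewrite mulrAC mulfV// mul1r subrr.
have kr y : k y x - k y x * k x x / k x x = 0.
  have [xx|xx] := eqVneq (k x x) 0; last by rewrite mulfK// subrr.
  by rewrite (psd_herm x y kP) (psd_null _ kP xx) conjC0 !mul0r subrr.
have [->|sx] := eqVneq s x.
  by rewrite kl big1// => u _; rewrite /cut eqxx conjC0 mul0r.
have [->|tx] := eqVneq t x.
  by rewrite kr big1// => u _; rewrite /cut eqxx mulr0.
rewrite !inE (negbTE sx) (negbTE tx) in sD tD.
rewrite usP//; apply: eq_bigr => u _.
by rewrite /cut (negbTE sx) (negbTE tx).
Qed.

(** Schur product theorem: a Gram factorisation of k on the finitely many points involved writes the
    form as a sum of values of the form of k'. *)
Lemma psdM (T T' : choiceType) (k : T -> T -> K) (k' : T' -> T' -> K) :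
  psd k -> psd k' -> psd (fun a b : T * T' => k a.1 b.1 * k' a.2 b.2).
Proof.
move=> kP kP' L.
have [us usP] := psd_gram [seq p.2.1 | p <- L] kP.
pose L' u := [seq (p.1 * u p.2.1, p.2.2) | p <- L].
rewrite (_ : kform _ L = \sum_(u <- us) kform k' (L' u)); last first.
  rewrite /kform (eq_bigr (fun u => \sum_(p <- L) \sum_(q <- L)
      (p.1 * u p.2.1)^* * (q.1 * u q.2.1) * k' p.2.2 q.2.2)); last first.
    by move=> u _; rewrite big_map; apply: eq_bigr => p _; rewrite big_map.
  rewrite [RHS]exchange_big /=; apply: eq_big_seq => p pL.
  rewrite [RHS]exchange_big /=; apply: eq_big_seq => q qL.
  rewrite usP ?(map_f (fun p : K * (T * T') => p.2.1))//.
  rewrite mulr_suml mulr_sumr; apply: eq_bigr => u _.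
  by rewrite rmorphM /=; ring.
by apply: sumr_ge0 => u _; apply: kP'.
Qed.

Section Stacks.
Variables (B : choiceType) (k : B -> B -> K).

Fixpoint stack_kernel (s t : seq B) : K :=
  match s, t with
  | [::], [::] => 1
  | a :: s', b :: t' => k a b * stack_kernel s' t'
  | _, _ => 0
  end.

Hypothesis kP : psd k.

(** The kernel is a direct sum of tensor powers of k. It is truncated by height, which suffices
    because a given combination only involves stacks of bounded height. *)
Lemma psd_stack : psd stack_kernel.
Proof.
have oneP : psd (fun _ _ : unit => 1 : K).
  move=> L; rewrite (_ : kform _ L = (\sum_(p <- L) p.1)^* * \sum_(p <- L) p.1).
    by rewrite mulrC -normCK exprn_ge0.
  rewrite rmorph_sum mulr_suml; apply: eq_bigr => p _.
  by rewrite mulr_sumr; apply: eq_bigr => q _; rewrite mulr1.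
pose cut := fix cut n (s t : seq B) : K := if n is n'.+1 then
  match s, t with
  | [::], [::] => 1
  | a :: s', b :: t' => k a b * cut n' s' t'
  | _, _ => 0
  end else 0.
have cutP n : psd (cut n).
  elim: n => [|n IHn].
    by move=> L; rewrite /kform !big1// => p _; rewrite big1// => q _; rewrite mulr0.
  pose p0 (s : seq B) := if s is [::] then Some tt else None.
  pose p1 (s : seq B) := if s is a :: s' then Some (a, s') else None.
  have := psdD (psd_pull p0 oneP) (psd_pull p1 (psdM kP IHn)).
  by apply: psd_ext => -[|a s] [|b t] //=; rewrite ?addr0 ?add0r.
have cutE n s t : (size s < n)%N -> cut n s t = stack_kernel s t.
  by elim: n s t => // n IHn [|a s] [|b t] //= sn; rewrite IHn.
move=> L; rewrite (_ : kform _ L = kform (cut (\max_(p <- L) size p.2).+1) L).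
  exact: cutP.
apply: eq_big_seq => p pL; apply: eq_bigr => q _; rewrite cutE// ltnS.
by apply: (@leq_bigmax_seq _ L xpredT (fun p : K * seq B => size p.2) p).
Qed.

End Stacks.

End PositiveKernels.

(* A representation of the free star-algebra by transposed operators [D l] on
   functions on a basis [S], with [(D l)^* = D (tau l)] for the form [k]. *)
Section AdjointModel.
Variables (K : numClosedFieldType) (X S : Type) (tau : X -> X).
Variables (D : X -> (S -> K) -> S -> K) (k : S -> S -> K) (o : S).
Hypothesis D_fin : forall l s, exists L : seq (K * S), forall h,
  D l h s = \sum_(p <- L) p.1 * h p.2.
Hypothesis D_adj : forall l t s,
  (D l (fun t' => (k t' s)^*) t)^* = D (tau l) (k t) s.
Hypothesis kP : psd k.

Let E (w : seq X) (h : S -> K) : S -> K := foldl (fun h l => D l h) h w.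

Let E_fin w s : exists L : seq (K * S), forall h,
  E w h s = \sum_(p <- L) p.1 * h p.2.
Proof.
elim: w s => [|l w IHw] s.
  by exists [:: (1, s)] => h; rewrite big_seq1 mul1r.
have [L LE] := IHw s.
have [M ME] : exists M : seq (K * S), forall h,
    \sum_(p <- L) p.1 * D l h p.2 = \sum_(p <- M) p.1 * h p.2.
  elim: (L) => [|[c t] L' [M ME]]; first by exists [::] => h; rewrite !big_nil.
  have [N NE] := D_fin l t; exists ([seq (c * q.1, q.2) | q <- N] ++ M) => h.
  rewrite big_cons ME big_cat big_map NE; congr (_ + _).
  by rewrite mulr_sumr; apply: eq_bigr => q _; rewrite mulrA.
by exists M => h; rewrite -ME -LE.
Qed.

(** The bra of the vector obtained from o by the operators of the word u. *)
Let G u s := (E u (fun t => (k t s)^*) o)^*.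

Let G_cons l u s : G (l :: u) s = D (tau l) (G u) s.
Proof.
have [L LE] := E_fin u o; have [M ME] := D_fin (tau l) s.
rewrite /G /= LE ME rmorph_sum /=.
rewrite (eq_bigr (fun p => p.1^* * D (tau l) (k p.2) s)); last first.
  by move=> p _; rewrite rmorphM /= D_adj.
rewrite (eq_bigr (fun p => \sum_(q <- M) p.1^* * (q.1 * k p.2 q.2))); last first.
  by move=> p _; rewrite ME mulr_sumr.
rewrite exchange_big; apply: eq_bigr => q _.
rewrite LE rmorph_sum mulr_sumr; apply: eq_bigr => p _ /=.
by rewrite rmorphM /= conjCK mulrCA.
Qed.

Lemma model_adjoint u v : E (catrev (map tau u) v) (k o) o = E v (G u) o.
Proof.
elim: u v => [|l u IHu] v /=.
  by congr E; apply/funext => s; rewrite /G /= conjCK.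
by rewrite IHu /=; congr E; apply/funext => s; rewrite G_cons.
Qed.

(** By adjointness this is the Gram kernel of the vectors obtained from o by words; M expands a
    combination of these vectors over the basis. *)
Lemma model_psd : psd (fun u v => E (catrev (map tau u) v) (k o) o).
Proof.
move=> L.
have [M ME] : exists M : seq (K * S), forall h,
    \sum_(p <- L) p.1 * E p.2 h o = \sum_(p <- M) p.1 * h p.2.
  elim: (L) => [|[c t] L' [M ME]]; first by exists [::] => h; rewrite !big_nil.
  have [N NE] := E_fin t o; exists ([seq (c * q.1, q.2) | q <- N] ++ M) => h.
  rewrite big_cons ME big_cat big_map NE; congr (_ + _).
  by rewrite mulr_sumr; apply: eq_bigr => q _; rewrite mulrA.
rewrite (_ : kform _ L = kform k M)//.
transitivity (\sum_(p <- L) \sum_(q <- M) p.1^* * q.1 * G p.2 q.2).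
  apply: eq_bigr => p _.
  rewrite (eq_bigr (fun q => p.1^* * (q.1 * E q.2 (G p.2) o))); last first.
    by move=> q _; rewrite model_adjoint mulrA.
  by rewrite -mulr_sumr ME mulr_sumr; apply: eq_bigr => q _; rewrite mulrA.
rewrite exchange_big [RHS]exchange_big; apply: eq_bigr => q _ /=.
transitivity (q.1 * (\sum_(p <- L) p.1 * E p.2 (fun t => (k t q.2)^*) o)^*).
  rewrite rmorph_sum mulr_sumr; apply: eq_bigr => p _.
  by rewrite rmorphM /= mulrCA mulrA.
rewrite ME rmorph_sum mulr_sumr; apply: eq_bigr => p _.
by rewrite rmorphM /= conjCK mulrCA mulrA.
Qed.

End AdjointModel.

(** * Positivity of free and boolean moments *)

Section PositiveMoments.
Variables (K : numClosedFieldType) (X : choiceType) (tau : X -> X).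
Variable f : seq X -> K.

(* Conditional positivity: positivity on polynomials without constant term. *)
Definition cond_psd := psd (fun a b : X * seq X =>
  f (catrev (map tau (a.1 :: a.2)) (b.1 :: b.2))).

Hypothesis f_herm : forall l w,
  f (catrev (map tau (l :: w)) [::]) = (f (l :: w))^*.
Hypothesis fP : cond_psd.

(** Creation of l is adjoint to removal of the top word by tau l, and prepending l to prepending tau
    l. The scalar parts are adjoint by [f_herm]: positivity tests pairs of non-empty words and is
    silent on single letters. *)
Lemma mom_psd : psd (fun u v => mom f (catrev (map tau u) v)).
Proof.
pose kb (a b : X * seq X) := f (catrev (map tau (a.1 :: a.2)) (b.1 :: b.2)).
have E0 : stack_kernel kb [::] = vacuum K (X := X).
  by apply/funext => -[|b s].
have herm1 l : f [:: tau l] = (f [:: l])^* by rewrite -f_herm.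
have herm2 l x r : (f (l :: x :: r))^* = kb (x, r) (tau l, [::]).
  by rewrite -f_herm.
have := @model_psd K X (seq (X * seq X)) tau (fock_dual f) (stack_kernel kb) [::].
rewrite E0; apply => //; last exact: psd_stack.
- move=> l s; case: s => [|[x r] s].
    exists [:: (1, [:: (l, [::])]); (f [:: l], [::])] => h.
    by rewrite !big_cons big_nil /fock_dual /=; ring.
  exists [:: (1, [:: (l, [::]), (x, r) & s]); (f [:: l], (x, r) :: s);
             (1, (l, x :: r) :: s); (f (l :: x :: r), s)] => h.
  by rewrite !big_cons big_nil /fock_dual /=; ring.
- have k1 a b s t : stack_kernel kb (a :: s) (b :: t) = kb a b * stack_kernel kb s t.
    by [].
  have k2 a s : stack_kernel kb (a :: s) [::] = 0 by [].
  have k3 a s : stack_kernel kb [::] (a :: s) = 0 by [].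
  have k4 l y q : kb (l, [::]) (y, q) = f [:: tau l, y & q] by [].
  have k5 l x r y q : kb (l, x :: r) (y, q) = kb (x, r) (tau l, y :: q) by [].
  move: (stack_kernel kb) k1 k2 k3 k4 k5 => k k1 k2 k3 k4 k5.
  move=> l [|[x r] t] [|[y q] s]; rewrite /fock_dual !rmorphD !rmorphM ?rmorph0 /= !conjCK;
    rewrite ?k1 ?k2 ?k3 ?k4 ?k5 ?herm1 ?herm2; ring.
Qed.

(* [boolean_moments f]: the series [(1 - f)^-1]. *)
Definition boolean_moments (A : seq X -> K) :=
  A [::] = 1 /\ forall l w, A (l :: w) = conv (dword l f) A w.

(** Transpose of the operator sending v to l v + f(l v) 1, where the empty word spans the scalars
    and the other words the one-particle space. *)
Definition bool_dual l (h : seq X -> K) v : K := h (l :: v) + f (l :: v) * h [::].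

(** The word w sends the empty word to the sum of A(v) u over all factorisations w = u v. *)
Lemma bool_dual_moments A : boolean_moments A -> forall w h,
  foldl (fun h l => bool_dual l h) h w [::] = conv h A w.
Proof.
move=> [A0 AS]; elim=> [|l w IHw] h /=; first by rewrite A0 mulr1.
rewrite IHw AS -convZl -convDl; apply: conv_ext => // v.
by rewrite /bool_dual mulrC.
Qed.

Lemma boolean_psd A : boolean_moments A ->
  psd (fun u v => A (catrev (map tau u) v)).
Proof.
move=> fA; pose kb (u v : seq X) : K := match u, v with
  | [::], [::] => 1
  | x :: r, y :: q => f (catrev (map tau (x :: r)) (y :: q))
  | _, _ => 0 end.
have E0 : kb [::] = @delta0 K X by apply/funext => -[|b s].
have herm1 l : f [:: tau l] = (f [:: l])^* by rewrite -f_herm.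
have herm2 l x r : (f (l :: x :: r))^* = kb (x :: r) [:: tau l].
  by rewrite -f_herm.
have kbP : psd kb.
  have oneP : psd (fun _ _ : unit => 1 : K).
    move=> L; rewrite (_ : kform _ L = (\sum_(p <- L) p.1)^* * \sum_(p <- L) p.1).
      by rewrite mulrC -normCK exprn_ge0.
    rewrite rmorph_sum mulr_suml; apply: eq_bigr => p _.
    by rewrite mulr_sumr; apply: eq_bigr => q _; rewrite mulr1.
  pose p0 (s : seq X) := if s is [::] then Some tt else None.
  pose p1 (s : seq X) := if s is a :: s' then Some (a, s') else None.
  have := psdD (psd_pull p0 oneP) (psd_pull p1 fP).
  by apply: psd_ext => -[|a s] [|b t] //=; rewrite ?addr0 ?add0r.
have := @model_psd K X (seq X) tau bool_dual kb [::].
rewrite E0 => H; apply: (psd_ext _ (H _ _ _)) => //.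
- by move=> u v; rewrite (bool_dual_moments fA) conv1l.
- move=> l s; exists [:: (1, l :: s); (f (l :: s), [::])] => h.
  by rewrite !big_cons big_nil /bool_dual /=; ring.
- move=> l [|x t] [|y s]; rewrite /bool_dual !rmorphD !rmorphM /= ?conjCK ?herm1 ?herm2 ?conjC1 ?conjC0 //=.
  all: rewrite /kb /=; ring.
Qed.

End PositiveMoments.

(** * Completion of a star-algebra *)

(** A star-algebra with a C*-seminorm that dominates a state; the seminorm may vanish on non-zero
    elements, which become 0 in the completion. *)
Record preCstar (R : realType) := PreCstar {
  pc_alg :> algType R[i]%C;
  pc_star : pc_alg -> pc_alg;
  pc_norm : pc_alg -> R;
  pc_state : {scalar pc_alg};
  pc_starK : involutive pc_star;
  pc_starD : {morph pc_star : x y / x + y};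
  pc_starZ : forall (c : R[i]%C) x, pc_star (c *: x) = Num.conj c *: pc_star x;
  pc_starM : forall x y, pc_star (x * y) = pc_star y * pc_star x;
  pc_normD : forall x y, pc_norm (x + y) <= pc_norm x + pc_norm y;
  pc_normZ : forall (c : R[i]%C) x, (pc_norm (c *: x))%:C%C = `|c| * (pc_norm x)%:C%C;
  pc_normM : forall x y, pc_norm (x * y) <= pc_norm x * pc_norm y;
  pc_norm_star_mul : forall x, pc_norm (pc_star x * x) = pc_norm x ^+ 2;
  pc_state_le : forall x, `|pc_state x| <= (pc_norm x)%:C%C;
  pc_state_ge0 : forall x, 0 <= pc_state (pc_star x * x);
  pc_state1 : pc_state 1 = 1
}.

Section Completion.
Variables (R : realType) (A : preCstar R).
Notation C := R[i]%C.
Notation p := (@pc_norm R A).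
Notation st := (@pc_star R A).
Notation phi := (@pc_state R A).
Implicit Types (x y : A) (u v w : nat -> A) (e : R).

Definition nrc (c : C) : R := complex.Re `|c|.

Lemma nrcE (c : C) : `|c| = (nrc c)%:C%C.
Proof. by rewrite /nrc normc_def. Qed.

Lemma nrc_ge0 (c : C) : 0 <= nrc c.
Proof. by rewrite -ler0c -nrcE. Qed.

Lemma pc_normZE (c : C) x : p (c *: x) = nrc c * p x.
Proof.
by apply: complexI; rewrite pc_normZ nrcE -[RHS]/((_ * _)%:C%C) rmorphM.
Qed.

Lemma pc_norm0 : p 0 = 0.
Proof. by rewrite -(scale0r 0) pc_normZE /nrc normr0 mul0r. Qed.

Lemma pc_normN x : p (- x) = p x.
Proof. by rewrite -scaleN1r pc_normZE /nrc normrN1 mul1r. Qed.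

Lemma pc_norm_ge0 x : 0 <= p x.
Proof.
have := pc_normD x (- x); rewrite subrr pc_norm0 pc_normN -mulr2n.
by rewrite pmulrn_lge0.
Qed.

Lemma pc_normB x y : p (x - y) = p (y - x).
Proof. by rewrite -pc_normN opprB. Qed.

Lemma pc_starN x : st (- x) = - st x.
Proof. by rewrite -[- x]scaleN1r pc_starZ rmorphN1 scaleN1r. Qed.

Lemma pc_norm_star x : p (st x) = p x.
Proof.
have le y : p y <= p (st y).
  have [->|p0] := eqVneq (p y) 0; first exact: pc_norm_ge0.
  rewrite -(@ler_pM2r _ (p y)) ?lt0r ?p0 ?pc_norm_ge0// -expr2.
  by rewrite -pc_norm_star_mul pc_normM.
by apply/eqP; rewrite eq_le le -{2}(pc_starK x) le.
Qed.

Lemma pc_norm_dist x y : `|p x - p y| <= p (x - y).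
Proof.
rewrite ler_norml lerBlDr lerBrDr; apply/andP; split.
  rewrite addrC lerBlDr pc_normB (le_trans _ (pc_normD _ _))// addrC subrK//.
by rewrite (le_trans _ (pc_normD _ _))// subrK.
Qed.

Definition pcauchy u := forall e, 0 < e ->
  exists N, forall m n, (N <= m)%N -> (N <= n)%N -> p (u m - u n) < e.

Definition pnull u := forall e, 0 < e ->
  exists N, forall n, (N <= n)%N -> p (u n) < e.

Lemma pnullD u v : pnull u -> pnull v -> pnull (fun n => u n + v n).
Proof.
move=> u0 v0 e e0; have e2 : 0 < e / 2 by rewrite divr_gt0.
have [N NP] := u0 _ e2; have [M MP] := v0 _ e2; exists (maxn N M) => n.
rewrite geq_max => /andP[Nn Mn]; rewrite (le_lt_trans (pc_normD _ _))//.
by rewrite (splitr e) ltrD ?NP ?MP.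
Qed.

Lemma pnull_le u v (k : R) : 0 < k -> (exists N, forall n, (N <= n)%N -> p (v n) <= k * p (u n)) ->
  pnull u -> pnull v.
Proof.
move=> k0 [M MP] u0 e e0; have ek : 0 < e / k by rewrite divr_gt0.
have [N NP] := u0 _ ek; exists (maxn N M) => n.
rewrite geq_max => /andP[Nn Mn]; rewrite (le_lt_trans (MP _ Mn))//.
by rewrite mulrC -ltr_pdivlMr// NP.
Qed.

Lemma pcauchyD u v : pcauchy u -> pcauchy v -> pcauchy (fun n => u n + v n).
Proof.
move=> uC vC e e0; have e2 : 0 < e / 2 by rewrite divr_gt0.
have [N NP] := uC _ e2; have [M MP] := vC _ e2; exists (maxn N M) => m n.
rewrite !geq_max => /andP[Nm Mm] /andP[Nn Mn].
rewrite opprD addrACA (le_lt_trans (pc_normD _ _))//.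
by rewrite (splitr e) ltrD ?NP ?MP.
Qed.

Lemma pcauchy_bounded u : pcauchy u ->
  exists k : R, 0 < k /\ exists N, forall n, (N <= n)%N -> p (u n) <= k.
Proof.
move=> /(_ 1 ltr01) [N NP]; exists (1 + p (u N)); split.
  by rewrite ltr_pwDl// pc_norm_ge0.
exists N => n Nn; rewrite -[u n](subrK (u N)) (le_trans (pc_normD _ _))//.
by rewrite lerD2r ltW// NP.
Qed.

Lemma pcauchy_le u v (k : R) : 0 < k -> (forall m n, p (v m - v n) <= k * p (u m - u n)) ->
  pcauchy u -> pcauchy v.
Proof.
move=> k0 kv uC e e0; have ek : 0 < e / k by rewrite divr_gt0.
have [N NP] := uC _ ek; exists N => m n Nm Nn.
by rewrite (le_lt_trans (kv _ _))// mulrC -ltr_pdivlMr// NP.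
Qed.

Lemma pcauchy_cst x : pcauchy (fun=> x).
Proof. by move=> e e0; exists 0 => m n _ _; rewrite subrr pc_norm0. Qed.

Lemma pcauchyZ c u : pcauchy u -> pcauchy (fun n => c *: u n).
Proof.
apply: (@pcauchy_le _ _ (nrc c + 1)); first by rewrite ltr_wpDl// nrc_ge0.
by move=> m n; rewrite -scalerBr pc_normZE ler_wpM2r ?pc_norm_ge0// lerDl.
Qed.

Lemma pcauchyN u : pcauchy u -> pcauchy (fun n => - u n).
Proof.
by move=> /(pcauchyZ (-1)); congr pcauchy; apply/funext => n; rewrite scaleN1r.
Qed.

Lemma pcauchy_star u : pcauchy u -> pcauchy (fun n => st (u n)).
Proof.
apply: (@pcauchy_le _ _ 1) => // m n.
by rewrite -pc_starN -pc_starD pc_norm_star mul1r.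
Qed.

Lemma pcauchyM u v : pcauchy u -> pcauchy v -> pcauchy (fun n => u n * v n).
Proof.
move=> uC vC; have [k [k0 [N NP]]] := pcauchy_bounded uC.
have [l [l0 [M MP]]] := pcauchy_bounded vC => e e0.
have [N' NP'] := uC (e / 2 / l) ltac:(by rewrite !divr_gt0).
have [M' MP'] := vC (e / 2 / k) ltac:(by rewrite !divr_gt0).
exists (maxn (maxn N M) (maxn N' M')) => m n.
rewrite !geq_max => /andP[/andP[Nm Mm] /andP[N'm M'm]] /andP[/andP[Nn Mn] /andP[N'n M'n]].
have -> : u m * v m - u n * v n = (u m - u n) * v m + u n * (v m - v n).
  by rewrite mulrBl mulrBr addrA subrK.
rewrite (le_lt_trans (pc_normD _ _))// (splitr e) ltrD//.
  rewrite (le_lt_trans (pc_normM _ _))// -[ltRHS](divfK (lt0r_neq0 l0)).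
  by rewrite (le_lt_trans (ler_wpM2l (pc_norm_ge0 _) (MP _ Mm)))// ltr_pM2r// NP'.
rewrite (le_lt_trans (pc_normM _ _))// -[ltRHS](divfK (lt0r_neq0 k0)) [ltRHS]mulrC.
by rewrite (le_lt_trans (ler_wpM2r (pc_norm_ge0 _) (NP _ Nn)))// ltr_pM2l// MP'.
Qed.

Lemma pnullMl u v : pcauchy u -> pnull v -> pnull (fun n => u n * v n).
Proof.
move=> /pcauchy_bounded[k [k0 [N NP]]]; apply: (pnull_le k0); exists N => n Nn.
by rewrite (le_trans (pc_normM _ _))// ler_wpM2r ?pc_norm_ge0 ?NP.
Qed.

Lemma pnullMr u v : pcauchy u -> pnull v -> pnull (fun n => v n * u n).
Proof.
move=> /pcauchy_bounded[k [k0 [N NP]]]; apply: (pnull_le k0); exists N => n Nn.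
by rewrite (le_trans (pc_normM _ _))// mulrC ler_wpM2r ?pc_norm_ge0 ?NP.
Qed.

Definition peqv u v := pnull (fun n => u n - v n).

Lemma peqv_refl u : peqv u u.
Proof. by move=> e e0; exists 0 => n _; rewrite subrr pc_norm0. Qed.

Lemma peqv_sym u v : peqv u v -> peqv v u.
Proof. by move=> uv e /uv[N NP]; exists N => n /NP; rewrite pc_normB. Qed.

Lemma peqv_trans v u w : peqv u v -> peqv v w -> peqv u w.
Proof.
move=> uv vw; have := pnullD uv vw; congr pnull; apply/funext => n.
by rewrite addrA subrK.
Qed.

(** Cauchy sequences modulo null sequences, so that separation and completion are a single
    quotient. *)
Record compl := Compl {
  compl_class : set (nat -> A);
  compl_classP : exists2 u, pcauchy u & compl_class = [set v | peqv u v]%classic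
}.

(** The default 0 makes [pi] total. *)
Definition tocauchy u : nat -> A := if `[< pcauchy u >] then u else fun=> 0.

Lemma tocauchyP u : pcauchy (tocauchy u).
Proof. by rewrite /tocauchy; case: asboolP => // _; apply: pcauchy_cst. Qed.

Definition pi u : compl :=
  Compl (ex_intro2 _ _ (tocauchy u) (tocauchyP u) erefl).

Definition rep (X : compl) : nat -> A := projT1 (cid2 (compl_classP X)).

Lemma compl_eq (X Y : compl) : compl_class X = compl_class Y -> X = Y.
Proof.
case: X Y => [X XP] [Y YP] /= XY; case: Y / XY YP => YP.
by congr Compl; exact: Prop_irrelevance.
Qed.

Lemma rep_cauchy X : pcauchy (rep X).
Proof. by rewrite /rep; case: cid2. Qed.

Lemma pi_eq u v : pcauchy u -> pcauchy v -> peqv u v -> pi u = pi v.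
Proof.
move=> uC vC uv; apply: compl_eq; rewrite /= /tocauchy !asboolT//.
apply/funext => w; apply/propext; split => /=.
  exact: peqv_trans (peqv_sym uv).
exact: peqv_trans uv.
Qed.

Lemma pi_rep X : pi (rep X) = X.
Proof.
apply: compl_eq; rewrite /= /tocauchy asboolT; last exact: rep_cauchy.
by rewrite /rep; case: cid2.
Qed.

Lemma rep_pi u : pcauchy u -> peqv (rep (pi u)) u.
Proof.
move=> uC; have := pi_rep (pi u) => /(congr1 compl_class) /=.
rewrite /tocauchy !asboolT//; last exact: rep_cauchy.
move=> /(congr1 (fun S : set (nat -> A) => S u)) /= ->; exact: peqv_refl.
Qed.

Lemma pi_inj u v : pcauchy u -> pcauchy v -> pi u = pi v -> peqv u v.
Proof.
move=> uC vC uv; apply: peqv_trans (rep_pi vC).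
by rewrite -uv; apply: peqv_sym; apply: rep_pi.
Qed.

HB.instance Definition _ := gen_eqMixin compl.
HB.instance Definition _ := gen_choiceMixin compl.

Definition cadd X Y := pi (fun n => rep X n + rep Y n).
Definition cmul X Y := pi (fun n => rep X n * rep Y n).
Definition cscale (c : C) X := pi (fun n => c *: rep X n).
Definition cstar X := pi (fun n => st (rep X n)).
Definition cinj x := pi (fun=> x).

Lemma piD u v : pcauchy u -> pcauchy v -> cadd (pi u) (pi v) = pi (fun n => u n + v n).
Proof.
move=> uC vC; apply: pi_eq; do ?[exact: pcauchyD | apply: pcauchyD; exact: rep_cauchy].
have := pnullD (rep_pi uC) (rep_pi vC); congr pnull; apply/funext => n.
by rewrite opprD addrACA.
Qed.

Lemma piM u v : pcauchy u -> pcauchy v -> cmul (pi u) (pi v) = pi (fun n => u n * v n).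
Proof.
move=> uC vC; apply: pi_eq; do ?[exact: pcauchyM | apply: pcauchyM; exact: rep_cauchy].
have := pnullD (pnullMr (rep_cauchy (pi v)) (rep_pi uC)) (pnullMl uC (rep_pi vC)).
by congr pnull; apply/funext => n; rewrite mulrBl mulrBr addrA subrK.
Qed.

Lemma piZ c u : pcauchy u -> cscale c (pi u) = pi (fun n => c *: u n).
Proof.
move=> uC; apply: pi_eq; do ?[exact: pcauchyZ | apply: pcauchyZ; exact: rep_cauchy].
have c0 : 0 < nrc c + 1 by rewrite ltr_wpDl// nrc_ge0.
apply: (pnull_le c0) (rep_pi uC); exists 0 => n _.
by rewrite -scalerBr pc_normZE ler_wpM2r ?pc_norm_ge0// lerDl.
Qed.

Lemma pi_star u : pcauchy u -> cstar (pi u) = pi (fun n => st (u n)).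
Proof.
move=> uC; apply: pi_eq; do ?[exact: pcauchy_star | apply: pcauchy_star; exact: rep_cauchy].
apply: (pnull_le ltr01) (rep_pi uC); exists 0 => n _.
by rewrite -pc_starN -pc_starD pc_norm_star mul1r.
Qed.

Lemma piP X : exists2 u, pcauchy u & X = pi u.
Proof. by exists (rep X); [exact: rep_cauchy | rewrite pi_rep]. Qed.

Let copp (X : compl) := cscale (-1) X.

Let caddA : associative cadd.
Proof.
move=> X Y Z; have [u uC ->] := piP X; have [v vC ->] := piP Y.
have [w wC ->] := piP Z; rewrite !piD//; do ?exact: pcauchyD.
by congr pi; apply/funext => n; rewrite addrA.
Qed.

Let caddC : commutative cadd.
Proof.
move=> X Y; have [u uC ->] := piP X; have [v vC ->] := piP Y.
by rewrite !piD//; congr pi; apply/funext => n; rewrite addrC.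
Qed.

Let cadd0 : left_id (cinj 0) cadd.
Proof.
move=> X; have [u uC ->] := piP X; rewrite piD//; last exact: pcauchy_cst.
by congr pi; apply/funext => n; rewrite add0r.
Qed.

Let caddN : left_inverse (cinj 0) copp cadd.
Proof.
move=> X; have [u uC ->] := piP X; rewrite /copp piZ// piD//; last exact: pcauchyZ.
by congr pi; apply/funext => n; rewrite scaleN1r addNr.
Qed.

HB.instance Definition _ :=
  GRing.isZmodule.Build compl caddA caddC cadd0 caddN.

Let cmulA : associative cmul.
Proof.
move=> X Y Z; have [u uC ->] := piP X; have [v vC ->] := piP Y.
have [w wC ->] := piP Z; rewrite !piM//; do ?exact: pcauchyM.
by congr pi; apply/funext => n; rewrite mulrA.
Qed.

Let cmul1 : left_id (cinj 1) cmul.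
Proof.
move=> X; have [u uC ->] := piP X; rewrite piM//; last exact: pcauchy_cst.
by congr pi; apply/funext => n; rewrite mul1r.
Qed.

Let cmulr1 : right_id (cinj 1) cmul.
Proof.
move=> X; have [u uC ->] := piP X; rewrite piM//; last exact: pcauchy_cst.
by congr pi; apply/funext => n; rewrite mulr1.
Qed.

Let cmulDl : left_distributive cmul cadd.
Proof.
move=> X Y Z; have [u uC ->] := piP X; have [v vC ->] := piP Y.
have [w wC ->] := piP Z.
rewrite piD// !piM//; do ?[exact: pcauchyD | exact: pcauchyM].
rewrite piD//; do ?exact: pcauchyM.
by congr pi; apply/funext => n; rewrite mulrDl.
Qed.

Let cmulDr : right_distributive cmul cadd.
Proof.
move=> X Y Z; have [u uC ->] := piP X; have [v vC ->] := piP Y.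
have [w wC ->] := piP Z.
rewrite piD// !piM//; do ?[exact: pcauchyD | exact: pcauchyM].
rewrite piD//; do ?exact: pcauchyM.
by congr pi; apply/funext => n; rewrite mulrDr.
Qed.

(** The state keeps 1 away from 0: its seminorm is at least the modulus of phi 1 = 1. *)
Let cone_neq0 : cinj 1 != cinj 0.
Proof.
apply/eqP => /(pi_inj (pcauchy_cst _) (pcauchy_cst _)) /(_ 1 ltr01) [N] /(_ N (leqnn N)).
rewrite subr0; have := pc_state_le (1 : A); rewrite pc_state1 normr1 -[1]/(1%:C%C) lecR.
by rewrite leNgt => /negP.
Qed.

HB.instance Definition _ := GRing.Zmodule_isNzRing.Build compl
  cmulA cmul1 cmulr1 cmulDl cmulDr cone_neq0.

Let cscaleA a b X : cscale a (cscale b X) = cscale (a * b) X.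
Proof.
have [u uC ->] := piP X; rewrite !piZ//; last exact: pcauchyZ.
by congr pi; apply/funext => n; rewrite scalerA.
Qed.

Let cscale1 : left_id 1 cscale.
Proof.
move=> X; have [u uC ->] := piP X; rewrite piZ//.
by congr pi; apply/funext => n; rewrite scale1r.
Qed.

Let cscaleDr : right_distributive cscale +%R.
Proof.
move=> c X Y; have [u uC ->] := piP X; have [v vC ->] := piP Y.
rewrite -[_ + _]/(cadd _ _) -[RHS]/(cadd _ _) !(piD, piZ)//; do ?[exact: pcauchyD | exact: pcauchyZ].
by congr pi; apply/funext => n; rewrite scalerDr.
Qed.

Let cscaleDl X : {morph cscale^~ X : a b / a + b}.
Proof.
move=> a b; have [u uC ->] := piP X.
rewrite -[RHS]/(cadd _ _) !piZ// piD//; do ?exact: pcauchyZ.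
by congr pi; apply/funext => n; rewrite scalerDl.
Qed.

HB.instance Definition _ := GRing.Zmodule_isLmodule.Build C compl
  cscaleA cscale1 cscaleDr cscaleDl.

Let cscaleAl (c : C) (X Y : compl) : c *: (X * Y) = (c *: X) * Y.
Proof.
have [u uC ->] := piP X; have [v vC ->] := piP Y.
rewrite -[LHS]/(cscale c (cmul _ _)) -[RHS]/(cmul (cscale c _) _).
rewrite !(piM, piZ)//; do ?[exact: pcauchyM | exact: pcauchyZ].
by congr pi; apply/funext => n; rewrite scalerAl.
Qed.

HB.instance Definition _ := GRing.Lmodule_isLalgebra.Build C compl cscaleAl.

Let cscaleAr (c : C) (X Y : compl) : c *: (X * Y) = X * (c *: Y).
Proof.
have [u uC ->] := piP X; have [v vC ->] := piP Y.
rewrite -[LHS]/(cscale c (cmul _ _)) -[RHS]/(cmul _ (cscale c _)).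
rewrite !(piM, piZ)//; do ?[exact: pcauchyM | exact: pcauchyZ].
by congr pi; apply/funext => n; rewrite scalerAr.
Qed.

HB.instance Definition _ := GRing.Lalgebra_isAlgebra.Build C compl cscaleAr.

Lemma piDE u v : pcauchy u -> pcauchy v -> pi u + pi v = pi (fun n => u n + v n).
Proof. exact: piD. Qed.

Lemma piME u v : pcauchy u -> pcauchy v -> pi u * pi v = pi (fun n => u n * v n).
Proof. exact: piM. Qed.

Lemma piZE c u : pcauchy u -> c *: pi u = pi (fun n => c *: u n).
Proof. exact: piZ. Qed.

Lemma piBE u v : pcauchy u -> pcauchy v -> pi u - pi v = pi (fun n => u n - v n).
Proof.
move=> uC vC; rewrite -scaleN1r piZE// piDE//; last exact: pcauchyZ.
by congr pi; apply/funext => n; rewrite scaleN1r.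
Qed.

Local Open Scope classical_set_scope.

Lemma real_cauchy_cvg (a : nat -> R) :
  (forall e, 0 < e -> exists N, forall m n, (N <= m)%N -> (N <= n)%N -> `|a m - a n| < e) ->
  exists l : R, a n @[n --> \oo] --> l.
Proof.
move=> aC; suff : cvg (a n @[n --> \oo]) by move=> /cvg_ex.
apply: R_complete; apply: cauchy_exP => e e0.
have [N NP] := aC e e0; exists (a N); rewrite -ball_normE.
exists N => // n Nn; exact: NP.
Qed.

Lemma cvg_dist (a b : nat -> R) (u : nat -> A) (l : R) :
  (forall n, `|a n - b n| <= p (u n)) -> pnull u ->
  a n @[n --> \oo] --> l -> b n @[n --> \oo] --> l.
Proof.
move=> ab u0 al; apply/cvgrPdist_lt => e e0; have e2 : 0 < e / 2 by rewrite divr_gt0.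
have [N NP] := u0 _ e2; move/cvgrPdist_lt: al => /(_ _ e2)[M _ MP].
exists (maxn N M) => // n; rewrite /= geq_max => /andP[Nn Mn].
rewrite -(subrK (a n) l) -addrA (le_lt_trans (ler_normD _ _))//.
by rewrite (splitr e) ltrD// ?MP// (le_lt_trans (ab n))// NP.
Qed.

Definition cnormc (X : compl) : R := lim (p (rep X n) @[n --> \oo]).

Lemma cnorm_pi u : pcauchy u -> p (u n) @[n --> \oo] --> cnormc (pi u).
Proof.
move=> uC; apply: (cvg_dist (fun n => pc_norm_dist (rep (pi u) n) (u n)) (rep_pi uC)).
have : exists l : R, p (rep (pi u) n) @[n --> \oo] --> l; last by move=> [l /cvgP].
apply: real_cauchy_cvg => e e0; have [N NP] := rep_cauchy (pi u) e0.
by exists N => m n Nm Nn; rewrite (le_lt_trans (pc_norm_dist _ _))// NP.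
Qed.

Lemma cnorm_eq u l : pcauchy u -> p (u n) @[n --> \oo] --> l -> cnormc (pi u) = l.
Proof. by move=> uC; apply: cvg_unique => //; exact: cnorm_pi. Qed.

Lemma cnorm_cinj x : cnormc (cinj x) = p x.
Proof. by apply: cnorm_eq; [exact: pcauchy_cst | exact: cvg_cst]. Qed.

Lemma cnorm_le u e : pcauchy u -> (exists N, forall n, (N <= n)%N -> p (u n) <= e) ->
  cnormc (pi u) <= e.
Proof.
move=> uC [N NP]; apply: (ler_cvg_to (cnorm_pi uC) (cvg_cst e)).
by exists N.
Qed.

Lemma cnormc_ge0 X : 0 <= cnormc X.
Proof.
have [u uC ->] := piP X; apply: (ler_cvg_to (cvg_cst 0) (cnorm_pi uC)).
by exists 0 => // n _; exact: pc_norm_ge0.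
Qed.

Lemma cnormc_eq0 X : cnormc X = 0 -> X = 0.
Proof.
have [u uC ->] := piP X => u0; apply: pi_eq => //; first exact: pcauchy_cst.
have := cnorm_pi uC; rewrite u0 => /cvgrPdist_lt H e e0; have [N _ NP] := H e e0.
exists N => n /NP; rewrite /= sub0r normrN subr0 ger0_norm//.
exact: pc_norm_ge0.
Qed.

Lemma cnormcD X Y : cnormc (X + Y) <= cnormc X + cnormc Y.
Proof.
have [u uC ->] := piP X; have [v vC ->] := piP Y; rewrite piDE//.
apply: (ler_cvg_to (cnorm_pi (pcauchyD uC vC)) (cvgD (cnorm_pi uC) (cnorm_pi vC))).
by exists 0 => // n _; exact: pc_normD.
Qed.

Lemma cnormcM X Y : cnormc (X * Y) <= cnormc X * cnormc Y.
Proof.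
have [u uC ->] := piP X; have [v vC ->] := piP Y; rewrite piME//.
apply: (ler_cvg_to (cnorm_pi (pcauchyM uC vC)) (cvgM (cnorm_pi uC) (cnorm_pi vC))).
by exists 0 => // n _; exact: pc_normM.
Qed.

Lemma cnormcZ (c : C) X : (cnormc (c *: X))%:C%C = `|c| * (cnormc X)%:C%C.
Proof.
have [u uC ->] := piP X; rewrite piZE// nrcE -rmorphM; congr (_%:C%C).
apply: cnorm_eq; first exact: pcauchyZ.
rewrite (_ : (fun n => _) = (fun n => nrc c * p (u n))).
  by apply: cvgM; [exact: cvg_cst | exact: cnorm_pi].
by apply/funext => n; rewrite pc_normZE.
Qed.

Lemma cnormc_star_mul X : cnormc (cstar X * X) = cnormc X ^+ 2.
Proof.
have [u uC ->] := piP X; rewrite pi_star// piME//; last exact: pcauchy_star.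
apply: cnorm_eq; first by apply: pcauchyM => //; apply: pcauchy_star.
rewrite (_ : (fun n => _) = (fun n => p (u n) * p (u n))).
  by rewrite expr2; apply: cvgM; exact: cnorm_pi.
by apply/funext => n; rewrite pc_norm_star_mul expr2.
Qed.

Let cstarK : involutive cstar.
Proof.
move=> X; have [u uC ->] := piP X; rewrite !pi_star//; last exact: pcauchy_star.
by congr pi; apply/funext => n; rewrite pc_starK.
Qed.

Let cstarD : {morph cstar : x y / x + y}.
Proof.
move=> X Y; have [u uC ->] := piP X; have [v vC ->] := piP Y.
rewrite piDE// !pi_star// ?piDE//; do ?[exact: pcauchy_star | exact: pcauchyD].
by congr pi; apply/funext => n; rewrite pc_starD.
Qed.

Let cstarM X Y : cstar (X * Y) = cstar Y * cstar X.
Proof.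
have [u uC ->] := piP X; have [v vC ->] := piP Y.
rewrite piME// !pi_star// ?piME//; do ?[exact: pcauchy_star | exact: pcauchyM].
by congr pi; apply/funext => n; rewrite pc_starM.
Qed.

Let cstarZ (c : C) X : cstar (c *: X) = Num.conj c *: cstar X.
Proof.
have [u uC ->] := piP X.
rewrite piZE// !pi_star// ?piZE//; do ?[exact: pcauchy_star | exact: pcauchyZ].
by congr pi; apply/funext => n; rewrite pc_starZ.
Qed.

Let cnorm_dense X e : 0 < e -> exists x, cnormc (X - cinj x) <= e.
Proof.
move=> e0; have [u uC ->] := piP X; have [N NP] := uC e e0.
exists (u N); rewrite piBE//; last exact: pcauchy_cst.
apply: cnorm_le; first by apply: pcauchyD => //; exact: pcauchy_cst.
by exists N => n Nn; rewrite ltW// NP.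
Qed.

Let cnormcN X : cnormc (- X) = cnormc X.
Proof.
have := cnormcZ (-1) X; rewrite normrN1 mul1r scaleN1r.
by move=> /complexI.
Qed.

Let inv_small (e : R) : 0 < e -> exists N, forall n, (N <= n)%N -> n.+1%:R^-1 < e.
Proof.
move=> e0; have [N NP] : exists N : nat, e^-1 < N%:R.
  by exists (Num.bound e^-1); apply: archi_boundP; rewrite invr_ge0 ltW.
exists N => n Nn; rewrite invf_plt ?posrE ?ltr0Sn// (lt_le_trans NP)//.
by rewrite ler_nat leqW.
Qed.

(** Each [U n] is replaced by a constant class [cinj (a n)] at distance at most 1/(n+1). The
    sequence a is Cauchy in A, and its class is the limit. *)
Lemma cnormc_complete (U : nat -> compl) :
  (forall e : R, 0 < e -> exists N : nat, forall m n : nat,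
     (N <= m)%N -> (N <= n)%N -> cnormc (U m - U n) < e) ->
  exists l : compl, cnormc (U n - l) @[n --> \oo] --> (0 : R).
Proof.
move=> UC; have ex n : exists x, cnormc (U n - cinj x) <= n.+1%:R^-1.
  by apply: cnorm_dense; rewrite invr_gt0 ltr0Sn.
pose a n := projT1 (cid (ex n)).
have aP n : cnormc (U n - cinj (a n)) <= n.+1%:R^-1 by rewrite /a; case: cid.
have aC : pcauchy a.
  move=> e e0; have e3 : 0 < e / 3 by rewrite divr_gt0.
  have [N NP] := UC _ e3; have [M MP] := inv_small e3.
  exists (maxn N M) => m n; rewrite !geq_max => /andP[Nm Mm] /andP[Nn Mn].
  rewrite -cnorm_cinj.
  have -> : cinj (a m - a n) = - (U m - cinj (a m)) + ((U m - U n) + (U n - cinj (a n))).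
    rewrite [(_ - _) + (_ - _)]addrA subrK opprB addrA subrK piBE//; exact: pcauchy_cst.
  have -> : e = e / 3 + (e / 3 + e / 3) by lra.
  rewrite (le_lt_trans (cnormcD _ _))// ltr_leD//.
    by rewrite cnormcN (le_lt_trans (aP _))// MP.
  rewrite (le_trans (cnormcD _ _))// lerD//; first by rewrite ltW// NP.
  by rewrite (le_trans (aP _))// ltW// MP.
exists (pi a); apply/cvgrPdist_lt => e e0; have e2 : 0 < e / 2 by rewrite divr_gt0.
have [N NP] := aC _ e2; have [M MP] := inv_small e2.
exists (maxn N M) => // n; rewrite /= geq_max => /andP[Nn Mn].
rewrite sub0r normrN ger0_norm ?cnormc_ge0// -[U n](subrK (cinj (a n))) -addrA.
rewrite (le_lt_trans (cnormcD _ _))// (splitr e) ltr_leD//.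
  by rewrite (le_lt_trans (aP _))// MP.
rewrite piBE//; last exact: pcauchy_cst.
apply: cnorm_le; first by apply: pcauchyD; [exact: pcauchy_cst | exact: pcauchyN].
by exists N => m Nm; rewrite ltW// NP.
Qed.

HB.instance Definition _ := isCStarAlgebra.Build R compl
  cstarK cstarD cstarZ cstarM cnormc_eq0 cnormcD cnormcZ cnormcM
  cnormc_star_mul cnormc_complete.

Definition cvgC (z : nat -> C) (l : C) :=
  complex.Re (z n) @[n --> \oo] --> complex.Re l /\
  complex.Im (z n) @[n --> \oo] --> complex.Im l.

Lemma cvgC_unique z l l' : cvgC z l -> cvgC z l' -> l = l'.
Proof.
move=> [r i] [r' i']; case: l l' r i r' i' => [a b] [a' b'] /= r i r' i'.
by congr Complex; [apply: (cvg_unique _ r r') | apply: (cvg_unique _ i i')].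
Qed.

Lemma ReD (a b : C) : complex.Re (a + b) = complex.Re a + complex.Re b.
Proof. by case: a; case: b. Qed.

Lemma ImD (a b : C) : complex.Im (a + b) = complex.Im a + complex.Im b.
Proof. by case: a; case: b. Qed.

Lemma ReM (a b : C) : complex.Re (a * b) =
  complex.Re a * complex.Re b - complex.Im a * complex.Im b.
Proof. by case: a; case: b. Qed.

Lemma ImM (a b : C) : complex.Im (a * b) =
  complex.Re a * complex.Im b + complex.Im a * complex.Re b.
Proof. by case: a; case: b. Qed.

Lemma cvgCD z z' l l' : cvgC z l -> cvgC z' l' -> cvgC (fun n => z n + z' n) (l + l').
Proof.
move=> [r i] [r' i']; rewrite /cvgC ReD ImD; split.
  rewrite (_ : (fun n => _) = (fun n => complex.Re (z n) + complex.Re (z' n))).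
    exact: cvgD.
  by apply/funext => n; rewrite ReD.
rewrite (_ : (fun n => _) = (fun n => complex.Im (z n) + complex.Im (z' n))).
  exact: cvgD.
by apply/funext => n; rewrite ImD.
Qed.

Lemma cvgCZ c z l : cvgC z l -> cvgC (fun n => c * z n) (c * l).
Proof.
move=> [r i]; rewrite /cvgC ReM ImM; split.
  rewrite (_ : (fun n => _) = (fun n =>
     complex.Re c * complex.Re (z n) - complex.Im c * complex.Im (z n))).
    by apply: cvgB; (apply: cvgM => //; exact: cvg_cst).
  by apply/funext => n; rewrite ReM.
rewrite (_ : (fun n => _) = (fun n =>
   complex.Re c * complex.Im (z n) + complex.Im c * complex.Re (z n))).
  by apply: cvgD; (apply: cvgM => //; exact: cvg_cst).
by apply/funext => n; rewrite ImM.
Qed.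

Lemma cvgC_cst l : cvgC (fun=> l) l.
Proof. by split; exact: cvg_cst. Qed.

Lemma Re_nrc (z : C) : `|complex.Re z| <= nrc z.
Proof. by rewrite -lecR -nrcE; exact: normc_ge_Re. Qed.

Lemma Im_nrc (z : C) : `|complex.Im z| <= nrc z.
Proof.
have -> : complex.Im z = - complex.Re ('i%C * z) by rewrite ReM; case: z => a b /=; ring.
rewrite normrN (le_trans (Re_nrc _))// -lecR -!nrcE normrM.
by rewrite -[leRHS]mul1r ler_wpM2r// normc_def /= expr0n expr1n add0r sqrtr1.
Qed.

Lemma nrc_state x : nrc (phi x) <= p x.
Proof. by rewrite -lecR -nrcE pc_state_le. Qed.

Definition cstate (X : compl) : C :=
  Complex (lim (complex.Re (phi (rep X n)) @[n --> \oo]))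
          (lim (complex.Im (phi (rep X n)) @[n --> \oo])).

Lemma cstate_pi u : pcauchy u -> cvgC (fun n => phi (u n)) (cstate (pi u)).
Proof.
move=> uC.
have reB a b : complex.Re a - complex.Re b = complex.Re (a - b).
  by case: a; case: b.
have imB a b : complex.Im a - complex.Im b = complex.Im (a - b).
  by case: a; case: b.
have reP x y : `|complex.Re (phi x) - complex.Re (phi y)| <= p (x - y).
  rewrite reB -[phi x - phi y]raddfB.
  exact: le_trans (Re_nrc _) (nrc_state _).
have imP x y : `|complex.Im (phi x) - complex.Im (phi y)| <= p (x - y).
  rewrite imB -[phi x - phi y]raddfB.
  exact: le_trans (Im_nrc _) (nrc_state _).
split.
  apply: (cvg_dist (fun n => reP (rep (pi u) n) (u n)) (rep_pi uC)).
  have : exists l : R, complex.Re (phi (rep (pi u) n)) @[n --> \oo] --> l.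
    apply: real_cauchy_cvg => e e0; have [N NP] := rep_cauchy (pi u) e0.
    by exists N => m n Nm Nn; rewrite (le_lt_trans (reP _ _))// NP.
  by move=> [l /cvgP].
apply: (cvg_dist (fun n => imP (rep (pi u) n) (u n)) (rep_pi uC)).
have : exists l : R, complex.Im (phi (rep (pi u) n)) @[n --> \oo] --> l.
  apply: real_cauchy_cvg => e e0; have [N NP] := rep_cauchy (pi u) e0.
  by exists N => m n Nm Nn; rewrite (le_lt_trans (imP _ _))// NP.
by move=> [l /cvgP].
Qed.

Lemma cstate_eq u l : pcauchy u -> cvgC (fun n => phi (u n)) l -> cstate (pi u) = l.
Proof. by move=> uC; apply: cvgC_unique; exact: cstate_pi. Qed.

Lemma cstate_cinj x : cstate (cinj x) = phi x.
Proof. by apply: cstate_eq; [exact: pcauchy_cst | exact: cvgC_cst]. Qed.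

Let cstate_linear : scalar cstate.
Proof.
move=> c X Y; have [u uC ->] := piP X; have [v vC ->] := piP Y.
rewrite piZE// piDE//; last exact: pcauchyZ.
apply: cstate_eq; first by apply: pcauchyD => //; exact: pcauchyZ.
have := cvgCD (cvgCZ c (cstate_pi uC)) (cstate_pi vC).
by congr cvgC; apply/funext => n; rewrite linearP.
Qed.

HB.instance Definition _ :=
  GRing.isLinear.Build C compl C *%R cstate cstate_linear.

Lemma cstate_ge0 (X : compl) : 0 <= cstate (star X * X).
Proof.
have [u uC ->] := piP X.
rewrite [star _ * _](_ : _ = pi (fun n => st (u n) * u n)); last first.
  by rewrite -[star _]/(cstar _) pi_star// piME//; exact: pcauchy_star.
have uuC : pcauchy (fun n => st (u n) * u n).
  by apply: pcauchyM => //; exact: pcauchy_star.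
have [re im] := cstate_pi uuC.
have nn n : complex.Im (phi (st (u n) * u n)) = 0 /\ 0 <= complex.Re (phi (st (u n) * u n)).
  by have := pc_state_ge0 (u n); rewrite lecE => /andP[/eqP ->].
rewrite lecE; apply/andP; split => /=.
  apply/eqP; apply: cvg_unique im _ => //=.
  by rewrite (_ : (fun n => _) = fun=> 0); [exact: cvg_cst | apply/funext => n; case: (nn n)].
apply: (ler_cvg_to (cvg_cst 0) re).
by exists 0 => // n _; case: (nn n).
Qed.

Definition completion : cstarProbSpace R :=
  @CStarProbSpace R compl cstate cstate_ge0
    (etrans (cstate_cinj 1) (pc_state1 A)).

Lemma cinj_star x : cinj (st x) = star (cinj x).
Proof. by rewrite -[RHS]/(cstar _) pi_star//; exact: pcauchy_cst. Qed.

Lemma cinjM x y : cinj (x * y) = cinj x * cinj y.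
Proof. by rewrite piME//; exact: pcauchy_cst. Qed.

End Completion.

(** * The GNS construction *)

(* Iterated Cauchy-Schwarz: [r k] stands for [`|phi (g^* (x^* x)^(2^k) g)|]. *)
Lemma power_trick (R : realType) (a b M : R) (r : nat -> R) :
  0 <= a -> 0 < b -> (forall k, 0 <= r k) ->
  (forall k, r k ^+ 2 <= a * r k.+1) -> (forall k, r k <= M * b ^+ (2 ^ k)) ->
  r 0%N <= b * a.
Proof.
move=> a0 b0 r0 rS rM; rewrite leNgt; apply/negP => bar.
have rp : 0 < r 0%N by rewrite (le_lt_trans _ bar)// mulr_ge0// ltW.
have ap : 0 < a.
  rewrite lt0r a0 andbT; apply: contraL rp => /eqP a00.
  by have := rS 0%N; rewrite a00 mul0r exprn_even_le0//= => /eqP->; rewrite ltxx.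
(* If r 0 > b a then q > b, and a q^(2^k) <= r k contradicts growth at rate b: the powers of t = q /
   b would be bounded, against Bernoulli's inequality. *)
pose q := r 0%N / a; have q0 : 0 < q by rewrite divr_gt0.
have bq : b < q by rewrite ltr_pdivlMr.
have rq k : a * q ^+ (2 ^ k) <= r k.
  elim: k => [|k IHk]; first by rewrite expn0 expr1 mulrC divfK ?gt_eqF.
  rewrite -(ler_pM2l ap) (le_trans _ (rS k))// expnSr exprM mulrA -expr2 -exprMn.
  by rewrite ler_pXn2r ?nnegrE ?mulr_ge0 ?exprn_ge0// ltW.
pose t := q / b; have t1 : 0 < t - 1 by rewrite subr_gt0 ltr_pdivlMr// mul1r.
have bern n : 1 + n%:R * (t - 1) <= t ^+ n.
  elim: n => [|n IHn]; first by rewrite mul0r addr0 expr0.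
  have tt : 0 <= t by rewrite divr_ge0// ltW.
  rewrite exprSr (le_trans _ (ler_wpM2r tt IHn))//.
  have -> : (1 + n%:R * (t - 1)) * t = 1 + n.+1%:R * (t - 1) + n%:R * (t - 1) ^+ 2.
    by rewrite -natr1; ring.
  by rewrite lerDl mulr_ge0 ?exprn_ge0 ?ler0n// ltW.
have tM k : t ^+ (2 ^ k) <= M / a.
  rewrite ler_pdivlMr// mulrC /t expr_div_n mulrA ler_pdivrMr ?exprn_gt0//.
  exact: le_trans (rq k) (rM k).
pose n := Num.bound (M / a / (t - 1)).
have M0 : 0 <= M / a by apply: le_trans (tM 0%N); rewrite exprn_ge0// divr_ge0// ltW.
have : M / a / (t - 1) < n%:R by apply: archi_boundP; rewrite divr_ge0// ltW.
rewrite ltr_pdivrMr//; apply/negP; rewrite -leNgt.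
rewrite (le_trans _ (tM n))// (le_trans _ (bern _))//.
rewrite (@le_trans _ _ ((2 ^ n)%:R * (t - 1)))// ?lerDr//.
by rewrite ler_pM2r// ler_nat ltnW// ltn_expl.
Qed.

(* GNS: a state with bounded left multiplications makes the operator norm on
   the pre-Hilbert space of the algebra a C*-seminorm. *)
Section OperatorSeminorm.
Variables (R : realType) (A : algType R[i]%C) (st : A -> A) (phi : {scalar A}).
Notation C := R[i]%C.
Hypothesis starK : involutive st.
Hypothesis starD : {morph st : x y / x + y}.
Hypothesis starZ : forall (c : C) x, st (c *: x) = Num.conj c *: st x.
Hypothesis starM : forall x y, st (x * y) = st y * st x.
Hypothesis phi1 : phi 1 = 1.
Hypothesis phi_ge0 : forall x, 0 <= phi (st x * x).
Implicit Types (x y a b : A) (k : R).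

Let ip x y : C := phi (st x * y).

Definition l2norm x : R := Num.sqrt (complex.Re (phi (st x * x))).

Hypothesis phi_bnd : forall a, exists2 k, 0 <= k &
  forall x, l2norm (a * x) <= k * l2norm x.

Let ipDr x y z : ip x (y + z) = ip x y + ip x z.
Proof. by rewrite /ip mulrDr raddfD. Qed.

Let ipDl x y z : ip (x + y) z = ip x z + ip y z.
Proof. by rewrite /ip starD mulrDl raddfD. Qed.

Let ipZr c x y : ip x (c *: y) = c * ip x y.
Proof. by rewrite /ip -scalerAr linearZ. Qed.

Let ipZl c x y : ip (c *: x) y = Num.conj c * ip x y.
Proof. by rewrite /ip starZ -scalerAl linearZ. Qed.

Lemma state_psd : psd (fun x y => phi (st x * y)).
Proof.
move=> L; rewrite -/ip (_ : kform _ L = phi (st (\sum_(p <- L) p.1 *: p.2) *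
  (\sum_(p <- L) p.1 *: p.2))); first exact: phi_ge0.
have st_sum : st (\sum_(p <- L) p.1 *: p.2) = \sum_(p <- L) Num.conj p.1 *: st p.2.
  elim: (L) => [|p M IH]; last by rewrite !big_cons starD starZ IH.
  by rewrite !big_nil; have := starZ 0 (0 : A); rewrite conjC0 !scale0r.
rewrite st_sum mulr_suml raddf_sum; apply: eq_bigr => p _.
rewrite mulr_sumr raddf_sum; apply: eq_bigr => q _.
by rewrite -mulrA -ipZr -ipZl /ip starZ.
Qed.

Let ip_psd : psd ip. Proof. exact: state_psd. Qed.

Let ipxx x : ip x x = (l2norm x ^+ 2)%:C%C.
Proof.
have := phi_ge0 x; rewrite /l2norm /ip lecE => /andP[/eqP /= im re].
rewrite sqr_sqrtr//; move: im; case: (phi _) => a b /= -> //.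
Qed.

(** Cauchy-Schwarz is non-negativity of the Schur complement on the diagonal. *)
Lemma state_CS x y : `|phi (st x * y)| <= (l2norm x * l2norm y)%:C%C.
Proof.
rewrite -/(ip x y).
rewrite -(@ler_pXn2r _ 2)// ?nnegrE ?normr_ge0//; last first.
  by rewrite lecR mulr_ge0 ?sqrtr_ge0.
have -> : (l2norm x * l2norm y)%:C%C ^+ 2 = ip x x * ip y y.
  by rewrite !ipxx -rmorphXn -rmorphM exprMn.
have [x0|x0] := eqVneq (ip x x) 0.
  by rewrite (psd_null y ip_psd x0) x0 normr0 expr0n mul0r.
have := psd_ge0 y (psd_schur x ip_psd); rewrite (psd_herm x y ip_psd).
rewrite subr_ge0 ler_pdivrMr; last by rewrite lt0r x0 psd_ge0.
by rewrite -normCKC [leRHS]mulrC.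
Qed.

Let l2_ge0 x : 0 <= l2norm x. Proof. exact: sqrtr_ge0. Qed.

Let l2E x k : ip x x = (k ^+ 2)%:C%C -> 0 <= k -> l2norm x = k.
Proof.
move=> xk k0; apply/eqP; rewrite -(@eqrXn2 _ 2)//.
by apply/eqP/complexI; rewrite -ipxx.
Qed.

Lemma l2normZ c x : l2norm (c *: x) = nrc c * l2norm x.
Proof.
apply: l2E; last by rewrite mulr_ge0 ?nrc_ge0.
by rewrite ipZl ipZr ipxx mulrA -normCKC nrcE exprMn [RHS]rmorphM !rmorphXn.
Qed.

Lemma l2normD x y : l2norm (x + y) <= l2norm x + l2norm y.
Proof.
rewrite -(@ler_pXn2r _ 2)// ?nnegrE ?addr_ge0// -lecR -ipxx ipDl !ipDr !ipxx.
rewrite sqrrD rmorphD rmorphD /= -!addrA lerD2l !addrA lerD2r.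
have re : ip x y + ip y x \is Num.real.
  by rewrite (psd_herm x y ip_psd) CrealE rmorphD /= conjCK addrC.
rewrite (le_trans (real_ler_norm re))// (le_trans (ler_normD _ _))//.
by rewrite mulr2n rmorphD /= lerD// ?state_CS// mulrC state_CS.
Qed.

Let bounds a : set R := [set k | 0 <= k /\ forall x, l2norm (a * x) <= k * l2norm x]%classic.

Definition opnorm a : R := inf (bounds a).

Let bounds_ne a : (bounds a !=set0)%classic.
Proof. by have [k k0 kP] := phi_bnd a; exists k. Qed.

Lemma opnorm_ge0 a : 0 <= opnorm a.
Proof. by apply: lb_le_inf; [exact: bounds_ne | move=> k []]. Qed.

Lemma opnorm_le a k : 0 <= k -> (forall x, l2norm (a * x) <= k * l2norm x) ->
  opnorm a <= k.
Proof. by move=> k0 kP; apply: ge_inf => //; exists 0 => y []. Qed.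

Lemma opnorm_bound a x : l2norm (a * x) <= opnorm a * l2norm x.
Proof.
have [x0|x0] := eqVneq (l2norm x) 0.
  have [k k0 kP] := phi_bnd a.
  by have := kP x; rewrite x0 !mulr0.
have xp : 0 < l2norm x by rewrite lt0r x0 l2_ge0.
rewrite -ler_pdivrMr//; apply: lb_le_inf; first exact: bounds_ne.
by move=> k [k0 kP]; rewrite ler_pdivrMr.
Qed.

Lemma opnormD a b : opnorm (a + b) <= opnorm a + opnorm b.
Proof.
apply: opnorm_le; first by rewrite addr_ge0 ?opnorm_ge0.
by move=> x; rewrite !mulrDl (le_trans (l2normD _ _))// lerD ?opnorm_bound.
Qed.

Lemma opnormM a b : opnorm (a * b) <= opnorm a * opnorm b.
Proof.
apply: opnorm_le; first by rewrite mulr_ge0 ?opnorm_ge0.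
move=> x; rewrite -mulrA (le_trans (opnorm_bound _ _))// -mulrA.
by rewrite ler_wpM2l ?opnorm_ge0 ?opnorm_bound.
Qed.

Lemma opnormZ (c : C) a : opnorm (c *: a) = nrc c * opnorm a.
Proof.
have le d b : opnorm (d *: b) <= nrc d * opnorm b.
  apply: opnorm_le; first by rewrite mulr_ge0 ?nrc_ge0 ?opnorm_ge0.
  by move=> x; rewrite -scalerAl l2normZ -mulrA ler_wpM2l ?nrc_ge0 ?opnorm_bound.
apply/eqP; rewrite eq_le le /=.
have [->|c0] := eqVneq c 0.
  by rewrite /nrc normr0 mul0r opnorm_ge0.
have := le c^-1 (c *: a); rewrite scalerA mulVf// scale1r => H.
have n0 : 0 < nrc c by rewrite -ltcR -nrcE normr_gt0.
have nV : nrc c^-1 = (nrc c)^-1.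
  by apply: complexI; rewrite -nrcE normfV nrcE fmorphV.
by move: H; rewrite nV ler_pdivlMl.
Qed.

(** The square of the norm of b x is the inner product of x with b^* b x, so the norm of b^* b
    bounds that of b squared. Submultiplicativity then shows that the star does not decrease the
    norm, hence preserves it, which gives the reverse bound. *)
Lemma opnorm_star_mul a : opnorm (st a * a) = opnorm a ^+ 2.
Proof.
have le1 b : opnorm b ^+ 2 <= opnorm (st b * b).
  have s0 := opnorm_ge0 (st b * b).
  rewrite -[leRHS]sqr_sqrtr// ler_pXn2r ?nnegrE ?sqrtr_ge0 ?opnorm_ge0//.
  apply: opnorm_le; first exact: sqrtr_ge0.
  move=> x; rewrite -(@ler_pXn2r _ 2)// ?nnegrE ?mulr_ge0 ?sqrtr_ge0//.
  rewrite exprMn (sqr_sqrtr s0) -lecR -ipxx.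
  have -> : ip (b * x) (b * x) = ip x (st b * b * x) by rewrite /ip starM !mulrA.
  have n0 : 0 <= ip x (st b * b * x) by rewrite /ip -mulrA mulrA -starM.
  rewrite -(ger0_norm n0) (le_trans (state_CS _ _))// lecR expr2 mulrCA.
  by rewrite ler_wpM2l ?opnorm_bound.
have le2 b : opnorm b <= opnorm (st b).
  have [->|b0] := eqVneq (opnorm b) 0; first exact: opnorm_ge0.
  rewrite -(@ler_pM2r _ (opnorm b)) ?lt0r ?b0 ?opnorm_ge0// -expr2.
  by rewrite (le_trans (le1 b))// opnormM.
apply/eqP; rewrite eq_le le1 andbT (le_trans (opnormM _ _))// expr2.
by rewrite ler_wpM2r ?opnorm_ge0// (le_trans (le2 _))// starK.
Qed.

Lemma state_opnorm a : `|phi a| <= (opnorm a)%:C%C.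
Proof.
have st1 : st 1 = 1.
  by rewrite -[LHS]mulr1 -[X in _ * X](starK 1) -starM mulr1 starK.
have l1 : l2norm 1 = 1.
  by apply: l2E => //; rewrite /ip st1 mulr1 phi1 expr1n.
have := state_CS 1 a; rewrite st1 mul1r l1 mul1r => /le_trans -> //.
by rewrite lecR; have := opnorm_bound a 1; rewrite mulr1 l1 mulr1.
Qed.

Definition gns_preCstar : preCstar R.
Proof.
refine (@PreCstar R A st opnorm phi starK starD starZ starM opnormD _ opnormM
  opnorm_star_mul state_opnorm phi_ge0 phi1).
by move=> c x; rewrite opnormZ nrcE [LHS]rmorphM.
Defined.

End OperatorSeminorm.

(* [A] is the algebra of non-commutative polynomials, with monomials [mon w]. *)
Section WordAlgebra.
Variables (R : realType) (X : Type) (tau : X -> X).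
Notation C := R[i]%C.
Variables (A : algType C) (mon : seq X -> A) (st : A -> A) (phi : {scalar A}).
Implicit Types (g h : A) (w : seq X).
Hypothesis tauK : involutive tau.
Hypothesis monM : forall v w, mon v * mon w = mon (v ++ w).
Hypothesis mon0 : mon [::] = 1.
Hypothesis mon_span : forall g, exists L : seq (C * seq X),
  g = \sum_(p <- L) p.1 *: mon p.2.
Hypothesis starD : {morph st : x y / x + y}.
Hypothesis star_mon : forall (c : C) w,
  st (c *: mon w) = Num.conj c *: mon (rev (map tau w)).

Let mon_ind (S : A -> Prop) : S 0 ->
  (forall g h, S g -> S h -> S (g + h)) ->
  (forall c w, S (c *: mon w)) -> forall g, S g.
Proof.
move=> S0 SD SZ g; have [L ->] := mon_span g.
elim: L => [|p L IH]; first by rewrite big_nil.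
by rewrite big_cons; apply: SD.
Qed.

Let star0 : st 0 = 0.
Proof. by have := star_mon 0 [::]; rewrite conjC0 !scale0r. Qed.

Let starK : involutive st.
Proof.
elim/mon_ind => [|g h gK hK|c w]; first by rewrite !star0.
  by rewrite !starD gK hK.
rewrite !star_mon conjCK map_rev revK -map_comp.
by rewrite (eq_map (g := id)) ?map_id// => x /=; rewrite tauK.
Qed.

Let starZ (c : C) g : st (c *: g) = Num.conj c *: st g.
Proof.
elim/mon_ind: g => [|g h gK hK|d w]; first by rewrite !(scaler0, star0).
  by rewrite scalerDr !starD gK hK scalerDr.
by rewrite scalerA !star_mon rmorphM scalerA.
Qed.

Let starM g h : st (g * h) = st h * st g.
Proof.
elim/mon_ind: g h => [|g g' gK gK'|c w] h.
- by rewrite mul0r star0 mulr0.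
- by rewrite mulrDl !starD gK gK' mulrDr.
elim/mon_ind: h => [|h h' hK hK'|d v].
- by rewrite mulr0 star0 mul0r.
- by rewrite mulrDr !starD hK hK' mulrDl.
rewrite -scalerAl -scalerAr scalerA monM !star_mon -scalerAl -scalerAr scalerA monM.
by rewrite rmorphM mulrC map_cat rev_cat.
Qed.

Hypothesis phi1 : phi 1 = 1.
Hypothesis phiP : psd (fun u v => phi (mon (catrev (map tau u) v))).

Let state_span (L : seq (C * seq X)) w :
  let g := \sum_(p <- L) p.1 *: mon p.2 in
  phi (st g * (mon w * g)) =
  \sum_(p <- L) \sum_(q <- L)
     Num.conj p.1 * q.1 * phi (mon (rev (map tau p.2) ++ w ++ q.2)).
Proof.
move=> g; have -> : st g = \sum_(p <- L) st (p.1 *: mon p.2).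
  by rewrite /g; elim: (L) => [|p M IH]; rewrite ?big_nil ?star0// !big_cons starD IH.
rewrite mulr_suml raddf_sum; apply: eq_bigr => p _.
rewrite star_mon -scalerAl /g !mulr_sumr scaler_sumr raddf_sum.
apply: eq_bigr => q _; rewrite -!scalerAr !monM.
by rewrite /= !scalarZ mulrA.
Qed.

Let phi_ge0 g : 0 <= phi (st g * g).
Proof.
have [L ->] := mon_span g; set h := \sum_(p <- L) _.
rewrite -[X in _ * X]mul1r -mon0 state_span.
have := phiP L; rewrite /kform => H.
rewrite (eq_bigr (fun p => \sum_(q <- L) p.1^* * q.1 *
   phi (mon (catrev [seq tau i | i <- p.2] q.2))))// => p _.
by apply: eq_bigr => q _; rewrite catrevE.
Qed.

Variable B : R.
Hypothesis B_gt0 : 0 < B.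
Hypothesis phi_bnd : forall w, `|phi (mon w)| <= (B ^+ size w)%:C%C.

Let l2 := l2norm st phi.

Let l2_sq g : (l2 g ^+ 2)%:C%C = phi (st g * g).
Proof.
have := phi_ge0 g; rewrite /l2 /l2norm lecE => /andP[/eqP /= im re].
by rewrite sqr_sqrtr//; move: im; case: (phi _) => a b /= ->.
Qed.

(** [power_trick] with the word W m as (x^* x)^m: expanding g in monomials bounds the expectations
    by M B^(2 m) for m = 2^k, with M depending on g only. The rate B^2 for x^* x gives B for x. *)
Let l2_letter x g : l2 (mon [:: x] * g) <= B * l2 g.
Proof.
pose W m := flatten (nseq m [:: tau x; x]).
have WD m n : W m ++ W n = W (m + n)%N by rewrite /W -flatten_cat -nseqD.
have Wrev m : rev (map tau (W m)) = W m.
  elim: m => // m IH; rewrite -addn1 -{1}(addnC 1%N) -!WD map_cat rev_cat IH.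
  by rewrite /W /= /rev /= tauK.
have sizeW m : size (W m) = (2 * m)%N.
  by elim: m => // m; rewrite /W /= => ->; rewrite mulnS.
have stW m : st (mon (W m)) = mon (W m).
  by have := star_mon 1 (W m); rewrite conjC1 !scale1r Wrev.
have sqW m : phi (st g * (mon (W (2 * m)%N) * g)) = (l2 (mon (W m) * g) ^+ 2)%:C%C.
  by rewrite l2_sq starM stW -mulrA [mon _ * (mon _ * _)]mulrA monM WD mul2n addnn.
pose r k := nrc (phi (st g * (mon (W (2 ^ k)%N) * g))).
have xW : (l2 (mon [:: x] * g) ^+ 2)%:C%C = `|phi (st g * (mon (W (2 ^ 0)%N) * g))|.
  rewrite l2_sq starM; have := star_mon 1 [:: x]; rewrite conjC1 !scale1r => ->.
  rewrite -mulrA [mon _ * (mon _ * _)]mulrA monM ger0_norm//.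
  have := phi_ge0 (mon [:: x] * g); rewrite starM.
  have := star_mon 1 [:: x]; rewrite conjC1 !scale1r => ->.
  by rewrite -mulrA [mon _ * (mon _ * _)]mulrA monM.
suff : r 0%N <= B ^+ 2 * l2 g ^+ 2.
  rewrite -lecR /r -nrcE -xW lecR -exprMn ler_pXn2r// nnegrE ?sqrtr_ge0//.
  by rewrite mulr_ge0 ?sqrtr_ge0// ltW.
have [L gL] := mon_span g.
pose M : R := \sum_(p <- L) \sum_(q <- L) nrc p.1 * nrc q.1 * B ^+ (size p.2 + size q.2).
apply: (@power_trick R (l2 g ^+ 2) (B ^+ 2) M r).
- by rewrite exprn_ge0// sqrtr_ge0.
- by rewrite exprn_gt0.
- by move=> k; exact: nrc_ge0.
- move=> k; rewrite -lecR rmorphXn rmorphM /= /r -!nrcE.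
  rewrite expnS sqW [X in _ <= _ * X]ger0_norm ?ler0c ?exprn_ge0 ?sqrtr_ge0//.
  rewrite -rmorphM -exprMn [leRHS]rmorphXn /=; apply: lerXn2r.
  - by rewrite nnegrE.
  - by rewrite nnegrE ler0c mulr_ge0 ?sqrtr_ge0.
  - exact: state_CS.
- move=> k; rewrite -lecR /r -nrcE gL state_span.
  rewrite (le_trans (ler_norm_sum _ _ _))// /M mulr_suml rmorph_sum.
  apply: ler_sum => p _; rewrite (le_trans (ler_norm_sum _ _ _))//.
  rewrite mulr_suml rmorph_sum; apply: ler_sum => q _.
  rewrite !normrM norm_conjC /=.
  have -> : (nrc p.1 * nrc q.1 * B ^+ (size p.2 + size q.2) * B ^+ 2 ^+ (2 ^ k))%:C%C =
    `|p.1| * `|q.1| * (B ^+ size (rev (map tau p.2) ++ W (2 ^ k)%N ++ q.2))%:C%C.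
    rewrite !nrcE -!rmorphM !size_cat size_rev size_map sizeW; congr (_%:C%C).
    by rewrite -exprM -!mulrA -exprD -addnA [(size q.2 + _)%N]addnC.
  by rewrite ler_wpM2l ?mulr_ge0.
Qed.

Let l2_triangle x y : l2 (x + y) <= l2 x + l2 y.
Proof. exact: l2normD. Qed.

Let phi_lmul a : exists2 k, 0 <= k & forall g, l2 (a * g) <= k * l2 g.
Proof.
have B0 := ltW B_gt0.
have lmul_mon w g : l2 (mon w * g) <= B ^+ size w * l2 g.
  elim: w => [|x w IHw]; first by rewrite mon0 mul1r expr0 mul1r.
  have -> : mon (x :: w) = mon [:: x] * mon w by rewrite monM.
  rewrite -mulrA (le_trans (l2_letter _ _))//= exprS -mulrA.
  by rewrite ler_wpM2l.
elim/mon_ind: a => [|a b [k k0 ka] [l l0 lb]|c w].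
- by exists 0 => // g; rewrite !mul0r /l2 /l2norm mulr0 raddf0 sqrtr0.
- exists (k + l); first exact: addr_ge0.
  by move=> g; rewrite !mulrDl (le_trans (l2_triangle _ _))// lerD.
- exists (nrc c * B ^+ size w); first by rewrite mulr_ge0 ?nrc_ge0 ?exprn_ge0.
  move=> g; rewrite -scalerAl /l2 l2normZ//.
  by rewrite -mulrA ler_wpM2l ?nrc_ge0 ?lmul_mon.
Qed.

Definition word_preCstar : preCstar R :=
  gns_preCstar starK starD starZ starM phi1 phi_ge0 phi_lmul.

Lemma word_gns : exists (P : cstarProbSpace R) (iota : X -> P),
  (forall x, star (iota x) = iota (tau x)) /\
  forall w, state P (\prod_(x <- w) iota x) = phi (mon w).
Proof.
pose Q := word_preCstar.
exists (completion Q), (fun x => cinj (A := Q) (mon [:: x])); split.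
  move=> x; rewrite -cinj_star; congr cinj.
  by have := star_mon 1 [:: x]; rewrite conjC1 !scale1r.
move=> w; suff -> : \prod_(x <- w) cinj (A := Q) (mon [:: x]) = cinj (A := Q) (mon w).
  exact: (cstate_cinj (A := Q)).
elim: w => [|x w IHw]; first by rewrite big_nil mon0.
by rewrite big_cons IHw -cinjM; congr cinj; exact: monM.
Qed.

End WordAlgebra.

Lemma malg_scaler (K : monomType) (S : comNzRingType) (c : S) (g h : {malg S[K]}) :
  c *: (g * h) = g * (c *: h).
Proof.
apply/malgP => k; rewrite mcoeffZ.
rewrite (mcoeffMlw _ (fsubset_refl _) (msuppZ_le c h)) mcoeffMl mulr_sumr.
apply: eq_bigr => i _; rewrite mulr_sumr; apply: eq_bigr => j _.
by rewrite mcoeffZ mulrCA mulrnAr.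
Qed.

(** * The free star-algebra *)

Section FreeStarAlgebra.
Variables (R : realType) (X : choiceType) (tau : X -> X).
Notation C := R[i]%C.
Notation M := {malg C[{fmonom X}]}.
Notation mon w := (mkmalgU (FMonom w) 1 : M).
Implicit Types (g : M) (w : seq X).
Hypothesis tauK : involutive tau.

Lemma malgU_scale (c : C) (k : {fmonom X}) : << c *g k >> = c *: mon (fmonom_val k).
Proof. by apply/malgP => j; rewrite mcoeffZ !mcoeffU fmK mulr_natr. Qed.

Lemma malg_span g : exists L : seq (C * seq X), g = \sum_(p <- L) p.1 *: mon p.2.
Proof.
exists [seq (g@_k, fmonom_val k) | k <- enum_fset (msupp g)].
by rewrite big_map [LHS]monalgE; apply: eq_bigr => k _; rewrite malgU_scale.
Qed.

Lemma monM v w : mon v * mon w = mon (v ++ w).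
Proof.
rewrite malgM_def fgmulUU mulr1; congr (mkmalgU _ 1).
by rewrite /mmul /= fmmulE.
Qed.

Lemma mon0 : mon [::] = 1.
Proof. by rewrite -fmoneE. Qed.

(** The star extends the reversal of words conjugate-linearly, so coefficients go through this
    merely additive map into the constants. *)
Definition conj_cst (c : C) : M := @malgC {fmonom X} C (Num.conj c).

Let conj_cst_additive : additive conj_cst.
Proof. by move=> a b; rewrite /conj_cst !raddfB. Qed.

HB.instance Definition _ := GRing.isAdditive.Build C M conj_cst conj_cst_additive.

Lemma free_star_ex : exists st : M -> M, {morph st : x y / x + y} /\
  forall (c : C) w, st (c *: mon w) = Num.conj c *: mon (rev (map tau w)).
Proof.
exists (mmap conj_cst (fun k => mon (rev (map tau (fmonom_val k))))); split.
  by move=> x y; exact: raddfD.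
by move=> c w; rewrite -(malgU_scale c (FMonom w)) mmapU mul_malgC.
Qed.

Definition free_star : M -> M := projT1 (cid free_star_ex).

Lemma free_starD : {morph free_star : x y / x + y}.
Proof. exact: (projT2 (cid free_star_ex)).1. Qed.

Lemma free_star_mon (c : C) w :
  free_star (c *: mon w) = Num.conj c *: mon (rev (map tau w)).
Proof. exact: (projT2 (cid free_star_ex)).2. Qed.

Lemma free_state_ex (F : seq X -> C) : exists phi : {scalar M}, forall w, phi (mon w) = F w.
Proof.
pose phi : M -> C := mmap idfun (fun k => F (fmonom_val k)).
have phiZ c g : phi (c *: g) = c * phi g.
  rewrite /phi (mmapEw (msuppZ_le c g)) mmapE mulr_sumr.
  by apply: eq_bigr => k _; rewrite mcoeffZ mulrA.
have lin : scalar phi.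
  by move=> c g h; rewrite -phiZ; exact: raddfD.
pose phiL := GRing.isLinear.Build C M C *%R phi lin.
pose phi' : {scalar M} := HB.pack phi phiL.
by exists phi' => w; rewrite /= /phi mmapU mul1r.
Qed.

End FreeStarAlgebra.

Definition free_alg (R : realType) (X : choiceType) : Type := {malg R[i]%C[{fmonom X}]}.

HB.instance Definition _ R X := GRing.Lalgebra.on (free_alg R X).

HB.instance Definition _ (R : realType) (X : choiceType) :=
  GRing.Lalgebra_isAlgebra.Build R[i]%C (free_alg R X)
    (@malg_scaler {fmonom X} R[i]%C).

Theorem gns (R : realType) (X : choiceType) (tau : X -> X) (Phi : seq X -> R[i]%C) (B : R) :
  involutive tau -> Phi [::] = 1 -> psd (fun u v => Phi (catrev (map tau u) v)) ->
  0 < B -> (forall w, `|Phi w| <= (B ^+ size w)%:C%C) ->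
  exists (P : cstarProbSpace R) (iota : X -> P),
  (forall x, star (iota x) = iota (tau x)) /\
  forall w, state P (\prod_(x <- w) iota x) = Phi w.
Proof.
move=> tauK Phi1 PhiP B0 PhiB; have [phi phiE] := free_state_ex Phi.
pose mon w : free_alg R X := mkmalgU (FMonom w) 1.
have [] := @word_gns R X tau (free_alg R X) mon (@free_star R X tau) phi tauK
  (@monM R X) (@mon0 R X) (@malg_span R X) (@free_starD R X tau)
  (@free_star_mon R X tau) _ _ B B0 _.
- by have := phiE [::]; rewrite mon0 Phi1.
- by apply: psd_ext PhiP => u v; rewrite phiE.
- by move=> w; rewrite phiE.
by move=> P [iota [iS iM]]; exists P, iota; split=> // w; rewrite iM phiE.
Qed.

(** * Star-distributions *)

Section CStarState.
Variables (R : realType) (A : cstarAlgType R).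
Notation C := R[i]%C.
Implicit Types (x y a b : A).

Lemma cnormZE (c : C) x : cnorm (c *: x) = nrc c * cnorm x.
Proof. by apply: complexI; rewrite cnormZ nrcE [RHS]rmorphM. Qed.

Lemma cnorm0 : cnorm (0 : A) = 0.
Proof. by have := cnormZE 0 (0 : A); rewrite scale0r /nrc normr0 mul0r. Qed.

Lemma cnormN x : cnorm (- x) = cnorm x.
Proof. by rewrite -scaleN1r cnormZE /nrc normrN1 mul1r. Qed.

Lemma cnorm_ge0 x : 0 <= cnorm x.
Proof.
have := cnormD_le x (- x); rewrite subrr cnorm0 cnormN -mulr2n.
by rewrite pmulrn_lge0.
Qed.

Lemma star0 : star (0 : A) = 0.
Proof. by have := starZ 0 (0 : A); rewrite conjC0 !scale0r. Qed.

Lemma starN x : star (- x) = - star x.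
Proof. by rewrite -[- x]scaleN1r starZ rmorphN1 scaleN1r. Qed.

Lemma star1 : star (1 : A) = 1.
Proof. by rewrite -[LHS]mulr1 -[X in _ * X](starK 1) -starM mulr1 starK. Qed.

Lemma cnorm_star x : cnorm (star x) = cnorm x.
Proof.
have le y : cnorm y <= cnorm (star y).
  have [->|p0] := eqVneq (cnorm y) 0; first exact: cnorm_ge0.
  rewrite -(@ler_pM2r _ (cnorm y)) ?lt0r ?p0 ?cnorm_ge0// -expr2.
  by rewrite -cnorm_star_mul cnormM_le.
by apply/eqP; rewrite eq_le le -{2}(starK x) le.
Qed.

Lemma cnorm1 : cnorm (1 : A) = 1.
Proof.
have := cnorm_star_mul (1 : A); rewrite star1 mulr1 => /eqP.
rewrite eq_sym expr2 -subr_eq0 -[X in _ - X]mulr1 -mulrBr mulf_eq0 subr_eq0.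
case/orP => /eqP // n0; have /eqP := cnorm_eq0 _ n0.
by rewrite oner_eq0.
Qed.

Lemma cnorm_small0 x (k : R) : (forall e : R, 0 < e -> cnorm x <= k * e) -> x = 0.
Proof.
move=> xe; apply: cnorm_eq0; apply/eqP; rewrite eq_le cnorm_ge0 andbT leNgt.
apply/negP => x0; have k0 : 0 < k.
  by have := xe 1 ltr01; rewrite mulr1; apply: lt_le_trans.
have := xe (cnorm x / (2 * k)) ltac:(by rewrite divr_gt0// mulr_gt0).
rewrite (_ : k * _ = cnorm x / 2); [lra | by field; rewrite gt_eqF].
Qed.

(* [b = (y + b^2) / 2] is solved by iterating a contraction of the ball of
   radius 1/2. *)
Lemma sqrt_one_sub y : star y = y -> cnorm y <= 3%:R / 4%:R ->
  exists2 b, star b = b & (1 - b) * (1 - b) = 1 - y.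
Proof.
move=> ys y34; pose h : C := 2^-1; pose F b := h *: (y + b * b).
have hn : nrc h = 2^-1.
  by apply: complexI; rewrite -nrcE /h normfV normr_nat [RHS]fmorphV rmorph_nat.
pose b := fix b n := if n is n'.+1 then F (b n') else 0.
have bs n : star (b n) = b n.
  elim: n => [|n IHn]; first exact: star0.
  rewrite /= /F starZ starD starM IHn ys; congr (_ *: _).
  by rewrite /h fmorphV rmorph_nat.
(* Half of 3/4 + 1/4 is 1/2, so the ball of radius 1/2 is stable; there F contracts with ratio
   1/2. *)
have b12 n : cnorm (b n) <= 2^-1.
  elim: n => [|n IHn]; first by rewrite cnorm0 invr_ge0.
  rewrite /= /F cnormZE hn; have := cnormD_le y (b n * b n).
  have := cnormM_le (b n) (b n); have := cnorm_ge0 (b n).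
  have : cnorm (b n) * cnorm (b n) <= 2^-1 * 2^-1 by rewrite ler_pM ?cnorm_ge0.
  lra.
have FB u v : cnorm (F u - F v) <= 2^-1 * ((cnorm u + cnorm v) * cnorm (u - v)).
  rewrite -scalerBr opprD addrACA subrr add0r cnormZE hn ler_wpM2l ?invr_ge0//.
  have -> : u * u - v * v = u * (u - v) + (u - v) * v.
    by rewrite mulrBr mulrBl addrA subrK.
  rewrite (le_trans (cnormD_le _ _))// [leRHS]mulrDl lerD ?cnormM_le//.
  by rewrite (le_trans (cnormM_le _ _))// mulrC.
have dist n : cnorm (b n.+1 - b n) <= 2^-1 ^+ n.
  elim: n => [|n IHn].
    by rewrite expr0 subr0 (le_trans (b12 1%N))// invf_le1// ler1n.
  rewrite (le_trans (FB _ _))// exprS ler_wpM2l ?invr_ge0//.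
  rewrite (le_trans _ IHn)// -[leRHS]mul1r ler_wpM2r ?cnorm_ge0//.
  have := b12 n; have := b12 n.+1; rewrite /=; lra.
have distm n m : cnorm (b (n + m)%N - b n) <= 2 * 2^-1 ^+ n.
  have H : cnorm (b (n + m)%N - b n) <= 2 * 2^-1 ^+ n - 2 * 2^-1 ^+ (n + m).
    elim: m => [|m IHm]; first by rewrite addn0 !subrr cnorm0.
    rewrite addnS -[b (n + m).+1](subrK (b (n + m)%N)) -addrA.
    rewrite (le_trans (cnormD_le _ _))// exprS.
    have := dist (n + m)%N; lra.
  by rewrite (le_trans H)// lerBlDr lerDl mulr_ge0 ?exprn_ge0 ?invr_ge0.
have small (e : R) : 0 < e -> exists N, forall n, (N <= n)%N -> 2 * 2^-1 ^+ n < e :> R.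
  move=> e0; pose N := Num.bound (2 / e); exists N => n Nn.
  rewrite exprVn ltr_pdivrMr ?exprn_gt0// -ltr_pdivrMl// mulrC.
  have : 2 / e < N%:R by apply: archi_boundP; rewrite divr_ge0// ltW.
  move=> /lt_le_trans; apply; rewrite -natrX ler_nat.
  by rewrite (leq_trans Nn)// ltnW// ltn_expl.
have [l lP] : exists l : A, (cnorm (b n - l) @[n --> \oo] --> (0 : R))%classic.
  apply: cnorm_complete => e e0; have [N NP] := small (e / 2) ltac:(by rewrite divr_gt0).
  exists N => m n Nm Nn.
  have H k : (N <= k)%N -> cnorm (b k - b N) < e / 2.
    by move=> Nk; rewrite -(subnKC Nk) (le_lt_trans (distm _ _))// NP.
  rewrite -[b m](subrK (b N)) -addrA (le_lt_trans (cnormD_le _ _))//.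
  by rewrite (splitr e) ltrD ?H// -cnormN opprB H.
have lsmall (e : R) : 0 < e -> exists n, cnorm (l - b n) <= e /\ cnorm (l - b n.+1) <= e.
  move=> e0; move/cvgrPdist_lt: lP => /(_ e e0)[N _ NP]; exists N.
  have H n : (N <= n)%N -> cnorm (l - b n) <= e.
    move=> /NP; rewrite /= sub0r normrN ger0_norm ?cnorm_ge0// => /ltW.
    by rewrite -cnormN opprB.
  by split; apply: H.
exists l.
  apply/eqP; rewrite -subr_eq0; apply/eqP; apply: (@cnorm_small0 _ 2) => e e0.
  have [n [ln _]] := lsmall e e0.
  rewrite -[star l](subrK (b n)) -addrA (le_trans (cnormD_le _ _))// mulr2n mulrDl mul1r.
  by rewrite lerD//; [rewrite -(bs n) -starN -starD cnorm_star | rewrite -cnormN opprB].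
have lF : l = F l.
  apply/eqP; rewrite -subr_eq0; apply/eqP.
  apply: (@cnorm_small0 _ (1 + 2^-1 * (cnorm l + 2^-1))) => e e0.
  have [n [ln ln1]] := lsmall e e0.
  rewrite -[l - F l](subrKA (b n.+1)) (le_trans (cnormD_le _ _))//.
  rewrite mulrDl mul1r lerD// -cnormN opprB (le_trans (FB _ _))//.
  rewrite -mulrA ler_wpM2l ?invr_ge0// ler_pM ?addr_ge0 ?cnorm_ge0//.
  by rewrite lerD2l.
rewrite mulrBl mul1r mulrBr mulr1 {1}lF.
have -> : y = h *: (y + l * l) + h *: (y + l * l) - l * l.
  rewrite -scalerDl (_ : h + h = 1) ?scale1r ?addrK//.
  by rewrite /h; field.
by rewrite -/(F l) -lF; move: (l * l) => ll; rewrite !opprD !opprK !addrA.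
Qed.

End CStarState.

(** * Boundedness of states *)

Section States.
Variables (R : realType) (P : cstarProbSpace R).
Notation C := R[i]%C.
Notation phi := (state P).
Implicit Types (x a : P).

Lemma star_psd : psd (fun x y : P => phi (star x * y)).
Proof. by apply: state_psd; [exact: starD | exact: starZ | exact: state_ge0]. Qed.

Lemma state_star x : phi (star x) = (phi x)^*.
Proof. by have := psd_herm 1 x star_psd; rewrite star1 mulr1 mul1r. Qed.

(** The element 1 - k x^* x is the square of the self-adjoint 1 - b, so its expectation is
    non-negative. The norm 3/4 allowed by [sqrt_one_sub] fixes k and yields the constant 4/3. *)
Lemma state_sq_le x : phi (star x * x) <= (4%:R / 3%:R * cnorm x ^+ 2)%:C%C.
Proof.
have [->|x0] := eqVneq x 0; first by rewrite mulr0 raddf0 cnorm0 expr0n mulr0.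
have n0 : 0 < cnorm x.
  rewrite lt0r cnorm_ge0 andbT; apply: contra x0 => /eqP x0; apply/eqP.
  exact: cnorm_eq0.
pose k : R := 3%:R / 4%:R / cnorm x ^+ 2.
have k0 : 0 < k by rewrite !divr_gt0// exprn_gt0.
have kn : nrc k%:C%C = k.
  by apply: complexI; rewrite -nrcE ger0_norm// ler0c ltW.
have [] := @sqrt_one_sub R P (k%:C%C *: (star x * x)).
- rewrite starZ starM starK; congr (_ *: _); apply/CrealP.
  by rewrite ger0_real// ler0c ltW.
- by rewrite cnormZE kn cnorm_star_mul /k divfK// expf_neq0// gt_eqF.
move=> b bs bE; have := state_ge0 (1 - b).
rewrite starD starN star1 bs bE raddfB /= state1 scalarZ subr_ge0 => H.
have kC : k%:C%C != 0 by rewrite -(rmorph0 (real_complex R)) (inj_eq (@complexI R)) gt_eqF.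
have -> : 4%:R / 3%:R * cnorm x ^+ 2 = k^-1.
  by rewrite /k; field; rewrite gt_eqF.
rewrite fmorphV -[leRHS]mulr1 /= ler_pdivlMl ?H//.
by rewrite ltcR.
Qed.

(** Cauchy-Schwarz against 1; the factor 2 is a round bound for the square root of 4/3, sufficient
    for exponential estimates. *)
Lemma state_le x : `|phi x| <= (2 * cnorm x)%:C%C.
Proof.
have l2x y : l2norm (@star R P) phi y ^+ 2 <= 4%:R / 3%:R * cnorm y ^+ 2.
  have := state_ge0 y; rewrite lecE => /andP[/eqP /= im re].
  rewrite /l2norm sqr_sqrtr//.
  by have := state_sq_le y; rewrite lecE => /andP[_].
have := @state_CS R P (@star R P) phi (@starD R P) (@starZ R P) (@state_ge0 R P) 1 x.
rewrite star1 mul1r => /le_trans; apply; rewrite lecR.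
have l1 : l2norm (@star R P) phi 1 = 1.
  by rewrite /l2norm star1 mulr1 state1 sqrtr1.
rewrite l1 mul1r -(@ler_pXn2r _ 2)// ?nnegrE ?sqrtr_ge0 ?mulr_ge0 ?cnorm_ge0//.
rewrite (le_trans (l2x x))// exprMn ler_wpM2r ?exprn_ge0 ?cnorm_ge0//.
by rewrite ler_pdivrMr// -natrX -natrM ler_nat.
Qed.

Lemma cnorm_star_pow a w : cnorm (star_pow a w) <= cnorm a ^+ size w.
Proof.
rewrite /star_pow; elim: w => [|l w IHw]; first by rewrite big_nil cnorm1.
rewrite big_cons (le_trans (cnormM_le _ _))//= exprS ler_pM ?cnorm_ge0//.
by case: l; rewrite ?cnorm_star.
Qed.

Lemma star_pow_cat a u v : star_pow a (u ++ v) = star_pow a u * star_pow a v.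
Proof. by rewrite /star_pow big_cat. Qed.

Lemma star_star_pow a w : star (star_pow a w) = star_pow a (rev (map negb w)).
Proof.
elim: w => [|l w IHw]; first by rewrite /star_pow !big_nil star1.
rewrite /= rev_cons -cats1 star_pow_cat -IHw /star_pow big_cons starM.
by congr (_ * _); rewrite big_seq1; case: l; rewrite //= starK.
Qed.

End States.

Section StarDistributions.
Variable R : realType.
Notation C := R[i]%C.
Implicit Types (mu nu : ncpoly R -> C) (m : seq bool -> C).

Definition wmom mu (w : seq bool) : C := mu (Zpow R w).

Lemma Zpow_nil : Zpow R [::] = 1.
Proof. by rewrite /Zpow big_nil. Qed.

Lemma wmom_star_pow (P : cstarProbSpace R) (a : P) mu w :
  is_star_distribution a mu -> wmom mu w = state P (star_pow a w).
Proof.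
move=> [_ mu1 muE]; case: w => [|l w]; last exact: muE.
by rewrite /wmom Zpow_nil mu1 /star_pow big_nil state1.
Qed.

Lemma star_distributionP (P : cstarProbSpace R) (a : P) mu : scalar mu ->
  (forall w, wmom mu w = state P (star_pow a w)) -> is_star_distribution a mu.
Proof.
move=> lin muE; split=> [//||w _]; last exact: muE.
by rewrite -Zpow_nil -/(wmom mu [::]) muE /star_pow big_nil state1.
Qed.

Lemma wmom_inj mu nu : scalar mu -> scalar nu -> wmom mu =1 wmom nu -> mu = nu.
Proof.
move=> lmu lnu mn; apply/funext => g.
have [L ->] := malg_span g.
have lin0 (f : ncpoly R -> C) : scalar f -> f 0 = 0.
  by move=> lf; have := lf (-1) 0 0; rewrite scaler0 addr0 mulN1r addNr.
elim: L => [|p L IH]; first by rewrite big_nil !lin0.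
rewrite big_cons lmu lnu IH; congr (_ * _ + _).
by have := mn p.2; rewrite /wmom ZpowE.
Qed.

Record admissible m : Prop := Admissible {
  adm1 : m [::] = 1;
  adm_psd : psd (fun u v => m (catrev (map negb u) v));
  adm_bnd : exists2 B : R, 0 < B & forall w, `|m w| <= (B ^+ size w)%:C%C
}.

Lemma Dc_admissible mu : Dc R mu -> scalar mu /\ admissible (wmom mu).
Proof.
move=> [P [a aD]]; have muE w := wmom_star_pow w aD.
case: (aD) => lin mu1 _; split=> //; split.
- by rewrite /wmom Zpow_nil.
- have := psd_pull (fun u => Some (star_pow a u)) (@star_psd R P).
  by apply: psd_ext => u v; rewrite muE catrevE star_pow_cat star_star_pow.
(* On non-empty words the factor 2 of [state_le] is absorbed by the power of 2; the added 1 makes B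
   positive. *)
- pose B := 2 * (cnorm a + 1); have B0 : 0 < B by rewrite mulr_gt0// ltr_wpDl ?cnorm_ge0.
  exists B => // -[|l w]; first by rewrite /wmom Zpow_nil mu1 normr1.
  rewrite muE (le_trans (state_le _))// lecR exprMn ler_pM ?cnorm_ge0//.
    by rewrite exprS ler_peMr// exprn_ege1// ler1n.
  rewrite (le_trans (cnorm_star_pow _ _))// lerXn2r ?nnegrE ?addr_ge0 ?cnorm_ge0//.
  by rewrite lerDl.
Qed.

Lemma star_pow_iota (P : cstarProbSpace R) (iota : bool -> P) w :
  (forall l, star (iota l) = iota (negb l)) ->
  star_pow (iota false) w = \prod_(l <- w) iota l.
Proof. by move=> iS; apply: eq_bigr => -[] _; rewrite ?iS. Qed.

Lemma admissible_Dc m : admissible m ->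
  exists mu, [/\ Dc R mu, scalar mu & wmom mu =1 m].
Proof.
move=> [m1 mP [B B0 mB]].
have [phi phiE] := @free_state_ex R bool m.
have phiZ w : wmom phi w = m w by rewrite /wmom ZpowE phiE.
exists phi; split=> //; last exact: scalarP.
have [P [iota [iS iM]]] := @gns R bool negb m B negbK m1 mP B0 mB.
exists P, (iota false); apply: star_distributionP; first exact: scalarP.
by move=> w; rewrite phiZ star_pow_iota// iM.
Qed.

End StarDistributions.

(** * Freeness *)

Lemma In_cat (T : Type) (s t : seq T) y :
  List.In y (s ++ t) -> List.In y s \/ List.In y t.
Proof.
by elim: s => [|x s IHs] /=; [right | case=> [|/IHs[]]; tauto].
Qed.

Lemma In_map (T T' : Type) (f : T -> T') (s : seq T) y :
  List.In y (map f s) -> exists2 x, List.In x s & y = f x.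
Proof.
elim: s => //= x s IHs [<-|/IHs[z zs ->]]; first by exists x => //; left.
by exists z => //; right.
Qed.

Lemma In_allpairs (T1 T2 T' : Type) (f : T1 -> T2 -> T') (s : seq T1) (t : seq T2) y :
  List.In y [seq f a b | a <- s, b <- t] ->
  exists a b, [/\ List.In a s, List.In b t & y = f a b].
Proof.
elim: s => //= a s IHs ys; have [H|H] := In_cat ys.
  by have [b bt yE] := In_map H; exists a, b; split=> //; left.
by have [a' [b [a's bt yE]]] := IHs H; exists a', b; split=> //; right.
Qed.

Lemma In_nth (T : Type) (d : T) s k : (k < size s)%N -> List.In (nth d s k) s.
Proof. by elim: s k => //= x s IHs [|k]; [left | right; apply: IHs]. Qed.

Lemma In_iota n k : List.In k (iota 0 n) -> (k < n)%N.
Proof.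
have H (s : seq nat) : List.In k s -> k \in s.
  by elim: s => //= x s IHs [->|/IHs ks]; rewrite inE ?eqxx// ks orbT.
by move=> /H; rewrite mem_iota.
Qed.

Section TwoColours.
Variables (R : realType) (P : cstarProbSpace R) (iota2 : bool * bool -> P).
Notation C := R[i]%C.
Notation X := (bool * bool)%type.
Notation poly := (seq (C * seq X)).
Implicit Types (L p q : poly) (w : seq X) (x y : P).

Definition ev_word w : P := \prod_(l <- w) iota2 l.
Definition ev L : P := \sum_(a <- L) a.1 *: ev_word a.2.

Lemma ev_word_cat v w : ev_word (v ++ w) = ev_word v * ev_word w.
Proof. exact: big_cat. Qed.

Lemma ev_mul p q : ev (polymul p q) = ev p * ev q.
Proof.
rewrite /ev /polymul big_allpairs_dep mulr_suml; apply: eq_bigr => a _.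
rewrite mulr_sumr; apply: eq_bigr => b _ /=.
by rewrite ev_word_cat -scalerAl -scalerAr scalerA.
Qed.

Definition polyprod (ps : seq (bool * poly)) : poly :=
  foldr (fun ip => polymul ip.2) [:: (1, [::])] ps.

Lemma ev_polyprod ps : ev (polyprod ps) = \prod_(ip <- ps) ev ip.2.
Proof.
elim: ps => [|ip ps IHps].
  by rewrite big_nil /ev big_seq1 scale1r /ev_word big_nil.
by rewrite big_cons -IHps -ev_mul.
Qed.

Definition letters (c : bool) : set P := [set iota2 (c, false); iota2 (c, true)]%classic.

Let coloured_poly c L := forall a, List.In a L -> coloured c a.2.

Lemma gen_alg_ev c x : gen_alg (letters c) x ->
  exists2 L, (forall a, List.In a L -> coloured c a.2) & x = ev L.
Proof.
move=> /(_ [set x | exists2 L, coloured_poly c L & x = ev L]%classic); apply; split.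
  split.
  - exists [:: (1, [::])]; last by rewrite /ev big_seq1 scale1r /ev_word big_nil.
    by move=> a [<-|//].
  - move=> _ _ [L Lc ->] [M Mc ->]; exists (L ++ M); last by rewrite /ev big_cat.
    by move=> a aLM; have [/Lc|/Mc] := In_cat aLM.
  - move=> d _ [L Lc ->]; exists [seq (d * a.1, a.2) | a <- L].
      by move=> a aL; have [b /Lc bc ->] := In_map aL.
    by rewrite /ev big_map scaler_sumr; apply: eq_bigr => a _; rewrite scalerA.
  - move=> _ _ [L Lc ->] [M Mc ->]; exists (polymul L M); last by rewrite ev_mul.
    move=> a aM; have [b [d [bL dM ->]]] := In_allpairs aM; rewrite /coloured /= all_cat.
    by apply/andP; split; [exact: Lc | exact: Mc].
have H l : exists2 L, coloured_poly c L & iota2 (c, l) = ev L.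
  exists [:: (1, [:: (c, l)])]; last by rewrite /ev big_seq1 scale1r /ev_word big_seq1.
  by move=> a [<-|//]; rewrite /coloured /= eqxx.
by move=> y [->|->]; apply: H.
Qed.

Lemma ev_gen_alg c L : coloured_poly c L -> gen_alg (letters c) (ev L).
Proof.
move=> Lc B [[B1 BD BZ BM] SB]; rewrite /ev.
have B0 : B 0 by rewrite -(scale0r (1 : P)); apply: BZ.
elim: L Lc => [|a L IHL] Lc; first by rewrite big_nil.
rewrite big_cons; apply: BD; last by apply: IHL => b bL; apply: Lc; right.
apply: BZ; have := Lc a (or_introl erefl); rewrite /coloured /ev_word.
elim: (a.2) => [|[d l] w IHw]; first by rewrite big_nil.
rewrite big_cons => /= /andP[/eqP -> /IHw wB]; apply: BM => //.
by apply: SB; case: l; [right | left].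
Qed.

Variable F : seq X -> C.
Hypothesis F_mixed : forall l r, ~~ monochrome l r -> F (l :: r) = 0.

(** Elements of the generated algebras are values of coloured polynomials, and for these the claim
    is [mom_poly_free]. *)
Lemma free_of_mom : (forall w, state P (ev_word w) = mom F w) -> free_sets letters.
Proof.
move=> stE n i x n0 xi x0 ii.
have stL L : state P (ev L) = mom_poly F L.
  by rewrite /ev raddf_sum; apply: eq_bigr => a _; rewrite /= scalarZ stE.
have ex k : exists L, (k < n)%N ->
    (forall a, List.In a L -> coloured (i k) a.2) /\ x k = ev L.
  have [kn|] := ltnP k n; last by exists [::].
  by have [L Lc xE] := gen_alg_ev (xi k kn); exists L.
pose L k := projT1 (cid (ex k)).
have LP k : (k < n)%N -> (forall a, List.In a (L k) -> coloured (i k) a.2) /\ x k = ev (L k).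
  by rewrite /L; case: cid.
pose ps := [seq (i k, L k) | k <- iota 0 n].
have -> : \prod_(k < n) x k = ev (polyprod ps).
  rewrite ev_polyprod /ps big_map -(big_mkord predT x) /index_iota subn0.
  by apply: eq_big_seq => k; rewrite mem_iota => /andP[_ kn]; case: (LP k kn).
rewrite stL; apply: mom_poly_free => //.
- by rewrite size_map size_iota.
- move=> ip ipps; have [k /In_iota kn ->] := In_map ipps; have [Lc xE] := LP k kn.
  by split=> //; rewrite -stL -xE x0.
- rewrite /ps sorted_map; apply/(sortedP 0) => k; rewrite size_iota => kn.
  by rewrite !nth_iota ?(ltnW kn)//=; apply/eqP; apply: ii.
Qed.

Let lin (D : seq X -> C) L : C := \sum_(a <- L) a.1 * D a.2.

Let lin_polymul D (p q : poly) :
  lin D (polymul p q) = lin (fun v => lin (fun u => D (u ++ v)) p) q.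
Proof.
rewrite /lin /polymul big_allpairs_dep exchange_big; apply: eq_bigr => b _.
by rewrite mulr_sumr; apply: eq_bigr => a _; rewrite mulrCA mulrA.
Qed.

Let alternating (ps : seq (bool * poly)) :=
  (forall ip, List.In ip ps -> coloured_poly ip.1 ip.2 /\ mom_poly F ip.2 = 0) /\
  sorted (fun ip jq : bool * poly => ip.1 != jq.1) ps.

Let centre (p : poly) : poly := rcons p (- mom_poly F p, [::]).

Let centre0 p : mom_poly F (centre p) = 0.
Proof.
by rewrite /centre /mom_poly -cats1 big_cat big_seq1 /= mulr1 subrr.
Qed.

Let centre_coloured c p : coloured_poly c p -> coloured_poly c (centre p).
Proof.
by move=> pc a; rewrite /centre -cats1 => ap; have [/pc//|[<-|//]] := In_cat ap.
Qed.

Let lin_centre D p q :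
  lin D (polymul p q) = lin D (polymul (centre p) q) + mom_poly F p * lin D q.
Proof.
rewrite !lin_polymul /centre -cats1.
rewrite [lin _ q in X in _ + X](_ : _ = lin (fun v => lin (fun u => D (u ++ v)) [:: (1, [::])]) q); last first.
  by apply: eq_bigr => a _; rewrite /lin big_seq1 mul1r.
rewrite /lin mulr_sumr -big_split; apply: eq_bigr => b _ /=.
by rewrite big_cat !big_seq1 /=; ring.
Qed.

(** A new letter on the left starts a factor or is absorbed by the first factor when the colours
    agree; recentring this factor leaves a multiple of a shorter product. The decomposition does not
    depend on D, so it serves for the state and for [mom F]. *)
Let word_span w : exists J : seq (C * seq (bool * poly)),
  (forall j, List.In j J -> alternating j.2) /\
  forall D, D w = \sum_(j <- J) j.1 * lin D (polyprod j.2).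
Proof.
elim: w => [|[c l] w [J [Jalt JD]]].
  exists [:: (1, [::])]; split=> [j [<-|//]|D]; first by split.
  by rewrite big_seq1 /lin big_seq1 !mul1r.
suff step ps : alternating ps -> exists J' : seq (C * seq (bool * poly)),
    (forall j, List.In j J' -> alternating j.2) /\
    forall D, lin (fun v => D ((c, l) :: v)) (polyprod ps) =
              \sum_(j <- J') j.1 * lin D (polyprod j.2).
  have [J' [J'alt J'D]] : exists J' : seq (C * seq (bool * poly)),
      (forall j, List.In j J' -> alternating j.2) /\
      forall D, \sum_(j <- J) j.1 * lin (fun v => D ((c, l) :: v)) (polyprod j.2) =
                \sum_(j <- J') j.1 * lin D (polyprod j.2).
    elim: J Jalt {JD} => [|j J IHJ] Jalt.
      by exists [::]; split=> // D; rewrite !big_nil.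
    have [J1 [J1alt J1D]] := IHJ (fun j' j'J => Jalt j' (or_intror j'J)).
    have [J2 [J2alt J2D]] := step _ (Jalt j (or_introl erefl)).
    exists ([seq (j.1 * k.1, k.2) | k <- J2] ++ J1); split.
      by move=> k kJ; have [kJ2|/J1alt//] := In_cat kJ; have [k' /J2alt k'alt ->] := In_map kJ2.
    move=> D; rewrite big_cons big_cat J1D J2D big_map mulr_sumr; congr (_ + _).
    by apply: eq_bigr => k _; rewrite mulrA.
  by exists J'; split=> // D; rewrite -J'D -(JD (fun v => D ((c, l) :: v))).
have lc : coloured_poly c [:: (1, [:: (c, l)])].
  by move=> a [<-|//]; rewrite /coloured /= eqxx.
have linl D p : lin (fun v => D ((c, l) :: v)) p = lin D (polymul [:: (1, [:: (c, l)])] p).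
  by rewrite lin_polymul; apply: eq_bigr => a _; rewrite /lin big_seq1 mul1r.
have new ps' : alternating ps' ->
    (if ps' is ip :: _ then ip.1 != c else true) -> forall p, coloured_poly c p ->
    exists J' : seq (C * seq (bool * poly)),
    (forall j, List.In j J' -> alternating j.2) /\
    forall D, lin D (polymul p (polyprod ps')) = \sum_(j <- J') j.1 * lin D (polyprod j.2).
  move=> [psP psS] hd p pc.
  exists [:: (1, (c, centre p) :: ps'); (mom_poly F p, ps')]; split.
    move=> j [<-|[<-|//]]; last by split.
    split=> [ip [<-|/psP//]|] /=; first by split; [exact: centre_coloured | exact: centre0].
    by case: (ps') hd psS => //= ip ps'' ipc ->; rewrite eq_sym ipc.
  by move=> D; rewrite big_cons big_seq1 /= mul1r lin_centre.
case: ps => [|[c' p] ps] [psP psS].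
  have alt0 : alternating [::] by split.
  have [J' [J'alt J'D]] := new [::] alt0 isT _ lc.
  by exists J'; split=> // D; rewrite linl J'D.
have altps : alternating ps.
  by split; [move=> ip ipps; apply: psP; right | case: (ps) psS => //= ip ps' /andP[]].
have [c'c|c'c] := eqVneq c' c.
  have [pc _] := psP _ (or_introl erefl); rewrite /= c'c in pc.
  have hd : is_true (if ps is ip :: _ then ip.1 != c else true).
    by case: (ps) psS => //= ip ps' /andP[]; rewrite c'c eq_sym.
  have ppc : coloured_poly c (polymul [:: (1, [:: (c, l)])] p).
    move=> a aM; have [b [d [[<-|//] dp ->]]] := In_allpairs aM; rewrite /coloured /= eqxx.
    exact: pc.
  have [J' [J'alt J'D]] := new ps altps hd _ ppc.
  exists J'; split=> // D; rewrite -J'D linl /= !lin_polymul.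
  apply: eq_bigr => a _; congr (_ * _).
  by rewrite lin_polymul; apply: eq_bigr => b _; rewrite /lin !big_seq1.
have [J' [J'alt J'D]] := new ((c', p) :: ps) (conj psP psS) c'c _ lc.
by exists J'; split=> // D; rewrite linl J'D.
Qed.

(** On alternating centred products the state vanishes by freeness and [mom F] by [mom_poly_free];
    the marginals ensure that both functionals centre a coloured polynomial alike. The empty product
    has value 1 for both. *)
Lemma mom_of_free : free_sets letters ->
  (forall c (w : seq bool), state P (ev_word [seq (c, l) | l <- w]) = mom F [seq (c, l) | l <- w]) ->
  forall w, state P (ev_word w) = mom F w.
Proof.
move=> fr marg w; have [J [Jalt JD]] := word_span w.
have marg' c v : coloured c v -> state P (ev_word v) = mom F v.
  move=> vc; suff vE : v = [seq (c, l) | l <- map snd v] by rewrite vE marg.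
  by elim: v vc => //= -[d l] v IHv /andP[/eqP /= -> /IHv <-].
have stL L : state P (ev L) = lin (fun v => state P (ev_word v)) L.
  by rewrite /ev raddf_sum; apply: eq_bigr => a _; rewrite /= scalarZ.
rewrite (JD (fun v => state P (ev_word v))) (JD (mom F)).
elim: J Jalt {JD} => [|j J IHJ] Jalt; first by rewrite !big_nil.
rewrite !big_cons IHJ => [|k kJ]; last by apply: Jalt; right.
congr (_ * _ + _); rewrite -stL.
have [jP jS] := Jalt j (or_introl erefl).
case: (j.2) jP jS => [|ip ps] jP jS.
  by rewrite /polyprod /lin !big_seq1 /= /ev big_seq1 scale1r /ev_word big_nil state1 mul1r.
rewrite [RHS](_ : _ = 0); last exact: mom_poly_free.
rewrite ev_polyprod; set qs := ip :: ps.
pose d : bool * poly := (false, [::]).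
rewrite (big_nth d) big_mkord.
apply: (fr (size qs) (fun k => (nth d qs k).1) (fun k => ev (nth d qs k).2)) => //.
- by move=> k kn; apply: ev_gen_alg; apply: (jP _ (In_nth d kn)).1.
- move=> k kn; have [kc k0] := jP _ (In_nth d kn); rewrite stL -[RHS]k0; rewrite /lin /mom_poly.
  elim: (nth d qs k).2 kc => [|a L IHL] kc; first by rewrite !big_nil.
  rewrite !big_cons IHL => [|b bL]; last by apply: kc; right.
  by rewrite (marg' _ _ (kc a (or_introl erefl))).
- move=> k kn; apply/eqP.
  by have /(sortedP d)/(_ k kn) := jS.
Qed.

End TwoColours.

(** * Free convolution *)

Section FreeModel.
Variable R : realType.
Notation C := R[i]%C.
Notation X := (bool * bool)%type.
Implicit Types (k : seq bool -> C) (f : bool -> seq bool -> C) (mu nu : ncpoly R -> C).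

(* The cumulants of infinitely divisible *-distributions. *)
Record levy k : Prop := Levy {
  levy_herm : forall l w, k (catrev (map negb (l :: w)) [::]) = (k (l :: w))^*;
  levy_psd : cond_psd negb k;
  levy_bnd : exists2 B : R, 0 < B &
    forall l w, `|k (l :: w)| <= (B ^+ (size w).+1)%:C%C
}.

Lemma levyZ k (t : R) : 0 <= t -> levy k -> levy (fun w => t%:C%C * k w).
Proof.
move=> t0 [kh kP [B B0 kB]]; split.
- move=> l w; rewrite kh rmorphM /=; congr (_ * _).
  by apply/esym/CrealP; rewrite ger0_real// ler0c.
- by apply: psdZ kP; rewrite ler0c.
(* The scalar t is below every positive power of t + 1, hence absorbed in the rate. *)
- exists ((t + 1) * B) => [|l w]; first by rewrite mulr_gt0// ltr_wpDl.
  rewrite normrM ger0_norm ?ler0c// exprMn rmorphM /=.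
  apply: ler_pM; [by rewrite ler0c | exact: normr_ge0 | rewrite lecR | exact: kB].
  by rewrite (@le_trans _ _ (t + 1)) ?lerDl// ler_eXnr// lerDr.
Qed.

Definition flip (x : X) : X := (x.1, ~~ x.2).

Let flipK : involutive flip.
Proof. by case=> c l; rewrite /flip /= negbK. Qed.

(** Both summands are pullbacks, so positivity follows from [psd_pull]; agreement with [fcol] is
    used on non-empty words. *)
Let fsum f (w : seq X) : C :=
  (if coloured false w then f false (map snd w) else 0) +
  (if coloured true w then f true (map snd w) else 0).

Let fcolE f x r : fcol f (x :: r) = fsum f (x :: r).
Proof.
case: x => c l; rewrite /fcol /fsum /monochrome /coloured /=.
by case: c; rewrite /= ?add0r ?addr0.
Qed.

Let coloured_catrev c (u v : seq X) :
  coloured c (catrev (map flip u) v) = coloured c u && coloured c v.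
Proof.
rewrite catrevE /coloured all_cat all_rev all_map.
by congr (_ && _); apply: eq_all => -[].
Qed.

Let snd_catrev (u v : seq X) :
  map snd (catrev (map flip u) v) = catrev (map negb (map snd u)) (map snd v).
Proof.
rewrite !catrevE map_cat map_rev -!map_comp; congr (_ ++ _); congr rev.
Qed.

Let fcol_catrev f x r (v : seq X) : fcol f (catrev (map flip (x :: r)) v) =
  fsum f (catrev (map flip (x :: r)) v).
Proof.
case E: (catrev _ _) => [|y s]; last exact: fcolE.
by have := congr1 size E; rewrite catrevE size_cat size_rev /=.
Qed.

Lemma free_model f : (forall c, levy (f c)) ->
  exists (P : cstarProbSpace R) (iota2 : X -> P),
    [/\ forall c l, star (iota2 (c, l)) = iota2 (c, ~~ l),
        forall w, state P (ev_word iota2 w) = mom (fcol f) w &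
        free_sets (letters iota2)].
Proof.
move=> fL.
have herm x r : fcol f (catrev (map flip (x :: r)) [::]) = (fcol f (x :: r))^*.
  rewrite fcol_catrev fcolE /fsum !coloured_catrev !andbT snd_catrev rmorphD.
  by congr (_ + _); case: ifP => _; rewrite ?rmorph0//= (levy_herm (fL _)).
have psdF : cond_psd flip (fcol f).
  pose phi c (a : X * seq X) : option (bool * seq bool) :=
    if coloured c (a.1 :: a.2) then Some (a.1.2, map snd a.2) else None.
  have := psdD (psd_pull (phi false) (levy_psd (fL false)))
               (psd_pull (phi true) (levy_psd (fL true))).
  apply: psd_ext => -[x r] [y s]; rewrite fcol_catrev /fsum !coloured_catrev.
  rewrite !snd_catrev /phi /=.
  by congr (_ + _); do 2 (case: ifP => _ //).
have [B0 B00 fB0] := levy_bnd (fL false); have [B1 B10 fB1] := levy_bnd (fL true).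
pose B := B0 + B1; have Bp : 0 < B by rewrite addr_gt0.
have fB x r : `|fcol f (x :: r)| <= B%:C%C ^+ (size r).+1.
  rewrite -rmorphXn /=; case: x => c l; rewrite /fcol; case: ifP => _; last first.
    by rewrite normr0 ler0c exprn_ge0// ltW.
  rewrite (_ : (size r).+1 = (size (map snd r)).+1) ?size_map//=.
  case: c; [apply: le_trans (fB1 _ _) _ | apply: le_trans (fB0 _ _) _].
    by rewrite lecR size_map lerXn2r ?nnegrE ?ltW// ltrDr.
  by rewrite lecR size_map lerXn2r ?nnegrE ?ltW// ltrDl.
have B4 : 0 < 4%:R * B by rewrite mulr_gt0.
have [] := @gns R X flip (mom (fcol f)) (4%:R * B) flipK erefl (mom_psd herm psdF) B4.
  move=> w; have BC : 0 <= B%:C%C :> C by rewrite ler0c ltW.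
  rewrite (le_trans (mom_bound BC fB w))// rmorphXn rmorphM rmorph_nat.
  exact: lexx.
move=> P [iota2 [iS iM]]; exists P, iota2; split=> //.
apply: (@free_of_mom _ _ _ (fcol f)); last by move=> w; exact: iM.
by move=> x r /negbTE xr; rewrite /fcol xr.
Qed.

Lemma functional_ex (m : seq bool -> C) : exists mu, scalar mu /\ wmom mu =1 m.
Proof.
have [phi phiE] := @free_state_ex R bool m.
by exists phi; split; [exact: scalarP | move=> w; rewrite /wmom ZpowE phiE].
Qed.

Definition functional (m : seq bool -> C) : ncpoly R -> C := projT1 (cid (functional_ex m)).

Lemma functional_scalar m : scalar (functional m).
Proof. exact: (projT2 (cid (functional_ex m))).1. Qed.

Lemma wmom_functional m : wmom (functional m) =1 m.
Proof. exact: (projT2 (cid (functional_ex m))).2. Qed.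

Lemma state_colsum (P : cstarProbSpace R) (iota2 : X -> P) (w : seq bool) :
  state P (\prod_(l <- w) (iota2 (false, l) + iota2 (true, l))) =
  colsum (fun v => state P (ev_word iota2 v)) w.
Proof.
suff H w' x : state P (x * \prod_(l <- w') (iota2 (false, l) + iota2 (true, l))) =
    colsum (fun v => state P (x * ev_word iota2 v)) w'.
  by rewrite -[X in state P X]mul1r H; congr colsum; apply/funext => v; rewrite mul1r.
elim: w' x => [|l w' IHw] x; first by rewrite /= big_nil /ev_word big_nil.
rewrite big_cons mulrDl mulrDr raddfD /= !mulrA !IHw; congr (_ + _).
  by congr colsum; apply/funext => v; rewrite /dword /ev_word big_cons mulrA.
by congr colsum; apply/funext => v; rewrite /dword /ev_word big_cons mulrA.
Qed.

Lemma star_pow_letters (P : cstarProbSpace R) (iota2 : X -> P) c (w : seq bool) :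
  (forall l, star (iota2 (c, l)) = iota2 (c, ~~ l)) ->
  star_pow (iota2 (c, false)) w = ev_word iota2 [seq (c, l) | l <- w].
Proof.
move=> iS; rewrite /star_pow /ev_word big_map; apply: eq_bigr => -[] _ //.
Qed.

Lemma star_pow_sum (P : cstarProbSpace R) (iota2 : X -> P) (w : seq bool) :
  (forall c l, star (iota2 (c, l)) = iota2 (c, ~~ l)) ->
  star_pow (iota2 (false, false) + iota2 (true, false)) w =
  \prod_(l <- w) (iota2 (false, l) + iota2 (true, l)).
Proof.
move=> iS; rewrite /star_pow; apply: eq_bigr => -[] _ //.
by rewrite starD !iS.
Qed.

Lemma star_free_letters (P : cstarProbSpace R) (iota2 : X -> P) :
  (forall c l, star (iota2 (c, l)) = iota2 (c, ~~ l)) ->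
  star_free (iota2 (false, false)) (iota2 (true, false)) =
  free_sets (letters iota2).
Proof.
move=> iS; rewrite /star_free; congr free_sets; apply/funext => c.
by rewrite /letters !iS; case: c.
Qed.

Lemma levy_boxplus k0 k1 : levy k0 -> levy k1 ->
  [/\ Dc R (functional (mom k0)), Dc R (functional (mom k1)) &
   is_boxplus (functional (mom k0)) (functional (mom k1))
     (functional (mom (fun w => k0 w + k1 w)))].
Proof.
move=> k0L k1L; pose f (c : bool) := if c then k1 else k0.
have [] := @free_model f; first by case.
move=> P [iota2 [iS iM iF]].
have marg c : is_star_distribution (iota2 (c, false)) (functional (mom (f c))).
  apply: star_distributionP; first exact: functional_scalar.
  by move=> w; rewrite wmom_functional star_pow_letters// iM mom_colres.
split; [by exists P, (iota2 (false, false)); exact: marg |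
        by exists P, (iota2 (true, false)); exact: marg | ].
exists P, (iota2 (false, false)), (iota2 (true, false)).
split; [by rewrite star_free_letters | exact: (marg false) | exact: (marg true) | ].
apply: star_distributionP; first exact: functional_scalar.
move=> w; rewrite wmom_functional star_pow_sum// state_colsum.
rewrite -(mom_colsum f); congr colsum; apply/funext => v.
by rewrite iM.
Qed.

Lemma is_R_transform_mom mu g : wmom mu [::] = 1 ->
  is_R_transform mu g <-> g [::] = 0 /\ wmom mu =1 mom g.
Proof.
move=> mu1; split=> -[g0 gE]; split=> //.
  move=> w; have [->|w0] := eqVneq w [::]; first by rewrite mu1.
  by rewrite /wmom gE// (noncrossing_sum _ (mom_free g)).
by move=> w w0; rewrite (noncrossing_sum _ (mom_free g)) -gE.
Qed.

Lemma R_transform_mom mu : wmom mu [::] = 1 -> wmom mu =1 mom (R_transform mu).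
Proof. by move=> mu1; have /(is_R_transform_mom _ mu1)[] := R_transformP mu. Qed.

Lemma R_transform_nil mu : R_transform mu [::] = 0.
Proof. by have [] := R_transformP mu. Qed.

Lemma R_transform_eq mu g : g [::] = 0 -> wmom mu =1 mom g -> R_transform mu = g.
Proof.
move=> g0 muE; apply: R_transformE; apply/is_R_transform_mom => //.
Qed.

(** Freeness and the two marginals fix all joint moments, so they are those of the coloured Fock
    model, where the cumulants of the sum are the sum of the cumulants. *)
Lemma boxplus_R mu mu' rho : is_boxplus mu mu' rho ->
  R_transform rho = R_transform mu + R_transform mu'.
Proof.
move=> [P [a [a' [fr aD aD' aS]]]].
pose iota2 (x : X) : P := if x.1 then (if x.2 then star a' else a')
                          else (if x.2 then star a else a).
have iS c l : star (iota2 (c, l)) = iota2 (c, ~~ l).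
  by case: c; case: l; rewrite /iota2 //= starK.
pose f (c : bool) := if c then R_transform mu' else R_transform mu.
have d1 (b : P) m : is_star_distribution b m -> wmom m [::] = 1.
  by move=> [_ m1 _]; rewrite /wmom Zpow_nil.
have marg c (w : seq bool) : state P (ev_word iota2 [seq (c, l) | l <- w]) =
    mom (fcol f) [seq (c, l) | l <- w].
  rewrite -star_pow_letters// mom_colres; case: c => /=.
    by rewrite -(R_transform_mom (d1 _ _ aD')) (wmom_star_pow _ aD').
  by rewrite -(R_transform_mom (d1 _ _ aD)) (wmom_star_pow _ aD).
have all w : state P (ev_word iota2 w) = mom (fcol f) w.
  apply: mom_of_free => //.
    by move=> x r /negbTE xr; rewrite /fcol xr.
  by rewrite -star_free_letters.
apply: R_transform_eq; first by rewrite ncs_addE !R_transform_nil addr0.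
move=> w; rewrite (wmom_star_pow _ aS) (star_pow_sum (iota2 := iota2))// state_colsum.
rewrite -(mom_colsum f); congr colsum; apply/funext => v.
exact: all.
Qed.

Lemma boxplus_iter_R mu j rho : is_boxplus_iter mu j rho ->
  forall w, R_transform rho w = j.+1%:R * R_transform mu w.
Proof.
elim: j rho => [|j IHj] rho /=; first by move=> -> w; rewrite mul1r.
move=> [sigma /IHj sE /boxplus_R ->] w.
by rewrite ncs_addE sE -[j.+2]addn1 natrD mulrDl mul1r.
Qed.

Lemma levy_infdiv k : levy k -> Dc_infdiv R (functional (mom k)).
Proof.
move=> kL; split; first by have [] := levy_boxplus kL kL.
move=> n n0; pose kn j : seq bool -> C := fun w => (j%:R / n%:R)%:C%C * k w.
have knL j : levy (kn j) by apply: levyZ => //; rewrite divr_ge0.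
exists (functional (mom (kn 1%N))); first by have [] := levy_boxplus (knL 1%N) kL.
(* Index j means j + 1 summands, each with cumulants k/n. *)
have iterP j : is_boxplus_iter (functional (mom (kn 1%N))) j (functional (mom (kn j.+1))).
  elim: j => // j IHj; exists (functional (mom (kn j.+1))) => //.
  have [_ _] := levy_boxplus (knL j.+1) (knL 1%N).
  congr is_boxplus; congr (functional (mom _)); apply/funext => w.
  by rewrite /kn -mulrDl -rmorphD -mulrDl -natrD addn1.
have := iterP n.-1; rewrite prednK//.
congr is_boxplus_iter; congr (functional (mom _)); apply/funext => w.
by rewrite /kn mulfV ?mul1r// pnatr_eq0 -lt0n.
Qed.

End FreeModel.

(** * Limits *)

Section Limits.
Variable R : realType.
Notation C := R[i]%C.

Let small_real (a D : R) : 0 <= D ->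
  (forall n, (0 < n)%N -> a <= D / n%:R) -> a <= 0.
Proof.
move=> D0 aD; rewrite leNgt; apply/negP => a0.
pose n := (Num.bound (D / a)).+1.
have Dn : D / a < n%:R.
  apply: lt_trans (_ : (Num.bound (D / a))%:R < n%:R); last by rewrite ltr_nat.
  by apply: archi_boundP; rewrite divr_ge0// ltW.
have := aD n isT; rewrite ler_pdivlMr ?ltr0n// leNgt => /negP; apply.
by rewrite mulrC -ltr_pdivrMr.
Qed.

Lemma small_eq0 (z : C) (D : R) : 0 <= D ->
  (forall n, (0 < n)%N -> `|z| <= (D / n%:R)%:C%C) -> z = 0.
Proof.
move=> D0 zD; apply/eqP; rewrite -normr_le0 nrcE lecR.
by apply: (small_real D0) => n n0; rewrite -lecR -nrcE zD.
Qed.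

Lemma ge0_approx (z : C) (D : R) : 0 <= D ->
  (forall n, (0 < n)%N -> exists2 y, 0 <= y & `|z - y| <= (D / n%:R)%:C%C) -> 0 <= z.
Proof.
move=> D0 zD.
have split_y n : (0 < n)%N ->
    `|complex.Im z| <= D / n%:R /\ - complex.Re z <= D / n%:R.
  move=> n0; have [y y0 zy] := zD n n0.
  have ny : nrc (z - y) <= D / n%:R by rewrite -lecR -nrcE.
  have := y0; rewrite lecE => /andP[/eqP /= yi yr].
  have zi : complex.Im (z - y) = complex.Im z.
    by move: yi; case: (z) => a b; case: (y) => c d /= ->; rewrite oppr0 addr0.
  have zr : complex.Re (z - y) = complex.Re z - complex.Re y.
    by case: (z) => a b; case: (y) => c d.
  split; first by rewrite -zi (le_trans (Im_nrc _)).
  have := le_trans (Re_nrc (z - y)) ny; rewrite zr ler_norml => /andP[+ _].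
  lra.
rewrite lecE; apply/andP; split => /=.
  rewrite -normr_eq0 eq_le normr_ge0 andbT.
  by apply: (small_real D0) => n /split_y[].
by rewrite -oppr_le0; apply: (small_real D0) => n /split_y[].
Qed.

(** Each value of the form is a finite sum, so the constant D may depend on the pair of points. *)
Lemma psd_limit (T : Type) (k : T -> T -> C) (kn : nat -> T -> T -> C) :
  (forall x y, exists2 D : R, 0 <= D & forall n, (0 < n)%N ->
     `|kn n x y - k x y| <= (D / n%:R)%:C%C) ->
  (forall n, (0 < n)%N -> psd (kn n)) -> psd k.
Proof.
move=> kD knP L.
pose D x y := s2val (cid2 (kD x y)).
have D0 x y : 0 <= D x y by rewrite /D; case: cid2.
have DP x y n : (0 < n)%N -> `|kn n x y - k x y| <= (D x y / n%:R)%:C%C.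
  by rewrite /D; case: cid2 => d /= _ dP; exact: dP.
pose E := \sum_(p <- L) \sum_(q <- L) nrc p.1 * nrc q.1 * D p.2 q.2.
apply: (@ge0_approx _ E) => [|n n0].
  by apply: sumr_ge0 => p _; apply: sumr_ge0 => q _; rewrite !mulr_ge0 ?nrc_ge0.
exists (kform (kn n) L); first exact: knP.
rewrite /kform -sumrB (le_trans (ler_norm_sum _ _ _))// /E mulr_suml rmorph_sum.
apply: ler_sum => p _; rewrite -sumrB (le_trans (ler_norm_sum _ _ _))//.
rewrite mulr_suml rmorph_sum; apply: ler_sum => q _.
rewrite -mulrBr !normrM norm_conjC distrC /=.
have -> : (nrc p.1 * nrc q.1 * D p.2 q.2 / n%:R)%:C%C =
    `|p.1| * `|q.1| * (D p.2 q.2 / n%:R)%:C%C.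
  by rewrite !nrcE -!rmorphM -!mulrA.
by rewrite ler_wpM2l ?mulr_ge0 ?DP.
Qed.

(** A partition with j blocks enters with the factor n^(1 - j): one block gives k itself, and all
    others are of order 1/n. *)
Lemma mom_scale_approx (k : seq bool -> C) w : w != [::] ->
  exists2 D : R, 0 <= D & forall n, (0 < n)%N ->
    `|n%:R * mom (fun v => (n%:R^-1)%:C%C * k v) w - k w| <= (D / n%:R)%:C%C.
Proof.
move=> w0; pose one := [set [set: 'I_(size w)]]%SET.
pose wt (P : {set {set 'I_(size w)}}) := \prod_(B in P) k (subword B).
have sumE n : mom (fun v => (n%:R^-1)%:C%C * k v) w =
    \sum_(P in NC (size w)) (n%:R^-1)%:C%C ^+ #|P| * wt P.
  rewrite -(noncrossing_sum _ (mom_free _)); apply: eq_bigr => P _.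
  by rewrite big_split prodr_const.
exists (\sum_(P in NC (size w) | P != one) nrc (wt P)).
  by apply: sumr_ge0 => P _; apply: nrc_ge0.
move=> n n0; rewrite sumE (bigD1 one)/=; last by apply: NC_setT; rewrite lt0n size_eq0.
rewrite cards1 expr1 /wt big_set1 subwordT mulrDr mulrA.
have nC : (n%:R^-1)%:C%C = n%:R^-1 :> C by rewrite fmorphV rmorph_nat.
have nn : n%:R != 0 :> C by rewrite pnatr_eq0 -lt0n.
rewrite nC mulfV// mul1r addrAC subrr add0r mulr_sumr.
rewrite (le_trans (ler_norm_sum _ _ _))// mulr_suml rmorph_sum.
apply: ler_sum => P /andP[PN P1]; rewrite mulrA normrM rmorphM /= -nrcE mulrC.
rewrite ler_wpM2l// nC.
have P2 : (1 < #|P|)%N.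
  rewrite ltnNge; apply: contra P1 => P1.
  move: PN; rewrite inE => /andP[/and3P[/eqP cP _ nP] _].
  have [B PB] : exists B, P = [set B]%SET.
    apply/finset.cards1P; rewrite eqn_leq P1 lt0n finset.cards_eq0.
    apply: contra w0 => /eqP P0; rewrite -size_eq0 -[size w]card_ord -cardsT -cP P0.
    by rewrite /finset.cover big_set0 finset.cards0.
  by move: cP; rewrite PB /finset.cover big_set1 => ->.
case: #|P| P2 => [|[|j]] // _; rewrite exprS mulrA mulfV// mul1r exprS normrM.
rewrite normfV normr_nat -[leRHS]mulr1 ler_wpM2l ?invr_ge0//.
by rewrite normrX normfV normr_nat exprn_ile1// ?invr_ge0// invf_le1 ?ler1n ?ltr0n.
Qed.

End Limits.

(** * Cumulant bounds and prescribed eta-series *)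

Section Series.
Variable R : realType.
Notation C := R[i]%C.
Notation word := (seq bool).

Lemma conv_ncs (f g : ncseries C) : conv f g = (f * g : ncseries C).
Proof. by apply/funext => w; rewrite convE. Qed.

Lemma conv_inv (f : ncseries C) : f [::] = 1 -> exists g : ncseries C,
  [/\ g [::] = 1, g * f = 1 & f * g = 1].
Proof.
move=> f1; have fU : f \is a GRing.unit.
  have -> : f = 1 + (f - 1) by rewrite addrC subrK.
  by apply: ncs_unit1D; rewrite ncs_addE ncs_oppE f1 ncs_oneE subrr.
exists f^-1; rewrite mulVr ?mulrV//; split=> //.
have := congr1 (fun h : ncseries C => h [::]) (mulVr fU).
by rewrite ncs_mulE big_ord1 /= f1 mulr1 ncs_oneE.
Qed.

Lemma delta0_ncs : @delta0 C bool = (1 : ncseries C).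
Proof. by apply/funext => w; rewrite ncs_oneE; case: w. Qed.

(** The moments A have rate B, the inverse V of A rate 2B, the moments with cumulants V rate 8B, and
    the inverse of the latter, which is 1 plus the cumulants, rate 16B. *)
Lemma levy_bnd_of_mom (k : word -> C) (B : R) : 0 < B ->
  (forall w, `|mom k w| <= (B ^+ size w)%:C%C) ->
  exists2 B' : R, 0 < B' & forall l w, `|k (l :: w)| <= (B' ^+ (size w).+1)%:C%C.
Proof.
move=> B0 AB; pose A : ncseries C := mom k.
have [V [V1 VA AV]] := @conv_inv A erefl.
have BC : 0 <= B%:C%C :> C by rewrite ler0c ltW.
have VB w : `|V w| <= (2 * B%:C%C) ^+ size w.
  apply: (inv_bound BC (f := A)) => //.
    by move=> v; rewrite conv_ncs AV delta0_ncs.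
  by move=> v; rewrite -rmorphXn; exact: AB.
have B2 : 0 <= 2 * B%:C%C :> C by rewrite mulr_ge0.
have GB := mom_bound B2 (fun l v => VB (l :: v)).
(* [free_moments_inv] wants constant term 1, whereas [mom] reads non-empty words only. *)
pose f : word -> C := fun w => if w is [::] then 1 else k w.
have fA : free_moments f A by split=> // l w; exact: (mom_free k).2.
have Gf : conv (mom V) f =1 @delta0 C bool.
  apply: (free_moments_inv _ V1 fA) => //; last exact: mom_free.
  by move=> w; rewrite conv_ncs VA delta0_ncs.
have B8 : 0 <= 4%:R * (2 * B%:C%C) :> C by rewrite mulr_ge0.
have fB := inv_bound B8 (mom_nil V) Gf GB.
exists (2 * (4%:R * (2 * B))) => [|l w]; first by rewrite !mulr_gt0.
by rewrite (le_trans (fB (l :: w)))// rmorphXn !rmorphM !rmorph_nat.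
Qed.

(** For A = (1 - k)^-1 one has A - 1 = k A, so A is a moment series whose eta-series is k. *)
Lemma levy_boolean (k : ncseries C) : levy k -> k [::] = 0 ->
  exists2 mu : ncpoly R -> C, Dc R mu & eta_series mu = k.
Proof.
move=> [kh kP [B B0 kB]] k0.
have f1 : ((1 : ncseries C) - k) [::] = 1.
  by rewrite ncs_addE ncs_oppE k0 ncs_oneE subr0.
have [A [A1 AV VA]] := conv_inv f1.
have Ak : A = 1 + k * A.
  by apply/eqP; rewrite -subr_eq; apply/eqP; rewrite -VA mulrBl mul1r.
have bA : boolean_moments k A.
  split=> // l w; rewrite {1}Ak ncs_addE ncs_oneE add0r -conv_ncs /= k0 mul0r addr0.
  by [].
have BC : 0 <= B%:C%C :> C by rewrite ler0c ltW.
have adA : admissible A.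
  split=> //; first exact: boolean_psd bA.
  exists (2 * B) => [|w]; first by rewrite mulr_gt0.
  have := inv_bound BC (f := 1 - k) (g := A) f1 _ _ w.
  rewrite rmorphXn rmorphM rmorph_nat; apply.
    by move=> v; rewrite conv_ncs VA delta0_ncs.
  move=> [|l v]; first by rewrite f1 normr1.
  by rewrite ncs_addE ncs_oppE ncs_oneE sub0r normrN -rmorphXn; exact: kB.
have [mu [muD lin muA]] := admissible_Dc adA; exists mu => //.
have MA : 1 + moment_series mu = A.
  apply/funext => -[|l w]; rewrite ncs_addE ncs_oneE /moment_series /= ?A1 ?addr0//.
  by rewrite add0r -muA.
have AU : A \is a GRing.unit by rewrite -MA; apply: ncs_unit1D.
apply: (mulIr AU); rewrite -[in LHS]MA eta_seriesM.
by apply: (addrI 1); rewrite MA -Ak.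
Qed.

End Series.

(** * The eta-series *)

Section LevyEta.
Variables (R : realType) (P : cstarProbSpace R) (a : P) (mu : ncpoly R -> R[i]%C).
Notation C := R[i]%C.
Notation word := (seq bool).
Notation phi := (state P).
Hypothesis aD : is_star_distribution a mu.

Let m : word -> C := wmom mu.
Let k : word -> C := eta_series mu.

Let letter (l : bool) : P := if l then star a else a.

Let letter_star l : star (letter l) = letter (~~ l).
Proof. by case: l => //=; rewrite starK. Qed.

(* [centred (l :: v)] is [letter l * centred v], minus its expectation: what the
   product of the letters contributes to the complement of the scalars when the
   scalars are projected out at every step. *)
Fixpoint centred (v : seq bool) : P :=
  if v is l :: v' then
    letter l * centred v' - phi (letter l * centred v') *: 1
  else 1.
Arguments centred : simpl never.

Let centred_cons l v :
  centred (l :: v) = letter l * centred v - phi (letter l * centred v) *: 1.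
Proof. by []. Qed.

Let phi_centred l v : phi (centred (l :: v)) = 0.
Proof. by rewrite centred_cons raddfB /= scalarZ state1 mulr1 subrr. Qed.

(** Splitting a_l b_u into b_(l u) and its expectation turns the first letter into the two terms of
    [conv]. *)
Let phi_pow x w :
  phi (x * star_pow a w) = conv (fun u => phi (x * centred u)) m w.
Proof.
elim: w x => [|l w IHw] x.
  by rewrite /star_pow big_nil /= /m (wmom_star_pow _ aD) /star_pow big_nil state1 !mulr1.
have powE : star_pow a (l :: w) = letter l * star_pow a w.
  by rewrite /star_pow big_cons.
have mE : m (l :: w) = conv (fun u => phi (letter l * centred u)) m w.
  by rewrite -IHw -powE /m (wmom_star_pow _ aD).
rewrite powE mulrA IHw [RHS]/= mE -convZl -convDl; apply: conv_ext => // u.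
rewrite /dword centred_cons mulrBr raddfB /= mulr1 -scalerAr mulr1 scalarZ mulrA.
by rewrite [phi x * _]mulrC subrK.
Qed.

Let k0 : k [::] = 0.
Proof.
have := congr1 (fun h : ncseries C => h [::]) (eta_seriesM mu).
rewrite ncs_mulE big_ord1 /= ncs_addE ncs_oneE /moment_series /= addr0 mulr1.
exact.
Qed.

Let mE : 1 + moment_series mu = m :> ncseries C.
Proof.
apply/funext => -[|l w]; rewrite ncs_addE ncs_oneE /moment_series /=.
  by case: aD => _ mu1 _; rewrite /m /wmom Zpow_nil mu1 addr0.
by rewrite add0r.
Qed.

Let k_boolean : boolean_moments k m.
Proof.
split=> [|l w]; first by rewrite -mE ncs_addE ncs_oneE /moment_series addr0.
have := congr1 (fun h : ncseries C => h (l :: w)) (eta_seriesM mu).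
rewrite mE -conv_ncs /= -/k k0 mul0r addr0 => ->.
by [].
Qed.

(** As series in v, both sides multiplied by m give m(l w), by [phi_pow] and by the boolean
    equation; m is invertible. *)
Let phi_letter l v : phi (letter l * centred v) = k (l :: v).
Proof.
have m1 : (m : ncseries C) [::] = 1 by have [] := k_boolean.
have [V [V1 Vm mV]] := conv_inv m1.
pose f : ncseries C := fun v => phi (letter l * centred v).
pose g : ncseries C := dword l k.
suff /(congr1 (fun h : ncseries C => h v)) : f = g by [].
rewrite -[f]mulr1 -[g]mulr1 -mV !mulrA; congr (_ * V).
apply/funext => w; rewrite -!conv_ncs.
have [_ <-] := k_boolean; rewrite -phi_pow /m (wmom_star_pow _ aD).
by rewrite /star_pow big_cons.
Qed.

(** Letters of u pass to the right factor as adjoints; the expectations subtracted on either side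
    contribute nothing, since [centred] of a non-empty word has expectation 0. *)
Let gram u x v : phi (star (centred u) * centred (x :: v)) =
  if u is [::] then 0 else k (catrev (map negb u) (x :: v)).
Proof.
elim: u x v => [|l u IHu] x v; first by rewrite {1}/centred star1 mul1r phi_centred.
rewrite (centred_cons l) starD starN starZ star1 starM letter_star mulrBl raddfB /=.
rewrite -scalerAl mul1r scalarZ phi_centred mulr0 subr0 -mulrA.
case: u IHu => [|y u] IHu; first by rewrite [centred [::]]/centred star1 mul1r phi_letter.
have -> : letter (~~ l) * centred (x :: v) = centred (~~ l :: x :: v) +
    phi (letter (~~ l) * centred (x :: v)) *: 1.
  by rewrite [centred (~~ l :: _)]centred_cons subrK.
rewrite mulrDr raddfD /= IHu -scalerAr mulr1 scalarZ state_star phi_centred.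
by rewrite conjC0 mulr0 addr0.
Qed.

Lemma levy_eta : levy (eta_series mu).
Proof.
split.
- move=> l [|x w].
    (* Single letters are out of reach of [gram]; there symmetry is that of the state. *)
    have ll l' : k [:: l'] = phi (letter l') by rewrite -phi_letter mulr1.
    by rewrite /= -/k !ll -state_star letter_star.
  have kl : k (l :: x :: w) = phi (star (centred [:: ~~ l]) * centred (x :: w)).
    by rewrite gram /= negbK.
  rewrite -/k kl (psd_herm _ _ (@star_psd R P)) conjCK.
  by rewrite gram.
- have := psd_pull (fun b : bool * word => Some (centred (b.1 :: b.2))) (@star_psd R P).
  by apply: psd_ext => -[x r] [y s]; rewrite gram.
have [_ [_ _ [B B0 mB]]] := Dc_admissible (ex_intro _ P (ex_intro _ a aD)).
have m1 : m [::] = 1 by have [] := k_boolean.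
have [V [V1 Vm mV]] := @conv_inv R m m1.
(* The eta-series is 1 - m^-1, so its bound is that of an inverse. *)
have kV : k = 1 - V.
  have mU : (m : ncseries C) \is a GRing.unit by rewrite -mE; apply: ncs_unit1D.
  apply: (mulIr mU); rewrite mulrBl Vm mul1r.
  by rewrite -[in LHS]mE eta_seriesM -mE addrAC subrr add0r.
have BC : 0 <= B%:C%C :> C by rewrite ler0c ltW.
exists (2 * B) => [|l w]; first by rewrite mulr_gt0.
rewrite -/k kV ncs_addE ncs_oppE ncs_oneE sub0r normrN rmorphXn rmorphM rmorph_nat.
apply: (inv_bound BC (f := m) (g := V) m1 _ _ (l :: w)) => v.
  by rewrite conv_ncs mV delta0_ncs.
by rewrite -rmorphXn; exact: mB.
Qed.

End LevyEta.

(** * Infinite divisibility and the bijection *)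

Section InfinitelyDivisible.
Variable R : realType.
Notation C := R[i]%C.

Lemma levy_of_infdiv (nu : ncpoly R -> C) : Dc_infdiv R nu -> levy (R_transform nu).
Proof.
move=> [nuD nuI]; set k := R_transform nu.
pose kn n : seq bool -> C := mom (fun v => (n%:R^-1)%:C%C * k v).
(* By additivity the n-th root of nu has cumulants k/n, so [kn n] is its moment functional. *)
have knP n : (0 < n)%N -> admissible (kn n).
  move=> n0; have [mu muD /boxplus_iter_R muE] := nuI n n0.
  have [_ adm] := Dc_admissible muD.
  suff -> : kn n = wmom mu by [].
  apply/funext => w; rewrite (R_transform_mom (adm1 adm)); congr (mom _ _).
  apply/funext => v; rewrite /k muE prednK// mulrA fmorphV rmorph_nat mulVf ?mul1r//.
  by rewrite pnatr_eq0 -lt0n.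
have knk w : w != [::] -> exists2 D : R, 0 <= D &
    forall n, (0 < n)%N -> `|n%:R * kn n w - k w| <= (D / n%:R)%:C%C.
  exact: mom_scale_approx.
have catrev_neq0 l (u v : seq bool) : catrev (map negb (l :: u)) v != [::].
  by rewrite -size_eq0 catrevE size_cat size_rev size_map.
split.
- move=> l w; apply/eqP; rewrite -subr_eq0; apply/eqP.
  have [D D0 kD] := knk _ (catrev_neq0 l w [::]).
  have [D' D'0 kD'] := knk (l :: w) isT.
  apply: (@small_eq0 _ _ (D + D')) => [|n n0]; first exact: addr_ge0.
  have knH : kn n (catrev (map negb (l :: w)) [::]) = (kn n (l :: w))^*.
    rewrite -[in RHS](cats0 (l :: w)).
    have := psd_herm (l :: w) [::] (adm_psd (knP n n0)).
    by rewrite cats0 /= => ->; rewrite conjCK.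
  set x := k (catrev _ _); set y := k (l :: w).
  have -> : x - y^* = (n%:R * kn n (l :: w) - y)^*
      - (n%:R * kn n (catrev (map negb (l :: w)) [::]) - x).
    rewrite knH rmorphB rmorphM /= conjC_nat; ring.
  rewrite (le_trans (ler_normB _ _))// norm_conjC addrC mulrDl rmorphD.
  by rewrite lerD ?kD ?kD'.
- apply: (psd_limit (kn := fun n (x y : bool * seq bool) => n%:R *
    kn n (catrev (map negb (x.1 :: x.2)) (y.1 :: y.2)))) => [x y|n n0].
    by apply: knk; exact: catrev_neq0.
  (* The moments of the root are positive on all words; restriction to non-empty ones is where n
     [kn n] approximates k. *)
  apply: psdZ => //.
  have := psd_pull (fun x : bool * seq bool => Some (x.1 :: x.2)) (adm_psd (knP n n0)).
  exact.
(* The constants in [knk] depend on the word, so the bound is taken from nu. *)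
- have [_ [nu1 _ [B B0 nuB]]] := Dc_admissible nuD.
  by apply: (levy_bnd_of_mom B0) => w; rewrite -R_transform_mom.
Qed.

Lemma R_transform_inj (mu nu : ncpoly R -> C) : Dc R mu -> Dc R nu ->
  R_transform mu = R_transform nu -> mu = nu.
Proof.
move=> /Dc_admissible[lmu [mu1 _ _]] /Dc_admissible[lnu [nu1 _ _]] mn.
by apply: wmom_inj => // w; rewrite (R_transform_mom mu1) (R_transform_mom nu1) mn.
Qed.

(** The series 1 - eta is the inverse of 1 + M, so eta determines all moments. *)
Lemma eta_series_inj (mu nu : ncpoly R -> C) : Dc R mu -> Dc R nu ->
  eta_series mu = eta_series nu -> mu = nu.
Proof.
move=> /Dc_admissible[lmu [mu1 _ _]] /Dc_admissible[lnu [nu1 _ _]] mn.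
have etaE rho : (1 - eta_series rho) * (1 + @moment_series R rho) = 1.
  by rewrite mulrBl mul1r eta_seriesM addrK.
have MU rho : (1 + @moment_series R rho) \is a GRing.unit by exact: ncs_unit1D.
have EU : 1 - eta_series mu \is a GRing.unit.
  by rewrite -(unitrMl _ (MU mu)) etaE unitr1.
have MM : 1 + moment_series mu = 1 + moment_series nu.
  by apply: (mulrI EU); rewrite etaE mn etaE.
apply: wmom_inj => // -[|l w]; first by rewrite mu1 nu1.
have := congr1 (fun h : ncseries C => h (l :: w)) MM.
by rewrite !ncs_addE /moment_series /= => /addrI.
Qed.

End InfinitelyDivisible.

Theorem theorem4p2 (R : realType) :
  (forall mu : ncpoly R -> R[i]%C, Dc R mu ->
     exists! nu : ncpoly R -> R[i]%C,
       Dc_infdiv R nu /\ R_transform nu = eta_series mu)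
  /\
  exists BB : Dc R -> Dc_infdiv R,
    unique (fun B : Dc R -> Dc_infdiv R =>
              forall mu : Dc R, R_transform (val (B mu)) = eta_series (val mu)) BB
    /\ bijective BB.
Proof.
have eta0 (mu : ncpoly R -> R[i]%C) : eta_series mu [::] = 0.
  by rewrite -(R_transform_nil mu) (R_transform_nil mu) /eta_series ncs_mulE big_ord1 mul0r.
have ex mu : Dc R mu -> exists2 nu, Dc_infdiv R nu & R_transform nu = eta_series mu.
  move=> muD; have [P [a aD]] := muD; have kL := levy_eta aD.
  exists (functional (mom (eta_series mu))); first exact: levy_infdiv.
  by apply: R_transform_eq => // w; rewrite wmom_functional.
have uniq nu nu' : Dc_infdiv R nu -> Dc_infdiv R nu' ->
    R_transform nu = R_transform nu' -> nu = nu'.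
  by move=> [nuD _] [nuD' _]; exact: R_transform_inj.
split.
  move=> mu /ex[nu nuI nuE]; exists nu; split=> // nu' [nuI' nuE'].
  by apply: uniq => //; rewrite nuE nuE'.
have exB (mu : Dc R) : exists nu : Dc_infdiv R, R_transform (val nu) = eta_series (val mu).
  have [nu nuI nuE] := ex _ (set_valP mu).
  by exists (exist _ nu (mem_set nuI)).
(* Surjectivity: the cumulants of nu satisfy [levy], hence also form an eta-series. *)
have exV (nu : Dc_infdiv R) : exists mu : Dc R, R_transform (val nu) = eta_series (val mu).
  have nuI := set_valP nu.
  have [mu muD muE] := levy_boolean (levy_of_infdiv nuI) (R_transform_nil _).
  by exists (exist _ mu (mem_set muD)).
pose BB mu := sval (cid (exB mu)).
have BBE mu : R_transform (val (BB mu)) = eta_series (val mu) by rewrite /BB; case: cid.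
exists BB; split.
  split=> // B BE; apply/funext => mu; apply: val_inj; apply: uniq.
  - exact: set_valP.
  - exact: set_valP.
  - by rewrite BBE BE.
exists (fun nu => sval (cid (exV nu))) => [mu|nu]; apply: val_inj.
  case: cid => mu' /= mu'E; apply: eta_series_inj; try exact: set_valP.
  by rewrite -mu'E BBE.
case: cid => mu /= muE; apply: uniq; try exact: set_valP.
by rewrite BBE.
Qed.
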